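(* Let $a:\mathbb R\to\mathbb R$ satisfy $a\in C^2(\mathbb R)$, $\inf_{r\in\mathbb R}a(r)>0$ and $\sup_{r\in\mathbb R}\{|a'(r)|,|a''(r)|\}<\infty$. Let $y_0\in L^2_+(0,1)$ with $y_0\not\equiv 0$, and let $\omega$ be a fixed proper (non-empty, open) subinterval of $(0,1)$. For $T>0$ and $u\in L^\infty(Q_T)$, denote by $y_{y_0,u,\omega}$ the solution of $$\begin{cases} y_t-(a(y)y_x)_x=u(x,t)\,y(x,t)\,\chi_{\omega}(x) & \text{in } Q_T,\\ y(0,t)=y(1,t)=0 & \text{in } (0,T),\\ y(x,0)=y_0(x) & \text{in } (0,1).\end{cases}$$ Then, for any $T>0$, the set $$F_{y_0,\omega}(T):=\left\{y_{y_0,u,\omega}(\cdot,T): u\in L^\infty(Q_T)\right\}$$ is not dense in $L^2_+(0,1)$ (with respect to the $L^2(0,1)$ norm).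
   Context: $Q_T:=(0,1)\times(0,T)$. $L^2_+(0,1)=\{\phi\in L^2(0,1):\phi(x)\ge 0 \text{ a.e. in }(0,1)\}$. $\chi_\omega$ is the characteristic function of $\omega$; the control support is static, i.e. it is the same interval $\omega$ for all $t\in(0,T)$. Solutions are understood in the weak sense, in the class $L^2(0,T;H^1_0(0,1))\cap C([0,T];L^2(0,1))$. *)

(* Defs.v *)
From mathcomp Require Import all_boot all_order all_algebra.
From mathcomp Require Import all_classical all_reals all_analysis.

Set Implicit Arguments.
Unset Strict Implicit.
Unset Printing Implicit Defensive.

Import Order.TTheory GRing.Theory Num.Theory.
Import numFieldNormedType.Exports.

Local Open Scope ring_scope.
Local Open Scope classical_set_scope.

Section Defs.
Context {R : realType}.

Notation mu := (@lebesgue_measure R).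
Notation mu2 := (@lebesgue_measure R \x @lebesgue_measure R)%E.

Definition I01 : set R := `]0, 1[.

Definition QT (T : R) : set (R * R) := I01 `*` `]0, T[.

Definition Ck (k : nat) (f : R -> R) : Prop :=
  (forall j, (j < k)%N -> forall x, derivable (f^`(j)) x 1) /\
  continuous (f^`(k)).

Definition Ccinfty (phi : R -> R) : Prop :=
  (forall k, Ck k phi) /\
  exists K : set R,
    [/\ compact K, K `<=` I01 & forall x, ~ K x -> phi x = 0].

(* Elements of L^2(0,1) are represented by functions on R whose values off
   (0,1) are irrelevant; equality in L^2(0,1) is equality a.e. in (0,1). *)
Definition L2 (f : R -> R) : Prop := f \_ I01 \in Lfun mu 2%:E.

Definition distL2 (f g : R -> R) : \bar R :=
  ('N[mu]_2%:E [EFin \o ((f \- g)%R \_ I01)])%E.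

Definition L2plus (f : R -> R) : Prop :=
  L2 f /\ {ae mu, forall x, I01 x -> 0 <= f x}.

Definition L2zero (f : R -> R) : Prop :=
  {ae mu, forall x, I01 x -> f x = 0}.

Definition dense_in_L2plus (F : set (R -> R)) : Prop :=
  forall g, L2plus g -> forall e : R, 0 < e ->
    exists2 f, F f & (distL2 f g < e%:E)%E.

Definition weak_deriv (f g : R -> R) : Prop :=
  forall phi, Ccinfty phi ->
    \int[mu]_(x in I01) (f x * phi^`()%classic x) =
    - \int[mu]_(x in I01) (g x * phi x).

(* f belongs to H^1_0(0,1), the closure of C_c^oo(0,1) in H^1(0,1), and its
   weak derivative is g. *)
Definition H10 (f g : R -> R) : Prop :=
  [/\ L2 f, L2 g, weak_deriv f g &
    forall e : R, 0 < e -> exists phi,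
      [/\ Ccinfty phi, (distL2 phi f < e%:E)%E &
          (distL2 (phi^`()) g < e%:E)%E]].

(* Functions on Q_T take the pair (x, t), space variable first.
   y belongs to L^2(0,T;H^1_0(0,1)), with spatial weak derivative yx. *)
Definition L2H10 (T : R) (y yx : R * R -> R) : Prop :=
  [/\ y \_ (QT T) \in Lfun mu2 2%:E,
      yx \_ (QT T) \in Lfun mu2 2%:E &
      {ae mu, forall t, `]0, T[%classic t ->
        H10 (fun x => y (x, t)) (fun x => yx (x, t))}].

Definition CL2 (T : R) (y : R * R -> R) : Prop :=
  (forall t, `[0, T]%classic t -> L2 (fun x => y (x, t))) /\
  (forall t, `[0, T]%classic t -> forall e : R, 0 < e ->
    \forall s \near within `[0, T] (nbhs t),
      (distL2 (fun x => y (x, s)) (fun x => y (x, t)) < e%:E)%E).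

Definition Linfty (T : R) (u : R * R -> R) : Prop :=
  u \_ (QT T) \in Lfun mu2 +oo%E.

Definition Dx (eta : R * R -> R) (p : R * R) : R := 'D_((1, 0) : R * R) eta p.
Definition Dt (eta : R * R -> R) (p : R * R) : R := 'D_((0, 1) : R * R) eta p.

(* Restrictions to [0,1] x [0,T] of C^1 functions on R^2 are exactly the
   functions that are C^1 up to the boundary. *)
Definition test_function (T : R) (eta : R * R -> R) : Prop :=
  [/\ forall p, derivable eta p (1, 0) /\ derivable eta p (0, 1),
      continuous (Dx eta), continuous (Dt eta) &
      forall t, `[0, T]%classic t -> eta (0, t) = 0 /\ eta (1, t) = 0].

(* Weak solution of y_t - (a(y) y_x)_x = u y \1_omega in Q_T with homogeneous
   Dirichlet conditions (encoded by H^1_0) and initial datum y0. When a' is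
   bounded, a grows at most linearly, so a(y) y_x is in L^1(Q_T) and all the
   integrals below converge for C^1 test functions. *)
Definition weak_solution (a : R -> R) (T : R) (y0 : R -> R)
    (u : R * R -> R) (omega : set R) (y : R * R -> R) : Prop :=
  exists yx : R * R -> R,
  [/\ L2H10 T y yx, CL2 T y, L2zero (fun x => y (x, 0) - y0 x) &
    forall eta, test_function T eta -> forall t, `[0, T]%classic t ->
      \int[mu]_(x in I01) (y (x, t) * eta (x, t))
      - \int[mu]_(x in I01) (y0 x * eta (x, 0))
      - \int[mu2]_(p in QT t) (y p * Dt eta p)
      + \int[mu2]_(p in QT t) (a (y p) * yx p * Dx eta p)
      = \int[mu2]_(p in QT t) (u p * y p * \1_omega p.1 * eta p)].

Definition reachable (a : R -> R) (y0 : R -> R) (omega : set R) (T : R) :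
    set (R -> R) :=
  [set f | exists u y, [/\ Linfty T u, weak_solution a T y0 u omega y &
                           f = fun x => y (x, T)]].

End Defs.

(* Main.v *)
Require Import Defs.
From mathcomp Require Import all_boot all_order all_algebra.
From mathcomp Require Import all_classical all_reals all_analysis.
From mathcomp Require Import measurable_realfun ring lra zify.
Import Order.TTheory GRing.Theory Num.Theory.
Import numFieldNormedType.Exports.
Local Open Scope ring_scope.
Local Open Scope classical_set_scope.

(** With A the primitive of a, the equation reads y_t - A(y)_xx = u y 1_omega.
Since omega is a proper subinterval, it misses some ]p, q[ in (0,1), and no
control acts there.  Take two zones of ]p, q[ on either side of its middle.  If
y(T) is small in both zones, then each zone contains a point at which the time
integral of A(y) is bounded by a constant depending only on a, T and the zones.
Testing with the trapezoid supported between two such points bounds the mass of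
y(T) in the middle by that of y0 plus this constant.  Hence a nonnegative target
that vanishes in the zones and has a large mass in the middle stays at a positive
distance from the reachable set.

For the zone estimate, min(y,1) is a supersolution; testing it with a quartic
bump shows that smallness of y(T) forces y <= 1 somewhere in the zone at every
earlier time.  The concave truncation F(y) with F' = (1 + A)^(-1/4), tested with
a tent, then controls the Dirichlet energy of (1 + A(y))^(3/8), and with it the
time integral of A(y) over the zone.

Weak solutions are not regular enough for these nonlinear tests, so they are
carried out on a monotone explicit Euler scheme.  Testing the weak formulation
with quadratic B-splines, whose second derivative is constant on each cell, gives
the scheme up to a consistency error, and a discrete H^-1 energy estimate compares
the scheme with y. *)

(** * Square-integrable functions *)

(** The control may be arbitrarily large, so the constants of the estimates must not see [u] or the
    behaviour of y inside [omega]. They are carried backward from time T, where closeness to the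
    target is known. Concave functions of y make this possible: they satisfy the uncontrolled
    equation as supersolutions, so a tent-weighted mass of F(y) can only increase in time, apart
    from a loss at the apex of the tent. Its final value then bounds all earlier values and the
    whole dissipation. The apex loss is absorbed by the dissipation as soon as y <= 1 at some nearby
    point.

    The exponent 1/4 comes from the growth of A, at most quadratic because a' is bounded: it makes
    (1 + A)^(1/4) at most a multiple of 1 + F. Then 1 + A is the product of (1 + A)^(3/4), whose
    supremum the dissipation controls, and (1 + A)^(1/4), whose integral the mass of F controls.

    The bound of [u] only decides how fine the grid must be. Closeness in H^-1 is enough because the
    tents and the trapezoid, the only functions paired with y(T), are Lipschitz. *)

Section SquareIntegrable.
Context {d : measure_display} {X : measurableType d} {R : realType}.
Variable mu : {measure set X -> \bar R}.
Implicit Types (D E : set X) (f g : X -> R).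

Definition rint D f := mu.-integrable D (EFin \o f).

Definition sqint D f := measurable_fun D f /\ rint D (fun x => f x ^+ 2).

Lemma rint_meas {D f} : rint D f -> measurable_fun D f.
Proof. by move=> /integrableP[/measurable_EFinP]. Qed.

Lemma rint_le {D f} g : measurable D -> measurable_fun D f -> rint D g ->
  (forall x, D x -> `|f x| <= g x) -> rint D f.
Proof.
move=> mD mf ig fg; apply: le_integrable ig => //; first exact/measurable_EFinP.
by move=> x Dx /=; rewrite lee_fin; apply: le_trans (fg _ Dx) (ler_norm _).
Qed.

Lemma rintD {D f g} : measurable D -> rint D f -> rint D g ->
  rint D (fun x => f x + g x).
Proof. by move=> mD hf hg; exact: (integrableD mD hf hg). Qed.

Lemma rintB {D f g} : measurable D -> rint D f -> rint D g ->
  rint D (fun x => f x - g x).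
Proof. by move=> mD hf hg; exact: (integrableB mD hf hg). Qed.

Lemma rintZ {D f} k : measurable D -> rint D f -> rint D (fun x => k * f x).
Proof. by move=> mD hf; exact: (integrableZl mD k hf). Qed.

Lemma rint_norm {D f} : rint D f -> rint D (fun x => `|f x|).
Proof. exact: integrable_norm. Qed.

Lemma rintS {D E f} : measurable D -> measurable E -> E `<=` D -> rint D f -> rint E f.
Proof. by move=> mD mE ED; exact: integrableS. Qed.

Lemma eq_rint {D} f {g} : measurable D -> (forall x, D x -> f x = g x) -> rint D f -> rint D g.
Proof.
by move=> mD fg; apply: eq_integrable => // x; rewrite inE => Dx /=; rewrite fg.
Qed.

Lemma rint_cst {D} k : measurable D -> (mu D < +oo)%E -> rint D (fun=> k).
Proof.
move=> mD Doo; apply/integrableP; split; first exact/measurable_EFinP.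
rewrite (_ : (fun x => _) = cst `|k|%:E)//= integral_cst//= lte_mul_pinfty//.
Qed.

Lemma rintM_bdd {D f g} (M : R) : measurable D -> measurable_fun D g ->
  (forall x, D x -> `|g x| <= M) -> rint D f -> rint D (fun x => g x * f x).
Proof.
move=> mD mg gM hf; apply: (rint_le (fun x => M * `|f x|)) => //.
- by apply: measurable_funM => //; exact: rint_meas.
- by apply: rintZ => //; exact: rint_norm.
- by move=> x Dx; rewrite normrM ler_wpM2r// gM.
Qed.

Lemma sqint_meas {D f} : sqint D f -> measurable_fun D f.
Proof. by case. Qed.

Lemma sqintM {D f g} : measurable D -> sqint D f -> sqint D g ->
  rint D (fun x => f x * g x).
Proof.
move=> mD [mf f2] [mg g2]; apply: (rint_le (fun x => f x ^+ 2 + g x ^+ 2)) => //.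
- exact: measurable_funM.
- exact: rintD.
- move=> x _; rewrite normrM -(real_normK (num_real (f x))).
  rewrite -(real_normK (num_real (g x))).
  move: `|f x| `|g x| (normr_ge0 (f x)) (normr_ge0 (g x)) => a b a0 b0; nra.
Qed.

Lemma sqint_le {D f} g : measurable D -> measurable_fun D f -> sqint D g ->
  (forall x, D x -> `|f x| <= g x) -> sqint D f.
Proof.
move=> mD mf [mg g2] fg; split => //.
apply: (rint_le _ mD _ g2); first exact: measurable_funX.
move=> x Dx; rewrite ger0_norm ?sqr_ge0// -(real_normK (num_real (f x))).
by rewrite ler_sqr ?fg ?nnegrE// (le_trans _ (fg x Dx)).
Qed.

Lemma sqintD {D f g} : measurable D -> sqint D f -> sqint D g ->
  sqint D (fun x => f x + g x).
Proof.
move=> mD hf hg; have [mf f2] := hf; have [mg g2] := hg.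
split; first exact: measurable_funD.
apply: (eq_rint (fun x => f x ^+ 2 + g x ^+ 2 + 2 * (f x * g x))) => //.
  by move=> x _; ring.
by apply: rintD => //; [exact: rintD|apply: rintZ => //; exact: sqintM].
Qed.

Lemma sqintZ {D f} k : measurable D -> sqint D f -> sqint D (fun x => k * f x).
Proof.
move=> mD [mf f2]; split; first exact: measurable_funM.
apply: (eq_rint (fun x => k ^+ 2 * f x ^+ 2)) => //; last exact: rintZ.
by move=> x _; rewrite exprMn.
Qed.

Lemma sqintB {D f g} : measurable D -> sqint D f -> sqint D g ->
  sqint D (fun x => f x - g x).
Proof.
move=> mD hf /(sqintZ (-1) mD) hg.
by have := sqintD mD hf hg; congr sqint; apply/funext => x; rewrite mulN1r.
Qed.

Lemma sqint_cst {D} k : measurable D -> (mu D < +oo)%E -> sqint D (fun=> k).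
Proof. by move=> mD Doo; split => //; exact: rint_cst. Qed.

Lemma sqint_rint {D f} : measurable D -> (mu D < +oo)%E -> sqint D f -> rint D f.
Proof.
move=> mD Doo hf; have := sqintM mD hf (sqint_cst 1 mD Doo).
by congr rint; apply/funext => x; rewrite mulr1.
Qed.

Lemma sqintS {D E f} : measurable D -> measurable E -> E `<=` D -> sqint D f -> sqint E f.
Proof.
move=> mD mE ED [mf f2]; split; last exact: (rintS mD).
exact: measurable_funS mf.
Qed.

Lemma sqintM_bdd {D f g} (M : R) : measurable D -> measurable_fun D g ->
  (forall x, D x -> `|g x| <= M) -> sqint D f -> sqint D (fun x => g x * f x).
Proof.
move=> mD mg gM [mf f2]; split; first exact: measurable_funM.
apply: (eq_rint (fun x => g x ^+ 2 * f x ^+ 2)) => //; first by move=> x _; rewrite exprMn.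
apply: (@rintM_bdd _ _ _ (M ^+ 2)) => //; first exact: measurable_funX.
move=> x Dx; rewrite normrX ler_sqr ?gM ?nnegrE//.
by rewrite (le_trans _ (gM x Dx)).
Qed.

Lemma Rint_sqr_ge0 D f : 0 <= \int[mu]_(x in D) (f x ^+ 2).
Proof. by apply: Rintegral_ge0 => x _; exact: sqr_ge0. Qed.

Lemma eq_Rint_in D f g : (forall x, D x -> f x = g x) ->
  \int[mu]_(x in D) f x = \int[mu]_(x in D) g x.
Proof. by move=> fg; apply: eq_Rintegral => x; rewrite inE; exact: fg. Qed.

Lemma sqr_disc (A B C : R) : 0 <= A -> 0 <= C ->
  (forall t, 0 <= A + 2 * t * B + t ^+ 2 * C) -> B ^+ 2 <= A * C.
Proof.
move=> A0 C0 h; have [C00|C0'] := eqVneq C 0.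
  have [->|B0] := eqVneq B 0; first by rewrite C00 expr0n mulr0.
  (* With [C] zero the polynomial is affine in [t], and this [t] gives it the value -1. *)
  have := h (- (A + 1) / (2 * B)); rewrite C00 mulr0 addr0.
  have -> : 2 * (- (A + 1) / (2 * B)) * B = - (A + 1) by field.
  by rewrite opprD addrA subrr add0r oppr_ge0 leNgt ltr01.
have Cp : 0 < C by rewrite lt_def C0'.
have := h (- B / C); have -> : A + 2 * (- B / C) * B + (- B / C) ^+ 2 * C = A - B ^+ 2 / C.
  by field.
by rewrite subr_ge0 ler_pdivrMr.
Qed.

Lemma cauchy_schwarz {D f g} : measurable D -> sqint D f -> sqint D g ->
  (\int[mu]_(x in D) (f x * g x)) ^+ 2 <=
  \int[mu]_(x in D) (f x ^+ 2) * \int[mu]_(x in D) (g x ^+ 2).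
Proof.
move=> mD hf hg; have [mf f2] := hf; have [mg g2] := hg.
apply: sqr_disc; [exact: Rint_sqr_ge0|exact: Rint_sqr_ge0|move=> t].
have ifg := sqintM mD hf hg.
rewrite -RintegralZl// -RintegralZl// -RintegralD//; last exact: rintZ.
rewrite -RintegralD//; [|by apply: rintD => //; exact: rintZ|exact: rintZ].
apply: Rintegral_ge0 => x _.
rewrite [leRHS](_ : _ = (f x + t * g x) ^+ 2) ?sqr_ge0//; ring.
Qed.

Definition nrm D f := Num.sqrt (\int[mu]_(x in D) (f x ^+ 2)).

Lemma nrm_ge0 D f : 0 <= nrm D f. Proof. exact: sqrtr_ge0. Qed.

Lemma nrm_sqr D f : nrm D f ^+ 2 = \int[mu]_(x in D) (f x ^+ 2).
Proof. by rewrite sqr_sqrtr// Rint_sqr_ge0. Qed.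

Lemma cauchy_schwarz_nrm {D f g} : measurable D -> sqint D f -> sqint D g ->
  `|\int[mu]_(x in D) (f x * g x)| <= nrm D f * nrm D g.
Proof.
move=> mD hf hg; rewrite -ler_sqr ?nnegrE ?mulr_ge0 ?nrm_ge0//.
by rewrite exprMn !nrm_sqr real_normK ?num_real// cauchy_schwarz.
Qed.

Lemma nrmD {D f g} : measurable D -> sqint D f -> sqint D g ->
  nrm D (fun x => f x + g x) <= nrm D f + nrm D g.
Proof.
move=> mD hf hg; have [mf f2] := hf; have [mg g2] := hg.
have ifg := sqintM mD hf hg.
rewrite -ler_sqr ?nnegrE ?addr_ge0 ?nrm_ge0// nrm_sqr sqrrD !nrm_sqr.
have -> : \int[mu]_(x in D) ((f x + g x) ^+ 2) =
   \int[mu]_(x in D) (f x ^+ 2) + 2 * \int[mu]_(x in D) (f x * g x)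
   + \int[mu]_(x in D) (g x ^+ 2).
  rewrite -RintegralZl// -RintegralD//; last exact: rintZ.
  rewrite -RintegralD//; last by apply: rintD => //; exact: rintZ.
  by apply: eq_Rint_in => x _; ring.
rewrite lerD2r lerD2l -[leRHS]mulr_natl ler_pM2l//.
by rewrite (le_trans (ler_norm _))// cauchy_schwarz_nrm.
Qed.

Lemma nrmZ {D f} k : measurable D -> sqint D f ->
  nrm D (fun x => k * f x) = `|k| * nrm D f.
Proof.
move=> mD [mf f2]; rewrite /nrm.
have -> : \int[mu]_(x in D) ((k * f x) ^+ 2) = k ^+ 2 * \int[mu]_(x in D) (f x ^+ 2).
  by rewrite -RintegralZl//; apply: eq_Rint_in => x _; rewrite exprMn.
by rewrite sqrtrM ?sqr_ge0// sqrtr_sqr.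
Qed.

Lemma nrm_eq {D f} g : (forall x, D x -> f x = g x) -> nrm D f = nrm D g.
Proof. by move=> fg; congr Num.sqrt; apply: eq_Rint_in => x Dx; rewrite fg. Qed.

Lemma nrm_le {D f g} : measurable D -> sqint D f -> sqint D g ->
  (forall x, D x -> `|f x| <= `|g x|) -> nrm D f <= nrm D g.
Proof.
move=> mD [mf f2] [mg g2] fg; rewrite ler_sqrt; last exact: Rint_sqr_ge0.
apply: le_Rintegral => // x Dx.
by rewrite -(real_normK (num_real (f x))) -(real_normK (num_real (g x))) ler_sqr ?nnegrE// fg.
Qed.

Lemma ae_imp (P Q : X -> Prop) : (forall x, P x -> Q x) ->
  {ae mu, forall x, P x} -> {ae mu, forall x, Q x}.
Proof. by move=> PQ; apply: filterS. Qed.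

Lemma ae_eq_Rint {D f g} : measurable D -> measurable_fun D f -> measurable_fun D g ->
  {ae mu, forall x, D x -> f x = g x} ->
  \int[mu]_(x in D) f x = \int[mu]_(x in D) g x.
Proof.
move=> mD mf mg fg; rewrite /Rintegral; congr fine.
apply: ae_eq_integral => //; [exact/measurable_EFinP|exact/measurable_EFinP|].
by apply: filterS fg => x h /h ->.
Qed.

Lemma ae_le_Rint {D f g} : measurable D -> rint D f -> rint D g ->
  {ae mu, forall x, D x -> f x <= g x} ->
  \int[mu]_(x in D) f x <= \int[mu]_(x in D) g x.
Proof.
move=> mD hf hg fg.
(* [max f g] dominates [f] everywhere and equals [g] almost everywhere, which reduces the claim to
   pointwise monotonicity. *)
have mfg : measurable_fun D (fun x => Num.max (f x) (g x)).
  by apply: measurable_maxr; exact: rint_meas.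
have <- : \int[mu]_(x in D) (Num.max (f x) (g x)) = \int[mu]_(x in D) g x.
  apply: ae_eq_Rint => //; first exact: rint_meas.
  by apply: filterS fg => x h /h fgx; rewrite max_r.
apply: le_Rintegral => //; last by move=> x _; rewrite le_max lexx.
apply: (rint_le (fun x => `|f x| + `|g x|)) => //.
  by apply: rintD => //; exact: rint_norm.
by move=> x _; rewrite /Num.max; case: ifP => _; rewrite ?lerDl ?lerDr.
Qed.

Lemma ae_rint {D f} g : measurable D -> measurable_fun D f -> rint D g ->
  {ae mu, forall x, D x -> `|f x| <= g x} -> rint D f.
Proof.
move=> mD mf hg fg; apply/integrableP; split; first exact/measurable_EFinP.
have /integrableP[mg goo] := hg.
apply: le_lt_trans goo; apply: ae_ge0_le_integral => //.
- by apply: measurableT_comp => //; exact/measurable_EFinP.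
- exact: measurableT_comp.
- apply: filterS fg => x h /h fgx /=; rewrite lee_fin.
  by rewrite (le_trans fgx)// ler_norm.
Qed.

End SquareIntegrable.

(** * The coefficient and its primitive *)

Section Coefficient.
Context {R : realType}.
Notation mu := (@lebesgue_measure R).

Lemma continuous_rint (f : R -> R) (x y : R) : continuous f -> rint mu `[x, y] f.
Proof.
move=> cf; apply: continuous_compact_integrable; first exact: segment_compact.
exact: continuous_subspaceT.
Qed.

Lemma continuous_antiderivative (f : R -> R) : continuous f ->
  exists2 F : R -> R, F 0 = 0 & forall x : R, is_derive x (1 : R) F (f x).
Proof.
move=> cf; pose P (n x : R) := \int[mu]_(t in `[n, x]) f t.
have Psub (m n x : R) : m <= n -> n <= x -> P m x = P m n + P n x.
  move=> mn nx; apply/eqP; rewrite addrC -subr_eq; apply/eqP.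
  rewrite /P (@Rintegral_itvB _ f (BLeft m) (BRight x) n).
  - rewrite Rintegral_itv_obnd_cbnd//; apply: rintS (continuous_rint f n x cf) => //.
    exact: subset_itv_oc_cc.
  - exact: continuous_rint.
  - by rewrite bnd_simp.
  - by rewrite bnd_simp.
have lN (u : R) : - `|u| <= u by rewrite lerNl -normrN ler_norm.
(* The base point moves with [x] so as to lie to the left of both [x] and 0. Near a given [x] this
   agrees with a difference of integrals from one fixed base point, to which the fundamental theorem
   of calculus applies. *)
pose F x := P (- `|x| - 1) x - P (- `|x| - 1) 0.
exists F; first by rewrite /F subrr.
move=> x; pose N : R := - `|x| - 2.
have FE y : `|y - x| < 1 -> F y = P N y - P N 0.
  move=> yx; rewrite /F; have yN : N <= - `|y| - 1.
    rewrite /N; have := ler_normD (y - x) x; rewrite subrK; lra.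
  rewrite (Psub N _ y yN); last first.
    by have := lN y; lra.
  rewrite (Psub N _ 0 yN); last by have := normr_ge0 y; lra.
  by rewrite opprD addrACA subrr add0r.
have [dF F'] : derivable (P N) x 1 /\ (P N)^`() x = f x.
  apply: (@continuous_FTC1_closed _ f N x (x + 1)) => //.
  - by rewrite ltrDl.
  - exact: continuous_rint.
  - by rewrite /N; have := lN x; lra.
  - exact: cf.
have dF' : is_derive x (1:R) (fun y => P N y - P N 0) (f x).
  have H1 : is_derive x (1 : R) (P N) (f x) by apply: DeriveDef => //; rewrite -derive1E.
  have := is_deriveB H1 (is_derive_cst (P N 0) x 1).
  by rewrite subr0.
apply: near_eq_is_derive dF'.
have : \forall y \near x, `|y - x| < 1.
  have := nbhsx_ballx x (1 : R) ltr01; apply: filterS => y.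
  by rewrite -ball_normE /= distrC.
by apply: filterS => y /FE ->.
Qed.

Lemma is_derive_continuous (f df : R -> R) :
  (forall x : R, is_derive x (1 : R) f (df x)) -> continuous f.
Proof.
move=> h x; apply: differentiable_continuous; apply/derivable1_diffP.
by have [] := h x.
Qed.

Lemma mean_value (f df : R -> R) (x y : R) :
  (forall x : R, is_derive x (1 : R) f (df x)) -> x <= y ->
  exists c, [/\ x <= c, c <= y & f y - f x = df c * (y - x)].
Proof.
move=> h xy; have [|c] := MVT_segment xy (fun z _ => h z).
  by apply: continuous_subspaceT; exact: is_derive_continuous h.
by rewrite in_itv/= => /andP[xc cy] E; exists c.
Qed.

Lemma mean_value_abs (f df : R -> R) (L x y : R) :
  (forall x : R, is_derive x (1 : R) f (df x)) ->
  (forall c, Num.min x y <= c <= Num.max x y -> `|df c| <= L) ->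
  `|f y - f x| <= L * `|y - x|.
Proof.
move=> h dL; wlog xy : x y dL / x <= y.
  move=> H; have [xy|/ltW yx] := leP x y; first exact: H.
  rewrite distrC (distrC y); apply: H => // c.
  by rewrite minC maxC; exact: dL.
have [c [xc cy ->]] := mean_value _ _ _ _ h xy.
by rewrite normrM ler_wpM2r// dL// min_l// max_r// xc cy.
Qed.

(** The form in which the hypotheses on [a] are used: ellipticity and a Lipschitz bound. They give
    linear growth of [a], and quadratic growth and strong monotonicity of its primitive. *)
Record coefficient (a : R -> R) (a0 L : R) : Prop := Coefficient {
  coef_gt0 : 0 < a0;
  coef_L : 0 <= L;
  coef_ge : forall r, a0 <= a r;
  coef_lip : forall r s, `|a r - a s| <= L * `|r - s| }.

Lemma coefficientP (a : R -> R) : Ck 2 a ->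
  (0 < ereal_inf (range (fun r => (a r)%:E)))%E ->
  (ereal_sup (range (fun r =>
     (Num.max `|a^`()%classic r| `|a^`(2)%classic r|)%:E)) < +oo)%E ->
  exists a0 L, coefficient a a0 L.
Proof.
move=> [da _] ainf asup.
have dera (x : R) : is_derive x (1 : R) a (a^`()%classic x).
  by rewrite derive1E; apply: derivableP; have := da 0%N erefl x.
have [a0 a0p ha0] : exists2 a0 : R, 0 < a0 & forall r, a0 <= a r.
  have lb r : (ereal_inf (range (fun r => (a r)%:E)) <= (a r)%:E)%E.
    by apply: ereal_inf_lbound; exists r.
  case: (ereal_inf _) ainf lb => [m| |]; last by [].
  - by rewrite lte_fin => m0 h; exists m => // r; rewrite -lee_fin.
  - by move=> _ /(_ 0).
have [L hL] : exists L : R, forall r, `|a^`()%classic r| <= L.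
  have ub r : (`|a^`()%classic r|%:E <=
      ereal_sup (range (fun r => (Num.max `|a^`()%classic r| `|a^`(2)%classic r|)%:E)))%E.
    apply: (@le_trans _ _ (Num.max `|a^`()%classic r| `|a^`(2)%classic r|)%:E).
      by rewrite lee_fin le_max lexx.
    by apply: ereal_sup_ubound; exists r.
  case: (ereal_sup _) asup ub => [m| |]; last by move=> _ /(_ 0).
  - by move=> _ h; exists m => r; rewrite -lee_fin.
  - by [].
exists a0, L; split => //.
- by rewrite (le_trans _ (hL 0)).
- move=> r s; apply: (mean_value_abs _ _ L _ _ dera) => c _; exact: hL.
Qed.

Section Primitive.
Variables (a A : R -> R) (a0 L : R).
Hypothesis ca : coefficient a a0 L.
Hypothesis A0 : A 0 = 0.
Hypothesis dA : forall x : R, is_derive x (1 : R) A (a x).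

Lemma coef_continuous : continuous a.
Proof.
move=> x; apply/cvgrPdist_lt => e e0; near=> y.
apply: (le_lt_trans (coef_lip _ _ _ ca x y)).
rewrite (@le_lt_trans _ _ ((L + 1) * `|x - y|))//.
  by rewrite ler_wpM2r// lerDl.
rewrite mulrC -ltr_pdivlMr; last by have := coef_L _ _ _ ca; lra.
near: y; apply: cvgr_dist_lt; first exact: cvg_id.
by rewrite divr_gt0//; have := coef_L _ _ _ ca; lra.
Unshelve. all: by end_near. Qed.

Lemma prim_continuous : continuous A.
Proof. exact: is_derive_continuous dA. Qed.

Lemma coef_growth r : a r <= a 0 + L * `|r|.
Proof.
have := coef_lip _ _ _ ca r 0; rewrite subr0 => /(le_trans (ler_norm _)).
by rewrite lerBlDl.
Qed.

Lemma coef_abs r : `|a r| <= a 0 + L * `|r|.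
Proof.
rewrite ger0_norm ?coef_growth//.
by rewrite (le_trans _ (coef_ge _ _ _ ca r))// ltW// (coef_gt0 _ _ _ ca).
Qed.

Lemma coef0_gt0 : 0 < a 0.
Proof. exact: lt_le_trans (coef_gt0 _ _ _ ca) (coef_ge _ _ _ ca 0). Qed.

Lemma prim_lip S r s : `|r| <= S -> `|s| <= S ->
  `|A r - A s| <= (a 0 + L * S) * `|r - s|.
Proof.
move=> rS sS; apply: (mean_value_abs _ _ _ _ _ dA) => c /andP[].
move=> c1 c2; apply: (le_trans (coef_abs c)).
rewrite lerD2l ler_wpM2l ?(coef_L _ _ _ ca)//.
move: rS sS; rewrite !ler_norml => /andP[r1 r2] /andP[s1 s2].
apply/andP; split.
- by rewrite (le_trans _ c1)// le_min r1 s1.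
- by rewrite (le_trans c2)// ge_max r2 s2.
Qed.

Lemma prim_abs r : `|A r| <= (a 0 + L * `|r|) * `|r|.
Proof. by have := prim_lip `|r| r 0; rewrite A0 normr0 !subr0; exact. Qed.

Lemma prim_mono r s : r <= s -> a0 * (s - r) <= A s - A r.
Proof.
move=> rs; have [c [_ _ ->]] := mean_value _ _ _ _ dA rs.
by rewrite ler_wpM2r ?subr_ge0// (coef_ge _ _ _ ca).
Qed.

Lemma prim_le r s : r <= s -> A r <= A s.
Proof.
move=> rs; rewrite -subr_ge0 (le_trans _ (prim_mono _ _ rs))//.
by rewrite mulr_ge0 ?subr_ge0// ltW// (coef_gt0 _ _ _ ca).
Qed.

Lemma prim_ge0 r : 0 <= r -> 0 <= A r.
Proof. by rewrite -{2}A0; exact: prim_le. Qed.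

(** Strong monotonicity of A supplies the damping term of the H^-1 estimate. *)
Lemma prim_monotone r s : a0 * (r - s) ^+ 2 <= (A r - A s) * (r - s).
Proof.
have [rs|/ltW rs] := leP r s.
- have := prim_mono _ _ rs; nra.
- have := prim_mono _ _ rs; nra.
Qed.

End Primitive.

End Coefficient.

(** * H^1_0 on the unit interval *)

Section SobolevInterval.
Context {R : realType}.
Notation mu := (@lebesgue_measure R).
Notation I01 := (@I01 R).

Lemma measurable_I01 : measurable I01. Proof. exact: measurable_itv. Qed.

Lemma mu_I01 : mu I01 = 1%:E.
Proof. by rewrite /Defs.I01 lebesgue_measure_itv/= lte_fin ltr01 oppr0 adde0. Qed.

Lemma mu_I01_fin : (mu I01 < +oo)%E. Proof. by rewrite mu_I01 ltry. Qed.

Hint Resolve measurable_I01 mu_I01_fin : core.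

Lemma measurable_fun_restrict (f : R -> R) (D : set R) : measurable D ->
  measurable_fun setT (f \_ D) <-> measurable_fun D f.
Proof. by move=> mD; rewrite -measurable_restrictT. Qed.

Lemma L2_sqint (f : R -> R) : L2 f -> sqint mu I01 f.
Proof.
move=> hf; have := Lfun2_integrable_sqr hf => hi.
move: hf; rewrite /L2 inE => /andP[]; rewrite inE/= => mf _.
split; first exact/measurable_fun_restrict.
have := rintS mu measurableT measurable_I01 (@subsetT _ _) hi.
apply: eq_rint => // x Dx; by rewrite patchE mem_set.
Qed.

Lemma sqint_Lnorm d (X : measurableType d) (m : {measure set X -> \bar R})
    (D : set X) (f : X -> R) : measurable D -> sqint m D f ->
  ('N[m]_2%:E [EFin \o (f \_ D)])%E = (nrm m D f)%:E.
Proof.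
move=> mD [mf f2]; rewrite unlock /nrm /Rintegral.
have -> : (\int[m]_x (`|(EFin \o f \_ D) x| `^ 2))%E = (\int[m]_(x in D) (f x ^+ 2)%:E)%E.
  rewrite [RHS]integral_mkcond; apply: eq_integral => x _ /=.
  rewrite !patchE; case: ifP => _ /=.
    by rewrite ?poweR_EFin powR_mulrn// real_normK ?num_real.
  by rewrite normr0 powR0.
have fin := integrable_fin_num mD f2.
rewrite -[in LHS](fineK fin) poweR_EFin; congr (_%:E).
by rewrite powR12_sqrt// fine_ge0// integral_ge0// => x _; rewrite lee_fin sqr_ge0.
Qed.

Lemma distL2_nrm (f g : R -> R) : L2 f -> L2 g ->
  distL2 f g = (nrm mu I01 (fun x => f x - g x))%:E.
Proof.
move=> /L2_sqint hf /L2_sqint hg.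
by rewrite /distL2 (@sqint_Lnorm _ _ mu)//; exact: sqintB.
Qed.

Lemma Ck_derivable (k : nat) (f : R -> R) : Ck k.+1 f ->
  forall x : R, is_derive x (1 : R) f (f^`()%classic x).
Proof.
move=> [df _] x; rewrite derive1E; apply: derivableP; exact: (df 0%N erefl x).
Qed.

Lemma Ccinfty_spec (phi : R -> R) : Ccinfty phi ->
  [/\ forall x : R, is_derive x (1 : R) phi (phi^`()%classic x),
      continuous phi^`()%classic, continuous phi, phi 0 = 0 & phi 1 = 0].
Proof.
move=> [Cphi [K [_ KI K0]]].
have d1 := Ck_derivable _ _ (Cphi 1%N).
split => //.
- by have [_] := Cphi 1%N.
- exact: is_derive_continuous d1.
- by apply: K0 => /KI; rewrite /Defs.I01/= in_itv/= ltxx.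
- by apply: K0 => /KI; rewrite /Defs.I01/= in_itv/= ltxx andbF.
Qed.

Lemma continuous_measurable (f : R -> R) (D : set R) : measurable D ->
  continuous f -> measurable_fun D f.
Proof. by move=> mD cf; apply: measurable_funTS; exact: continuous_measurable_fun. Qed.

Lemma continuous_sqint (f : R -> R) : continuous f -> sqint mu I01 f.
Proof.
move=> cf; split; first exact: continuous_measurable.
have cf2 : continuous (fun x => f x ^+ 2).
  by move=> x; rewrite (_ : (fun x => f x ^+ 2) = f \* f)//; apply: continuousM; exact: cf.
apply: rintS (continuous_rint _ 0 1 cf2) => //; exact: subset_itv_oo_cc.
Qed.

Lemma FTC2 (f df : R -> R) (x y : R) : x <= y ->
  (forall x : R, is_derive x (1 : R) f (df x)) -> continuous df ->
  \int[mu]_(t in `]x, y[) df t = f y - f x.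
Proof.
move=> xy hd cdf; have cf := is_derive_continuous _ _ hd.
have iu (u v : R) : mu.-integrable `]u, v[ (EFin \o df).
  apply: rintS (continuous_rint _ u v cdf) => //; exact: subset_itv_oo_cc.
have [->|xy'] := eqVneq x y; first by rewrite subrr set_itvoo0 Rintegral_set0.
have {xy xy'} xy : x < y by rewrite lt_def eq_sym xy'.
rewrite Rintegral_itv_bndo_bndc// Rintegral_itv_obnd_cbnd//; last first.
  apply: rintS (continuous_rint _ x y cdf) => //; exact: subset_itv_oc_cc.
rewrite /Rintegral (@continuous_FTC2 _ df f)//.
- exact: continuous_subspaceT.
- split; first by move=> z _; have [] := hd z.
  + by apply: cvg_at_right_filter; exact: cf.
  + by apply: cvg_at_left_filter; exact: cf.
- by move=> z _; rewrite derive1E; have [_ ->] := hd z.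
Qed.

Lemma H10_L2 (f g : R -> R) : H10 f g -> sqint mu I01 f /\ sqint mu I01 g.
Proof. by move=> [/L2_sqint ? /L2_sqint ?]. Qed.

(** When [g] is the weak derivative of an element of H^1_0, this is the continuous representative of
    that element, on which pointwise bounds make sense. *)
Definition prim0 (g : R -> R) (x : R) := \int[mu]_(t in `]0, x[) g t.

Lemma sub_I01 (x y : R) : 0 <= x -> y <= 1 -> `]x, y[ `<=` I01.
Proof.
move=> x0 y1 z; rewrite /Defs.I01 /= !in_itv/= => /andP[xz zy].
by rewrite (le_lt_trans x0 xz) (lt_le_trans zy y1).
Qed.

Lemma sqint_sub (g : R -> R) (x y : R) : 0 <= x -> y <= 1 -> sqint mu I01 g ->
  sqint mu `]x, y[ g.
Proof. by move=> x0 y1; apply: sqintS => //; exact: sub_I01. Qed.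

Lemma mu_itvoo (x y : R) : x <= y -> fine (mu `]x, y[) = y - x.
Proof.
move=> xy; rewrite lebesgue_measure_itv/= lte_fin; case: ltP => //=.
move=> yx; have <- : x = y by apply/eqP; rewrite eq_le xy yx.
by rewrite subrr.
Qed.

Lemma mu_itvoo_fin (x y : R) : (mu `]x, y[ < +oo)%E.
Proof.
by rewrite lebesgue_measure_itv/=; case: ifP => _; rewrite ?ltry// -EFinD ltry.
Qed.

Lemma rint_sub (g : R -> R) (x y : R) : 0 <= x -> y <= 1 -> sqint mu I01 g ->
  rint mu `]x, y[ g.
Proof.
move=> x0 y1 hg; apply: sqint_rint => //; first exact: mu_itvoo_fin.
exact: sqint_sub.
Qed.

Lemma Rint_sub_le (g : R -> R) (x y : R) : 0 <= x -> y <= 1 -> sqint mu I01 g ->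
  \int[mu]_(t in `]x, y[) (g t ^+ 2) <= \int[mu]_(t in I01) (g t ^+ 2).
Proof.
move=> x0 y1 [mg hg]; rewrite /Rintegral fine_le//.
- apply: integrable_fin_num => //; apply: rintS hg => //; exact: sub_I01.
- exact: integrable_fin_num.
- apply: ge0_subset_integral => //; last exact: sub_I01.
    by apply/measurable_EFinP; exact: measurable_funX.
  by move=> t _; rewrite lee_fin sqr_ge0.
Qed.

Lemma Rint_itv_bound (g : R -> R) (x y : R) : 0 <= x -> x <= y -> y <= 1 ->
  sqint mu I01 g ->
  `|\int[mu]_(t in `]x, y[) g t| <= Num.sqrt (y - x) * nrm mu I01 g.
Proof.
move=> x0 xy y1 hg; have mxy : measurable (`]x, y[ : set R) by exact: measurable_itv.
have gs := sqint_sub _ _ _ x0 y1 hg.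
have ones := sqint_cst mu 1 mxy (mu_itvoo_fin x y).
have := cauchy_schwarz_nrm mu mxy ones gs.
under eq_Rintegral do rewrite mul1r.
move=> /le_trans; apply; apply: ler_pM; rewrite ?nrm_ge0//.
  rewrite /nrm; under eq_Rintegral do rewrite expr1n.
  by rewrite Rintegral_cst// mul1r mu_itvoo.
by rewrite ler_sqrt ?Rint_sqr_ge0// Rint_sub_le.
Qed.

Lemma prim0B (g : R -> R) (x y : R) : 0 <= x -> x <= y -> y <= 1 -> sqint mu I01 g ->
  prim0 g y - prim0 g x = \int[mu]_(t in `]x, y[) g t.
Proof.
move=> x0 xy y1 hg; have x1 := le_trans xy y1; have y0 := le_trans x0 xy.
have [xe0|xn0] := eqVneq x 0.
  by rewrite /prim0 xe0 set_itvoo0 Rintegral_set0 subr0.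
have xp : 0 < x by rewrite lt_def xn0.
have [xey|xny] := eqVneq x y.
  by rewrite -xey set_itvoo0 Rintegral_set0 subrr.
have xy' : x < y by rewrite lt_def eq_sym xny.
rewrite /prim0 (@Rintegral_itv_bndo_bndc _ (BRight 0) x); last exact: rint_sub.
rewrite (@Rintegral_itvB _ g (BRight 0) (BLeft y) x)//.
exact: rint_sub.
Qed.

Lemma prim0_holder (g : R -> R) (x y : R) : 0 <= x <= 1 -> 0 <= y <= 1 ->
  sqint mu I01 g ->
  `|prim0 g x - prim0 g y| <= Num.sqrt `|x - y| * nrm mu I01 g.
Proof.
move=> xI yI hg; wlog xy : x y xI yI / y <= x.
  move=> H; have [yx|/ltW xy] := leP y x; first exact: H.
  by rewrite distrC (distrC x); exact: H.
move: xI yI => /andP[x0 x1] /andP[y0 y1].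
by rewrite prim0B// [`|x - y|]ger0_norm ?subr_ge0// Rint_itv_bound.
Qed.

Lemma prim0_0 (g : R -> R) : prim0 g 0 = 0.
Proof. by rewrite /prim0 set_itvoo0 Rintegral_set0. Qed.

Lemma Rint_cst_I (k : R) : \int[mu]_(x in I01) k = k.
Proof.
apply: (eq_trans (@Rintegral_cst _ _ _ mu _ measurable_I01 k)).
rewrite -[RHS]mulr1; congr (_ * _).
have E : fine (mu I01) = 1 :> R by rewrite mu_I01.
exact: E.
Qed.

Lemma contM (f g : R -> R) : continuous f -> continuous g -> continuous (fun x => f x * g x).
Proof. by move=> cf cg x; apply: (@continuousM _ _ f g x); [exact: cf|exact: cg]. Qed.

Lemma contD (f g : R -> R) : continuous f -> continuous g -> continuous (fun x => f x + g x).
Proof. by move=> cf cg x; apply: (@continuousD _ _ _ f g x); [exact: cf|exact: cg]. Qed.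

Lemma contC (k : R) : continuous (fun _ : R => k).
Proof. by move=> x; exact: cst_continuous. Qed.

Lemma sqintB_I (f g : R -> R) : sqint mu I01 f -> sqint mu I01 g ->
  sqint mu I01 (fun x => f x - g x).
Proof. exact: (@sqintB _ _ _ mu _ _ _ measurable_I01). Qed.

Lemma sqintD_I (f g : R -> R) : sqint mu I01 f -> sqint mu I01 g ->
  sqint mu I01 (fun x => f x + g x).
Proof. exact: (@sqintD _ _ _ mu _ _ _ measurable_I01). Qed.

Lemma nrm_sym_I (f g : R -> R) :
  nrm mu I01 (fun x => f x - g x) = nrm mu I01 (fun x => g x - f x).
Proof. by congr Num.sqrt; apply: eq_Rint_in => x _; rewrite -sqrrN opprB. Qed.

Lemma nrm_tri_I (f g : R -> R) : sqint mu I01 f -> sqint mu I01 g ->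
  nrm mu I01 f <= nrm mu I01 g + nrm mu I01 (fun x => f x - g x).
Proof.
move=> hf hg; apply: le_trans (@nrmD _ _ _ mu _ _ _ measurable_I01 hg (sqintB_I _ _ hf hg)).
by rewrite le_eqVlt; apply/orP; left; apply/eqP; apply: nrm_eq => x _; rewrite addrC subrK.
Qed.

(** An approximant and [prim0 g] both vanish at 0, so their distance at [x] is the integral of the
    error of the derivatives over an interval of length at most 1; this turns the L^2 bound into a
    uniform one. *)
Lemma H10_approx (f g : R -> R) : H10 f g -> forall e : R, 0 < e ->
  exists phi, [/\ Ccinfty phi, nrm mu I01 (fun x => phi x - f x) < e,
    nrm mu I01 (fun x => phi^`()%classic x - g x) < e &
    forall x, 0 <= x <= 1 -> `|phi x - prim0 g x| <= e].
Proof.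
move=> [L2f L2g _ apx] e e0; have [phi [cphi h1 h2]] := apx e e0.
have sf := L2_sqint _ L2f; have sg := L2_sqint _ L2g.
have [dphi cdphi cphi' phi0 phi1] := Ccinfty_spec _ cphi.
have sp := continuous_sqint _ cphi'; have sdp := continuous_sqint _ cdphi.
have h1' : nrm mu I01 (fun x => phi x - f x) < e.
  rewrite -lte_fin; move: h1; rewrite /distL2 (@sqint_Lnorm _ _ mu)//; exact: sqintB.
have h2' : nrm mu I01 (fun x => phi^`()%classic x - g x) < e.
  rewrite -lte_fin; move: h2; rewrite /distL2 (@sqint_Lnorm _ _ mu)//; exact: sqintB.
exists phi; split => // x /andP[x0 x1].
have -> : phi x = \int[mu]_(t in `]0, x[) phi^`()%classic t.
  by rewrite (FTC2 phi)// phi0 subr0.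
rewrite /prim0 -RintegralB//; [|exact: rint_sub|exact: rint_sub].
apply: le_trans (Rint_itv_bound _ _ _ _ x0 x1 (sqintB _ _ sdp sg)) _ => //.
rewrite subr0 -[leRHS]mul1r ler_pM ?nrm_ge0 ?(ltW h2')//.
by rewrite -sqrtr1 ler_sqrt.
Qed.

End SobolevInterval.

(** * Continuous representatives and sup bounds *)

Section SobolevEmbedding.
Context {R : realType}.
Notation mu := (@lebesgue_measure R).
Notation I01 := (@I01 R).
Hint Resolve measurable_I01 mu_I01_fin : core.

(** Passage to the limit in [e]; the restriction [e <= 1] lets terms of order [e ^+ 2] be absorbed
    into [C * e]. *)
Lemma le_small (x y C : R) : (forall e, 0 < e -> e <= 1 -> x <= y + C * e) -> x <= y.
Proof.
move=> h; have [//|yx] := leP x y.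
pose e := Num.min 1 ((x - y) / (2 * (`|C| + 1))).
have C1 : 0 < `|C| + 1 by rewrite ltr_wpDl.
have e0 : 0 < e by rewrite /e lt_min ltr01/= divr_gt0 ?subr_gt0// mulr_gt0.
have e1 : e <= 1 by rewrite /e ge_min lexx.
have e2 : e * (2 * (`|C| + 1)) <= x - y.
  by rewrite -ler_pdivlMr ?mulr_gt0// /e ge_min lexx orbT.
have := h e e0 e1; have := ler_norm C; nra.
Qed.

Lemma prim0_continuous (g : R -> R) : sqint mu I01 g ->
  exists2 F : R -> R, continuous F & forall x, 0 <= x <= 1 -> F x = prim0 g x.
Proof.
(* Composing with the projection [c] onto [0, 1] extends [prim0 g] continuously to the line, whence
   its measurability. *)
move=> hg; pose c (x : R) := if x < 0 then 0 else if 1 < x then 1 else x.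
have cI x : 0 <= c x <= 1.
  by rewrite /c; case: ltP => ?; last case: ltP => ?; rewrite ?lexx ?ler01//; apply/andP.
have clip x y : `|c x - c y| <= `|x - y|.
  rewrite /c; (case: (ltP x 0) => ?; last case: (ltP 1 x) => ?);
  (case: (ltP y 0) => ?; last case: (ltP 1 y) => ?);
  rewrite ler_norml; apply/andP; split;
  have := ler_norm (x - y); have := ler_norm (y - x); rewrite (distrC y x);
  have := normr_ge0 (x - y); lra.
exists (fun x => prim0 g (c x)); last first.
  move=> x /andP[x0 x1]; congr (prim0 g _).
  by rewrite /c !ltNge x0 x1.
move=> x; apply/cvgrPdist_lt => e e0.
pose G := nrm mu I01 g; have G0 : 0 <= G := nrm_ge0 _ _ _.
pose d := (e / (G + 1)) ^+ 2.
have d0 : 0 < d by rewrite exprn_gt0// divr_gt0// ltr_wpDl.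
have := nbhsx_ballx x d d0; apply: filterS => y.
rewrite -ball_normE /= => xy.
apply: (le_lt_trans (prim0_holder _ _ _ (cI x) (cI y) hg)).
have : Num.sqrt `|c x - c y| <= e / (G + 1).
  have -> : e / (G + 1) = Num.sqrt d.
    by rewrite /d sqrtr_sqr ger0_norm// divr_ge0// ?(ltW e0)// addr_ge0.
  by rewrite ler_wsqrtr// (le_trans (clip _ _))// ltW.
move=> /(ler_wpM2r G0) /le_lt_trans; apply.
rewrite mulrAC ltr_pdivrMr ?ltr_wpDl// ltr_pM2l//; lra.
Qed.

Lemma prim0_meas (g : R -> R) (D : set R) : sqint mu I01 g -> measurable D -> D `<=` I01 ->
  measurable_fun D (prim0 g).
Proof.
move=> /prim0_continuous[F cF FE] mD DI.
apply: (@eq_measurable_fun _ _ _ _ _ F); last exact: continuous_measurable.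
move=> x; rewrite inE => /DI; rewrite /Defs.I01/= in_itv/= => /andP[x0 x1].
by rewrite FE// !ltW.
Qed.

Lemma prim0_abs (g : R -> R) (x : R) : sqint mu I01 g -> 0 <= x <= 1 ->
  `|prim0 g x| <= nrm mu I01 g.
Proof.
move=> hg xI; have /andP[x0 x1] := xI.
have := prim0_holder g x 0 xI _ hg; rewrite lexx ler01 prim0_0 !subr0 => /(_ isT).
move=> /le_trans; apply; rewrite -[leRHS]mul1r ler_wpM2r ?nrm_ge0//.
by rewrite -sqrtr1 ler_wsqrtr// ger0_norm.
Qed.

Lemma prim0_sqint (g : R -> R) : sqint mu I01 g -> sqint mu I01 (prim0 g).
Proof.
move=> hg; apply: (@sqint_le _ _ _ mu _ _ _ measurable_I01
  (prim0_meas _ _ hg measurable_I01 (@subset_refl _ _))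
  (sqint_cst mu (nrm mu I01 g) measurable_I01 mu_I01_fin)).
move=> x; rewrite /Defs.I01/= in_itv/= => /andP[x0 x1].
by apply: prim0_abs => //; rewrite !ltW.
Qed.

Lemma nrm_le_sup (f : R -> R) (e : R) : 0 <= e -> sqint mu I01 f ->
  (forall x, I01 x -> `|f x| <= e) -> nrm mu I01 f <= e.
Proof.
move=> e0 hf fe; have H := @nrm_le _ _ _ mu I01 f (fun=> e) measurable_I01 hf
  (sqint_cst mu e measurable_I01 mu_I01_fin).
apply: (le_trans (H _)).
  by move=> x Ix; rewrite (le_trans (fe _ Ix))// ler_norm.
by rewrite /nrm Rint_cst_I sqrtr_sqr ger0_norm.
Qed.

Lemma nrm_eq0_ae (f : R -> R) : sqint mu I01 f -> nrm mu I01 f = 0 ->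
  {ae mu, forall x, I01 x -> f x = 0}.
Proof.
move=> [mf f2] /eqP; rewrite sqrtr_eq0 => h.
have h0 : \int[mu]_(x in I01) (f x ^+ 2) = 0.
  by apply/eqP; rewrite eq_le h Rint_sqr_ge0.
have : (\int[mu]_(x in I01) `|(f x ^+ 2)%:E| = 0)%E.
  rewrite -[RHS]/((0 : R)%:E) -h0 /Rintegral fineK; last by apply: integrable_fin_num f2; exact: measurable_I01.
  by apply: eq_integral => x _; rewrite gee0_abs// lee_fin sqr_ge0.
have m2 : measurable_fun I01 (fun x => (f x ^+ 2)%:E).
  by apply/measurable_EFinP; exact: measurable_funX.
move/(ae_eq_integral_abs mu measurable_I01 m2).1; apply: ae_imp => x h2 /h2 /= [] /eqP.
by rewrite sqrf_eq0 => /eqP.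
Qed.

Lemma H10_ae (f g : R -> R) : H10 f g -> {ae mu, forall x, I01 x -> f x = prim0 g x}.
Proof.
move=> H; have [hf hg] := H10_L2 _ _ H; have hF := prim0_sqint _ hg.
have hs := @sqintB _ _ _ mu _ _ _ measurable_I01 hf hF.
suff h0 : nrm mu I01 (fun x => f x - prim0 g x) = 0.
  have := nrm_eq0_ae _ hs h0; apply: ae_imp => x h /h /eqP.
  by rewrite subr_eq0 => /eqP.
apply/eqP; rewrite eq_le nrm_ge0 andbT.
apply: (@le_small _ _ 2) => e e0 _; rewrite add0r.
have [phi [cphi h1 h2 h3]] := H10_approx _ _ H e e0.
have [dphi _ cphi' _ _] := Ccinfty_spec _ cphi.
have sp := continuous_sqint _ cphi'.
have s1 := @sqintB _ _ _ mu _ _ _ measurable_I01 hf sp.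
have s2 := @sqintB _ _ _ mu _ _ _ measurable_I01 sp hF.
rewrite (@nrm_eq _ _ _ mu I01 _ (fun x => (f x - phi x) + (phi x - prim0 g x))); last first.
  by move=> x _; ring.
apply: (le_trans (@nrmD _ _ _ mu _ _ _ measurable_I01 (sqintB_I _ _ hf sp) (sqintB_I _ _ sp hF))).
rewrite mulr_natl mulr2n lerD//; first by rewrite nrm_sym_I ltW.
apply: nrm_le_sup => //; first exact: ltW.
move=> x; rewrite /Defs.I01/= in_itv/= => /andP[x0 x1]; apply: h3.
by rewrite !ltW.
Qed.

(** Agmon's inequality: the square of a smooth approximant is the integral of twice its product with
    its derivative. Since the L^2 norm of y(t) is bounded in time, the sup norm grows only like the
    square root of the gradient norm, so that quantities quadratic in the sup norm, such as the
    bound on A(y), remain square integrable in time. *)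
Lemma H10_sup (f g : R -> R) (x : R) : H10 f g -> 0 <= x <= 1 ->
  prim0 g x ^+ 2 <= 2 * nrm mu I01 f * nrm mu I01 g.
Proof.
move=> H xI; have [hf hg] := H10_L2 _ _ H.
have /andP[x0 x1] := xI.
pose nf := nrm mu I01 f; pose G := nrm mu I01 g.
have nf0 : 0 <= nf := nrm_ge0 _ _ _; have G0 : 0 <= G := nrm_ge0 _ _ _.
apply: (@le_small _ _ (2 * nf + 4 * G + 5)) => e e0 e1.
have [phi [cphi h1 h2 h3]] := H10_approx _ _ H e e0.
have [dphi cd cphi' phi0 _] := Ccinfty_spec _ cphi.
have sp := continuous_sqint _ cphi'; have sd := continuous_sqint _ cd.
have np : nrm mu I01 phi <= nf + e.
  by rewrite (le_trans (nrm_tri_I _ _ sp hf))// lerD2l ltW.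
have nd : nrm mu I01 phi^`()%classic <= G + e.
  by rewrite (le_trans (nrm_tri_I _ _ sd hg))// lerD2l ltW.
have phi2 : phi x ^+ 2 <= 2 * (nf + e) * (G + e).
  have d2 (y : R) : is_derive y (1 : R) (fun y => phi y ^+ 2) (2 * (phi y * phi^`()%classic y)).
    have dy := dphi y; rewrite (_ : (fun y => phi y ^+ 2) = phi * phi); last first.
      by apply/funext => z; rewrite expr2.
    by apply: is_derive_eq; rewrite /GRing.scale/=; ring.
  have c2 : continuous (fun y => 2 * (phi y * phi^`()%classic y)).
    by apply: contM; [exact: contC|exact: contM].
  have := FTC2 _ _ 0 x x0 d2 c2; rewrite phi0 expr0n/= subr0 => <-.
  rewrite RintegralZl//; last first.
    apply: sqintM => //; exact: sqint_sub.
  rewrite -mulrA ler_pM2l//; apply: (le_trans (ler_norm _)).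
  apply: (le_trans (@cauchy_schwarz_nrm _ _ _ mu _ _ _ _ (sqint_sub _ _ _ _ x1 sp) (sqint_sub _ _ _ _ x1 sd))) => //.
  have sub (u : R -> R) : sqint mu I01 u -> nrm mu `]0, x[ u <= nrm mu I01 u.
    by move=> su; rewrite ler_sqrt ?Rint_sqr_ge0// Rint_sub_le.
  by apply: ler_pM; rewrite ?nrm_ge0// (le_trans (sub _ _)).
have := h3 x xI; move: phi2; rewrite -/G -/nf.
move: (phi x) (prim0 g x) (prim0_abs g x hg xI); rewrite -/G => p q qG.
rewrite ler_norml => p2 /andP[q1 q2].
have qG2 : q <= G /\ - G <= q by move: qG; rewrite ler_norml => /andP[].
nra.
Qed.

End SobolevEmbedding.

(** * Integration by parts for the nonlinear flux *)

Section ChainRule.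
Context {R : realType}.
Notation mu := (@lebesgue_measure R).
Notation I01 := (@I01 R).
Variables (a A : R -> R) (a0 L : R).
Hypothesis ca : coefficient a a0 L.
Hypothesis A0 : A 0 = 0.
Hypothesis dA : forall x : R, is_derive x (1 : R) A (a x).

Lemma meas_comp_I (h f : R -> R) (D : set R) : continuous h -> measurable_fun D f ->
  measurable_fun D (fun x => h (f x)).
Proof. by move=> ch mf; apply: measurableT_comp => //; exact: continuous_measurable_fun. Qed.

Lemma sqintZ_I k (f : R -> R) : sqint mu I01 f -> sqint mu I01 (fun x => k * f x).
Proof. exact: (@sqintZ _ _ _ mu _ _ _ measurable_I01). Qed.

Lemma sqint_cst_I k : sqint mu I01 (fun _ => k : R).
Proof. exact: (sqint_cst mu k measurable_I01 mu_I01_fin). Qed.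

Lemma sqint_norm_I (f : R -> R) : sqint mu I01 f -> sqint mu I01 (fun x => `|f x|).
Proof.
move=> [mf f2]; split; first exact: measurableT_comp.
by apply: (@eq_rint _ _ _ mu _ _ _ measurable_I01 _ f2) => x _; rewrite real_normK ?num_real.
Qed.

Lemma nrm_norm_I (f : R -> R) : nrm mu I01 (fun x => `|f x|) = nrm mu I01 f.
Proof. by congr Num.sqrt; apply: eq_Rint_in => x _; rewrite real_normK ?num_real. Qed.

Lemma nrmD_I (f g : R -> R) : sqint mu I01 f -> sqint mu I01 g ->
  nrm mu I01 (fun x => f x + g x) <= nrm mu I01 f + nrm mu I01 g.
Proof. exact: (@nrmD _ _ _ mu _ _ _ measurable_I01). Qed.

Lemma nrmZ_I k (f : R -> R) : sqint mu I01 f ->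
  nrm mu I01 (fun x => k * f x) = `|k| * nrm mu I01 f.
Proof. exact: (@nrmZ _ _ _ mu _ _ _ measurable_I01). Qed.

Lemma nrm_cst_I (k : R) : nrm mu I01 (fun=> k) = `|k|.
Proof. by rewrite /nrm Rint_cst_I sqrtr_sqr. Qed.

Lemma sqintM_I (f g : R -> R) : sqint mu I01 f -> sqint mu I01 g ->
  rint mu I01 (fun x => f x * g x).
Proof. exact: (@sqintM _ _ _ mu _ _ _ measurable_I01). Qed.

Lemma Rint_normM_I (f g : R -> R) : sqint mu I01 f -> sqint mu I01 g ->
  \int[mu]_(x in I01) (`|f x| * `|g x|) <= nrm mu I01 f * nrm mu I01 g.
Proof.
move=> hf hg; rewrite -(nrm_norm_I f) -(nrm_norm_I g).
apply: (le_trans (ler_norm _)).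
exact: (@cauchy_schwarz_nrm _ _ _ mu _ _ _ measurable_I01 (sqint_norm_I _ hf) (sqint_norm_I _ hg)).
Qed.

Lemma coef_sqint (f : R -> R) : sqint mu I01 f -> sqint mu I01 (fun x => a (f x)).
Proof.
move=> hf; apply: (@sqint_le _ _ _ mu _ _ (fun x => a 0 + L * `|f x|) measurable_I01).
- apply: meas_comp_I; [exact: (coef_continuous _ _ _ ca)|by case: hf].
- apply: sqintD_I; first exact: sqint_cst_I.
  by apply: sqintZ_I; exact: sqint_norm_I.
- by move=> x _; exact: (coef_abs _ _ _ ca).
Qed.

Lemma prim_rint (f : R -> R) : sqint mu I01 f -> rint mu I01 (fun x => A (f x)).
Proof.
move=> hf; apply: (@rint_le _ _ _ mu _ _ (fun x => (a 0 + L * `|f x|) * `|f x|) measurable_I01).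
- apply: meas_comp_I; [exact: (prim_continuous _ _ dA)|by case: hf].
- apply: sqintM_I; last exact: sqint_norm_I.
  apply: sqintD_I; first exact: sqint_cst_I.
  by apply: sqintZ_I; exact: sqint_norm_I.
- by move=> x _; exact: (prim_abs _ _ _ _ ca A0 dA).
Qed.

Lemma rint_I_sub (f : R -> R) (c : R) : 0 <= c -> rint mu I01 f -> rint mu `]c, 1[ f.
Proof.
move=> c0; exact: (@rintS _ _ _ mu _ _ _ measurable_I01 (measurable_itv _) (sub_I01 c 1 c0 (lexx _))).
Qed.

Lemma le_Rint_I (f g : R -> R) (c : R) : 0 <= c -> rint mu I01 f -> rint mu I01 g ->
  (forall x, I01 x -> `|f x| <= g x) ->
  `|\int[mu]_(x in `]c, 1[) f x| <= \int[mu]_(x in I01) g x.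
Proof.
move=> c0 hf hg fg; have hfc := rint_I_sub _ _ c0 hf; have hgc := rint_I_sub _ _ c0 hg.
have mc : measurable (`]c, 1[ : set (measurableTypeR R)) by exact: measurable_itv.
apply: (le_trans (@le_normr_Rintegral _ _ _ mu _ _ mc hfc)).
apply: (@le_trans _ _ (\int[mu]_(x in `]c, 1[) g x)).
  apply: (@le_Rintegral _ _ _ mu _ _ _ mc) => //; first exact: (rint_norm mu).
  by move=> x xI; apply: fg; apply: (sub_I01 c 1) => //.
rewrite /Rintegral fine_le//.
- exact: integrable_fin_num hgc.
- apply: integrable_fin_num hg; exact: measurable_I01.
- apply: ge0_subset_integral => //.
  + exact: measurable_I01.
  + by apply/measurable_EFinP; exact: (rint_meas mu hg).
  + by move=> x /fg h; rewrite lee_fin (le_trans _ h).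
  + exact: sub_I01.
Qed.

Lemma rintB_I (f g : R -> R) : rint mu I01 f -> rint mu I01 g ->
  rint mu I01 (fun x => f x - g x).
Proof. exact: (@rintB _ _ _ mu _ _ _ measurable_I01). Qed.

Lemma rintD_I (f g : R -> R) : rint mu I01 f -> rint mu I01 g ->
  rint mu I01 (fun x => f x + g x).
Proof. exact: (@rintD _ _ _ mu _ _ _ measurable_I01). Qed.

Lemma rint_mulsub_I (f : R -> R) c : 0 <= c <= 1 -> rint mu I01 f ->
  rint mu I01 (fun x => f x * (x - c)).
Proof.
move=> /andP[c0 c1] hf.
apply: (@eq_rint _ _ _ mu _ (fun x => (x - c) * f x) _ measurable_I01).
  by move=> x _; rewrite mulrC.
apply: (@rintM_bdd _ _ _ mu _ f (fun x => x - c) 1 measurable_I01) => //.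
  exact: measurable_funB.
move=> x; rewrite /Defs.I01/= in_itv/= => /andP[x0 x1]; rewrite ler_norml; lra.
Qed.

(** For smooth [phi] the two integrals come from the derivative of A(phi(x)) (x - c), a function
    that vanishes at 1 because [phi 1 = 0] and [A 0 = 0], and at [c] because of the ramp. The
    identity then passes to the limit along approximants of [f]; the weak derivative of A(f) itself
    is thereby avoided. *)
Lemma chain_rule (f g : R -> R) (c : R) : H10 f g -> 0 <= c <= 1 ->
  \int[mu]_(x in `]c, 1[) (a (f x) * g x * (x - c)) = - \int[mu]_(x in `]c, 1[) A (f x).
Proof.
move=> H cI; have /andP[c0 c1] := cI; have [hf hg] := H10_L2 _ _ H.
have haf := coef_sqint _ hf.
have mc : measurable (`]c, 1[ : set (measurableTypeR R)) by exact: measurable_itv.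
have i1 : rint mu I01 (fun x => a (f x) * g x * (x - c)).
  by apply: rint_mulsub_I => //; exact: sqintM_I.
have i2 := prim_rint _ hf.
have E := @RintegralD _ _ _ mu _ _ _ mc (rint_I_sub _ _ c0 i1) (rint_I_sub _ _ c0 i2).
suff : `|\int[mu]_(x in `]c, 1[) (a (f x) * g x * (x - c) + A (f x))| <= 0.
  by rewrite normr_le0 E addr_eq0 => /eqP.
pose nf := nrm mu I01 f; pose G := nrm mu I01 g.
have nf0 : 0 <= nf := nrm_ge0 _ _ _; have G0 : 0 <= G := nrm_ge0 _ _ _.
apply: (@le_small _ _ _ (L * (G + 1) + nrm mu I01 (fun x => a (f x)) + (a 0 + L * (2 * nf + 1)))).
move=> e e0 e1; rewrite add0r.
have [phi [cphi h1 h2 h3]] := H10_approx _ _ H e e0.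
have [dphi cd cphi' phi0 phi1] := Ccinfty_spec _ cphi.
have sp := continuous_sqint _ cphi'; have sd := continuous_sqint _ cd.
have np : nrm mu I01 phi <= nf + e.
  by rewrite (le_trans (nrm_tri_I _ _ sp hf))// lerD2l ltW.
have nd : nrm mu I01 phi^`()%classic <= G + e.
  by rewrite (le_trans (nrm_tri_I _ _ sd hg))// lerD2l ltW.
have j1 : rint mu I01 (fun x => a (phi x) * phi^`()%classic x * (x - c)).
  by apply: rint_mulsub_I => //; apply: sqintM_I => //; exact: coef_sqint.
have j2 := prim_rint _ sp.
have zero : \int[mu]_(x in `]c, 1[) (a (phi x) * phi^`()%classic x * (x - c) + A (phi x)) = 0.
  have dW (x : R) : is_derive x (1 : R) (fun x => A (phi x) * (x - c))
      (a (phi x) * phi^`()%classic x * (x - c) + A (phi x)).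
    have d1 : is_derive x (1 : R) (A \o phi) (a (phi x) * phi^`()%classic x).
      exact: (is_derive1_comp (dA (phi x)) (dphi x)).
    have d2 : is_derive x (1 : R) (fun x : R => x - c) 1.
      by have := is_deriveB (is_derive_id x (1:R)) (is_derive_cst c x 1); rewrite subr0.
    have := is_deriveM d1 d2; rewrite /GRing.scale/= => d3.
    by apply: is_derive_eq; rewrite /GRing.scale/=; ring.
  have cW : continuous (fun x => a (phi x) * phi^`()%classic x * (x - c) + A (phi x)).
    apply: contD; last by move=> x; apply: continuous_comp; [exact: cphi'|exact: (prim_continuous _ _ dA)].
    apply: contM; last by apply: contD; [move=> x; exact: cvg_id|exact: contC].
    apply: contM => //.
    by move=> x; apply: continuous_comp; [exact: cphi'|exact: (coef_continuous _ _ _ ca)].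
  by rewrite (FTC2 _ _ _ _ c1 dW cW) phi1 A0 mul0r subrr mulr0 subr0.
rewrite -[X in `|X|]subr0 -[X in `|_ - X|]zero -(@RintegralB _ _ _ mu _ _ _ mc); last 2 first.
- by apply: rint_I_sub => //; exact: rintD_I.
- by apply: rint_I_sub => //; exact: rintD_I.
have s1 := sqintB_I _ _ sp hf; have s2 := sqintB_I _ _ sd hg.
have s3 : sqint mu I01 (fun x => a 0 + L * (`|phi x| + `|f x|)).
  apply: sqintD_I; first exact: sqint_cst_I.
  by apply: sqintZ_I; apply: sqintD_I; exact: sqint_norm_I.
pose B1 x := `|phi x - f x| * `|phi^`()%classic x|.
pose B2 x := `|a (f x)| * `|phi^`()%classic x - g x|.
pose B3 x := `|a 0 + L * (`|phi x| + `|f x|)| * `|phi x - f x|.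
have r1 : rint mu I01 B1 by apply: sqintM_I; exact: sqint_norm_I.
have r2 : rint mu I01 B2 by apply: sqintM_I; exact: sqint_norm_I.
have r3 : rint mu I01 B3 by apply: sqintM_I; exact: sqint_norm_I.
have L0 := coef_L _ _ _ ca.
have a00 := coef0_gt0 _ _ _ ca.
have r1L : rint mu I01 (fun x => L * B1 x) by exact: (@rintZ _ _ _ mu _ _ _ measurable_I01).
apply: (@le_trans _ _ (\int[mu]_(x in I01) (L * B1 x + B2 x + B3 x))).
  apply: le_Rint_I => //; first by apply: rintB_I; exact: rintD_I.
    by apply: rintD_I => //; exact: rintD_I.
  move=> x; rewrite /Defs.I01/= in_itv/= => /andP[x0 x1].
  (* Every term of this splitting carries a factor that tends to zero in L^2 with [e]: the Lipschitz
     bounds of [a] and A produce [phi - f] in the first and the last, and the middle one contains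
     the difference of the derivatives. *)
  have -> : a (f x) * g x * (x - c) + A (f x) -
      (a (phi x) * phi^`()%classic x * (x - c) + A (phi x)) =
      ((a (f x) - a (phi x)) * phi^`()%classic x + a (f x) * (g x - phi^`()%classic x)) * (x - c)
      + (A (f x) - A (phi x)) by ring.
  apply: (le_trans (ler_normD _ _)); apply: lerD.
    rewrite normrM -[leRHS]mulr1 ler_pM//; last by rewrite ler_norml; lra.
    apply: (le_trans (ler_normD _ _)); rewrite !normrM; apply: lerD.
      rewrite mulrA ler_wpM2r//; rewrite (distrC (phi x)); exact: (coef_lip _ _ _ ca).
    by rewrite (distrC (g x)).
  rewrite /B3 (distrC (phi x)) [`|a 0 + _|]ger0_norm; last by rewrite addr_ge0 ?(ltW a00)// mulr_ge0// addr_ge0.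
  by apply: (prim_lip _ _ _ _ ca dA); rewrite ?lerDl ?lerDr.
have -> : \int[mu]_(x in I01) (L * B1 x + B2 x + B3 x) =
   L * \int[mu]_(x in I01) B1 x + \int[mu]_(x in I01) B2 x + \int[mu]_(x in I01) B3 x.
  rewrite -(@RintegralZl _ _ _ mu _ _ _ measurable_I01)//.
  rewrite -(@RintegralD _ _ _ mu _ _ _ measurable_I01)//.
  rewrite -(@RintegralD _ _ _ mu _ _ _ measurable_I01)//.
  exact: rintD_I.
have b1 := Rint_normM_I _ _ s1 sd; have b2 := Rint_normM_I _ _ haf s2.
have b3 := Rint_normM_I _ _ s3 s1.
have n3 : nrm mu I01 (fun x => a 0 + L * (`|phi x| + `|f x|)) <= a 0 + L * (2 * nf + 1).
  apply: (le_trans (nrmD_I _ _ (sqint_cst_I _) _)).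
    by apply: sqintZ_I; apply: sqintD_I; exact: sqint_norm_I.
  rewrite nrm_cst_I (ger0_norm (ltW a00)) lerD2l nrmZ_I; last by apply: sqintD_I; exact: sqint_norm_I.
  rewrite ger0_norm// ler_wpM2l//; apply: (le_trans (nrmD_I _ _ (sqint_norm_I _ sp) (sqint_norm_I _ hf))).
  rewrite !nrm_norm_I -/nf; lra.
have n1 := nrm_ge0 mu I01 (fun x => phi x - f x).
have n2 := nrm_ge0 mu I01 (fun x => a (f x)).
have n4 := nrm_ge0 mu I01 phi^`()%classic.
have n5 := nrm_ge0 mu I01 (fun x => a 0 + L * (`|phi x| + `|f x|)).
have c1' : \int[mu]_(x in I01) B1 x <= e * (G + 1).
  apply: (le_trans b1); apply: ler_pM => //; first exact: ltW.
  by rewrite (le_trans nd)// lerD2l.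
have c2' : \int[mu]_(x in I01) B2 x <= nrm mu I01 (fun x => a (f x)) * e.
  by apply: (le_trans b2); rewrite ler_wpM2l// ltW.
have c3' : \int[mu]_(x in I01) B3 x <= (a 0 + L * (2 * nf + 1)) * e.
  by apply: (le_trans b3); apply: ler_pM => //; exact: ltW.
have := ler_wpM2l L0 c1'; lra.
Qed.

End ChainRule.

(** * Fubini on rectangles *)

Section Product.
Context {d1 d2 : measure_display} {X1 : measurableType d1} {X2 : measurableType d2}
  {R : realType}.
Variables (m1 : {sigma_finite_measure set X1 -> \bar R})
          (m2 : {sigma_finite_measure set X2 -> \bar R}).
Notation m12 := (m1 \x m2)%E.
Variables (E : set X1) (J : set X2).
Hypotheses (mE : measurable E) (mJ : measurable J).

Lemma measurable_EJ : measurable (E `*` J). Proof. exact: measurableX. Qed.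

Lemma section_meas (G : X1 * X2 -> R) (s : X2) : J s ->
  measurable_fun (E `*` J) G -> measurable_fun E (fun x => G (x, s)).
Proof.
move=> Js mG; have mGr : measurable_fun setT (G \_ (E `*` J)).
  by apply/(measurable_restrictT G measurable_EJ).
have h : measurable_fun setT (fun x => (G \_ (E `*` J)) (x, s)).
  by apply: (measurableT_comp mGr); exact: pair2_measurable.
apply: (@eq_measurable_fun _ _ _ _ _ (fun x => (G \_ (E `*` J)) (x, s))).
  by move=> x; rewrite inE => Ex; rewrite patchE mem_set.
exact: measurable_funTS.
Qed.

(** Extension by zero reduces the rectangle to the whole product. The space integral is the inner
    one because the estimates on y are made at a fixed time. *)
Lemma Rint_prod (G : X1 * X2 -> R) : rint m12 (E `*` J) G ->
  [/\ {ae m2, forall s, J s -> rint m1 E (fun x => G (x, s))},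
      rint m2 J (fun s => \int[m1]_(x in E) G (x, s)) &
      \int[m12]_(p in E `*` J) G p = \int[m2]_(s in J) \int[m1]_(x in E) G (x, s)].
Proof.
move=> iG; pose g : X1 * X2 -> \bar R := (EFin \o G) \_ (E `*` J).
have ig : m12.-integrable setT g.
  by apply/(integrable_mkcond _ measurable_EJ).
have secE s : J s -> (fun x => g (x, s)) = (fun x => ((fun x => (G (x, s))%:E) \_ E) x).
  move=> Js; apply/funext => x; rewrite /g !patchE.
  have -> : ((x, s) \in E `*` J) = (x \in E) => //.
  by apply/idP/idP; rewrite !inE => //= -[].
have sec0 s : ~ J s -> (fun x => g (x, s)) = cst 0%E.
  move=> Js; apply/funext => x; rewrite /g patchE.
  by case: ifP => //; rewrite inE => -[].
have ae1 : {ae m2, forall s, J s -> rint m1 E (fun x => G (x, s))}.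
  have := ae_integrable2 ig; apply: filterS => s + Js.
  rewrite secE// => h; exact/(integrable_mkcond _ mE).
have iG2 : m2.-integrable setT (fubini_G m1 g).
  have mg := measurable_int _ ig.
  apply/integrableP; split; first exact: (measurable_fubini_G ig).
  apply: le_lt_trans ((integrable21ltyP m1 m2 mg).1 ig).
  apply: ge0_le_integral => //.
  - by apply: measurableT_comp => //; exact: (measurable_fubini_G ig).
  - have := @measurable_fun_fubini_tonelli_G _ _ X1 X2 R m1 (abse \o g).
    by apply => //=; exact: measurableT_comp.
  - move=> s _; apply: le_abse_integral => //.
    by apply: (measurableT_comp mg); exact: pair2_measurable.
have aeE : {ae m2, forall s, J s ->
    fubini_G m1 g s = (\int[m1]_(x in E) G (x, s))%:E}.
  move: ae1; apply: filterS => s h Js; rewrite /fubini_G secE// -integral_mkcond.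
  by rewrite /Rintegral fineK//; apply: integrable_fin_num => //; exact: h.
have iG2J : m2.-integrable J (fubini_G m1 g) by apply: integrableS iG2.
have GJ s : J s -> (\int[m1]_(x in E) G (x, s)) = fine (fubini_G m1 g s).
  by move=> Js; rewrite /fubini_G secE// -integral_mkcond.
have mfin : measurable_fun J (fun s => \int[m1]_(x in E) G (x, s)).
  apply: (@eq_measurable_fun _ _ _ _ _ (fun s => fine (fubini_G m1 g s))).
    by move=> s; rewrite inE => Js; rewrite GJ.
  apply: measurableT_comp => //; exact: measurable_int iG2J.
have rJ : rint m2 J (fun s => \int[m1]_(x in E) G (x, s)).
  apply/integrableP; split; first exact/measurable_EFinP.
  move/integrableP : iG2J => [mg]; apply: le_lt_trans.
  rewrite le_eqVlt; apply/orP; left; apply/eqP.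
  apply: ae_eq_integral => //.
  - by apply: measurableT_comp => //; exact/measurable_EFinP.
  - exact: measurableT_comp.
  - by move: aeE; apply: filterS => s h Js; rewrite h.
split => //.
rewrite /Rintegral; congr fine.
rewrite integral_mkcond -/g -integral21_prod_meas1//.
transitivity (\int[m2]_(s in J) fubini_G m1 g s)%E.
  rewrite [RHS]integral_mkcond; apply: eq_integral => s _; rewrite patchE.
  case: ifPn => // /negP; rewrite inE => Js.
  by rewrite /fubini_G sec0// integral0.
apply: ae_eq_integral => //.
- exact: measurable_int iG2J.
- exact/measurable_EFinP.
Qed.

End Product.

Lemma Linfty_bound {R : realType} (T : R) (u : R * R -> R) : Linfty T u ->
  measurable_fun (QT T : set (measurableTypeR R * measurableTypeR R)) u /\
  exists2 U : R, 0 <= U &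
    {ae (@lebesgue_measure R \x @lebesgue_measure R)%E, forall p, QT T p -> `|u p| <= U}.
Proof.
rewrite /Linfty inE => /andP[]; rewrite inE/= => mu_ ; rewrite inE/= /finite_norm unlock/=.
have mQT : measurable (QT T : set (measurableTypeR R * measurableTypeR R)).
  by apply: measurableX; exact: measurable_itv.
move=> h; split; first exact/(measurable_restrictT u mQT).
(* The infinity norm branches on whether the whole space has positive measure; if it has not, every
   property holds almost everywhere. *)
have [m0|m0] := ltP 0%E ((@lebesgue_measure R \x @lebesgue_measure R)%E setT).
  rewrite m0 in h.
  have := @ess_sup_inf.ess_sup_ge _ _ _ (@lebesgue_measure R \x @lebesgue_measure R)%E
    (abse \o (EFin \o u \_ (QT T))).
  case: (ess_sup_inf.ess_sup _ _) h => [r _|//|_] H.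
  - exists `|r| => //; apply: filterS H => p /= + Qp.
    by rewrite patchE mem_set// lee_fin => /le_trans; apply; exact: ler_norm.
  - by exists 0 => //; apply: filterS H => p /=.
exists 0 => //; exists setT; split => //.
by apply/eqP; rewrite eq_le m0 measure_ge0.
Qed.

(** * Quadratic B-splines *)

Section Spline.
Context {R : realType}.
Notation mu := (@lebesgue_measure R).
Notation I01 := (@I01 R).

Lemma der_eq {f : R -> R} {x a : R} (g : R -> R) (b : R) : is_derive x (1 : R) f a ->
  (forall y, f y = g y) -> a = b -> is_derive x (1 : R) g b.
Proof. by move=> d /funext <- <-. Qed.

Lemma derD {f g : R -> R} {x a b : R} : is_derive x (1 : R) f a ->
  is_derive x (1 : R) g b -> is_derive x (1 : R) (fun y => f y + g y) (a + b).
Proof. by move=> df dg; have := is_deriveD df dg. Qed.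

Lemma derZ {f : R -> R} {x a : R} (k : R) : is_derive x (1 : R) f a ->
  is_derive x (1 : R) (fun y => k * f y) (k * a).
Proof. by move=> df; have := is_deriveZ k df. Qed.

Lemma derM {f g : R -> R} {x a b : R} : is_derive x (1 : R) f a ->
  is_derive x (1 : R) g b -> is_derive x (1 : R) (fun y => f y * g y) (f x * b + g x * a).
Proof. by move=> df dg; have := is_deriveM df dg. Qed.

Definition pospart (s : R) : R := Num.max 0 s.
Definition half_sqr (s : R) : R := pospart s ^+ 2 / 2.
(* step2 is a C^1 step from 0 to 1 on [0, 2], and bspline, a bump on [0, 3], is the difference of
   two consecutive steps, so that sums of translates telescope. *)
Definition step2 (t : R) : R := half_sqr t - 2 * half_sqr (t - 1) + half_sqr (t - 2).
Definition bspline (t : R) : R := step2 t - step2 (t - 1).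
(** Four ramps, with kinks at the ends of the three cells of the support; [chain_rule] evaluates the
    flux against each ramp. *)
Definition dbspline (t : R) : R := pospart t - 3 * pospart (t - 1) + 3 * pospart (t - 2) - pospart (t - 3).

Lemma pospart_ge s : 0 <= s -> pospart s = s. Proof. by move=> h; rewrite /pospart max_r. Qed.
Lemma pospart_le s : s <= 0 -> pospart s = 0. Proof. by move=> h; rewrite /pospart max_l. Qed.

Lemma pospartP s : (0 <= s /\ pospart s = s) \/ (s <= 0 /\ pospart s = 0).
Proof.
have [h|/ltW h] := leP 0 s; first by left; rewrite pospart_ge.
by right; rewrite pospart_le.
Qed.

Lemma step2_0 t : t <= 0 -> step2 t = 0.
Proof. by move=> h; rewrite /step2 /half_sqr !pospart_le; [field|lra..]. Qed.

Lemma step2_1 t : 2 <= t -> step2 t = 1.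
Proof. by move=> h; rewrite /step2 /half_sqr !pospart_ge; [field|lra..]. Qed.

Lemma step2_ge0 t : 0 <= step2 t.
Proof.
rewrite /step2 /half_sqr; have [[h1 ->]|[h1 ->]] := pospartP t; have [[h2 ->]|[h2 ->]] := pospartP (t - 1);
  have [[h3 ->]|[h3 ->]] := pospartP (t - 2); nra.
Qed.

Lemma step2_le1 t : step2 t <= 1.
Proof.
rewrite /step2 /half_sqr; have [[h1 ->]|[h1 ->]] := pospartP t; have [[h2 ->]|[h2 ->]] := pospartP (t - 1);
  have [[h3 ->]|[h3 ->]] := pospartP (t - 2); nra.
Qed.

Lemma bspline0l t : t <= 0 -> bspline t = 0.
Proof. by move=> h; rewrite /bspline !step2_0 ?subrr//; lra. Qed.

Lemma bspline0r t : 3 <= t -> bspline t = 0.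
Proof. by move=> h; rewrite /bspline !step2_1 ?subrr//; lra. Qed.

Lemma bspline_ge0 t : 0 <= bspline t.
Proof.
have [?|?] := leP t 0; first by rewrite bspline0l.
have [?|?] := leP 3 t; first by rewrite bspline0r.
have E1 : t - 1 - 1 = t - 2 by ring.
have E2 : t - 1 - 2 = t - 3 by ring.
rewrite /bspline /step2 /half_sqr E1 E2 (pospart_ge t) ?(pospart_le (t - 3)); [|lra|lra].
have [[h2 ->]|[h2 ->]] := pospartP (t - 1);
  have [[h3 ->]|[h3 ->]] := pospartP (t - 2); nra.
Qed.

Lemma bspline_le1 t : bspline t <= 1.
Proof. by rewrite /bspline lerBlDl (le_trans (step2_le1 t))// lerDr step2_ge0. Qed.

(** A second-order remainder bound treats all points of [half_sqr] alike, including 0, where its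
    derivative [pospart] has a kink. *)
Lemma is_derive_quad (f : R -> R) (x l C : R) :
  (forall h, `|f (x + h) - f x - h * l| <= C * h ^+ 2) -> is_derive x (1 : R) f l.
Proof.
move=> H; have C0 : 0 <= C by have := H 1; rewrite expr1n mulr1; apply: le_trans.
have cv : (fun h : R => h^-1 *: (f (h *: (1 : R) + x) - f x)) @ 0^' --> l.
  apply/cvgrPdist_lt => e e0; near=> h.
  have h0 : h != 0 by near: h; exact: nbhs_dnbhs_neq.
  have he : `|h| < e / (C + 1).
    near: h; apply: dnbhs0_lt; rewrite divr_gt0// ltr_wpDl//.
  rewrite /GRing.scale/= mulr1 [h + x]addrC.
  have -> : l - h^-1 * (f (x + h) - f x) = - (h^-1 * (f (x + h) - f x - h * l)).
    by field.
  rewrite normrN normrM normfV ltr_pdivrMl ?normr_gt0//.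
  apply: (le_lt_trans (H h)); rewrite -(real_normK (num_real h)) expr2 mulrCA.
  rewrite ltr_pM2l ?normr_gt0//.
  move: he; rewrite ltr_pdivlMr ?ltr_wpDl//; have := normr_ge0 h; nra.
by apply: DeriveDef; [apply/cvg_ex; exists l|exact/cvg_lim].
Unshelve. all: by end_near. Qed.

Lemma half_sqr_derive (x : R) : is_derive x (1 : R) half_sqr (pospart x).
Proof.
apply: (is_derive_quad _ _ _ (1 / 2)) => h; rewrite /half_sqr ler_norml.
by have [[h1 ->]|[h1 ->]] := pospartP x; have [[h2 ->]|[h2 ->]] := pospartP (x + h);
  apply/andP; split; nra.
Qed.

Lemma pospart_lip (x y : R) : `|pospart x - pospart y| <= `|x - y|.
Proof.
rewrite ler_norml; have := ler_norm (x - y); have := ler_norm (y - x); rewrite (distrC y x) => h1 h2.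
by have [[? ->]|[? ->]] := pospartP x; have [[? ->]|[? ->]] := pospartP y; apply/andP; split; lra.
Qed.

Lemma pospart_continuous : continuous pospart.
Proof.
move=> x; apply/cvgrPdist_lt => e e0.
have := nbhsx_ballx x e e0; apply: filterS => y.
rewrite -ball_normE /= => xy; apply: le_lt_trans xy.
rewrite ler_norml; have := ler_norm (x - y); have := ler_norm (y - x).
rewrite (distrC y x).
by have [[h1 ->]|[h1 ->]] := pospartP x; have [[h2 ->]|[h2 ->]] := pospartP y; move=> *;
  apply/andP; split; lra.
Qed.

Lemma is_derive_affine (f df : R -> R) (k c : R) :
  (forall x : R, is_derive x (1 : R) f (df x)) ->
  forall x : R, is_derive x (1 : R) (fun x => f (k * x - c)) (k * df (k * x - c)).
Proof.
move=> d x.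
have d2 : is_derive x (1 : R) (fun x : R => k * x - c) k.
  apply: der_eq (derD (derZ k (is_derive_id x (1:R))) (is_derive_cst (- c) x 1)) _ _ => //.
  by rewrite mulr1 addr0.
have := @is_derive1_comp R f (fun x : R => k * x - c) x _ _ (d (k * x - c)) d2.
by rewrite mulrC.
Qed.

Lemma continuous_affine (f : R -> R) (k c : R) : continuous f ->
  continuous (fun x => f (k * x - c)).
Proof.
move=> cf x; apply: (@continuous_comp _ _ _ (fun x : R => k * x - c) f); last exact: cf.
apply: (@contD _ (fun x => k * x) (fun _ => - c)); last exact: contC.
by apply: contM; [exact: contC|move=> y; exact: cvg_id].
Qed.

(** The spline on the grid of mesh [1 / k], supported on the three cells between [j / k] and
    [(j + 3) / k]. *)
Definition nodal (k : R) (j : nat) (x : R) : R := bspline (k * x - j%:R).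
Definition dnodal (k : R) (j : nat) (x : R) : R := k * dbspline (k * x - j%:R).

Lemma bspline_derive (x : R) : is_derive x (1 : R) bspline (dbspline x).
Proof.
have d (c : R) := is_derive_affine _ _ 1 c half_sqr_derive x.
apply: der_eq (derD (derD (d 0) (derZ 3 (d 2))) (derD (derZ (-3) (d 1)) (derZ (-1) (d 3)))) _ _.
- move=> t; rewrite /bspline /step2 !mul1r subr0.
  have -> : t - 1 - 1 = t - 2 by ring.
  have -> : t - 1 - 2 = t - 3 by ring.
  ring.
- by rewrite /dbspline !mul1r subr0; ring.
Qed.

Lemma dbspline_continuous : continuous dbspline.
Proof.
have c1 (c : R) : continuous (fun x => pospart (x - c)).
  move=> x; have := continuous_affine _ 1 c pospart_continuous x.
  by under eq_fun do rewrite mul1r.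
rewrite (_ : dbspline = (fun t => (pospart t + -3 * pospart (t - 1)) + (3 * pospart (t - 2) + -1 * pospart (t - 3)))).
  exact: (contD _ _ (contD _ _ pospart_continuous (contM _ _ (contC (-3)) (c1 1)))
    (contD _ _ (contM _ _ (contC 3) (c1 2)) (contM _ _ (contC (-1)) (c1 3)))).
by apply/funext => t; rewrite /dbspline; ring.
Qed.

Lemma nodal_derive k j (x : R) : is_derive x (1 : R) (nodal k j) (dnodal k j x).
Proof. exact: (is_derive_affine _ _ k j%:R bspline_derive x). Qed.

Lemma dnodal_continuous k j : continuous (dnodal k j).
Proof.
apply: contM; first exact: contC.
exact: continuous_affine dbspline_continuous.
Qed.

Lemma nodal_continuous k j : continuous (nodal k j).
Proof. exact: is_derive_continuous (nodal_derive k j). Qed.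

Lemma nodal_ge0 k j x : 0 <= nodal k j x. Proof. exact: bspline_ge0. Qed.
Lemma nodal_le1 k j x : nodal k j x <= 1. Proof. exact: bspline_le1. Qed.

Lemma sum_nodal k m x : \sum_(j < m) nodal k j x = step2 (k * x) - step2 (k * x - m%:R).
Proof.
elim: m => [|m IH]; first by rewrite big_ord0 subr0 subrr.
rewrite big_ord_recr /= IH /nodal /bspline.
have -> : k * x - m.+1%:R = k * x - m%:R - 1 by rewrite -natr1; ring.
ring.
Qed.

Lemma sum_nodal_le1 k m x : \sum_(j < m) nodal k j x <= 1.
Proof. by rewrite sum_nodal lerBlDl (le_trans (step2_le1 _))// lerDr step2_ge0. Qed.

Lemma sum_nodal_eq1 k m x : 2 <= k * x -> k * x <= m%:R -> \sum_(j < m) nodal k j x = 1.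
Proof. by move=> h1 h2; rewrite sum_nodal step2_1// step2_0 ?subr0//; lra. Qed.

Lemma half_sqr_prim (x : R) : is_derive x (1 : R) (fun x => x * half_sqr x / 3) (half_sqr x).
Proof.
apply: der_eq (derZ 3^-1 (derM (is_derive_id x (1:R)) (half_sqr_derive x))) _ _.
- by move=> y; rewrite mulrC.
- by rewrite /half_sqr; have [[h ->]|[h ->]] := pospartP x; field.
Qed.

Lemma Rint_nodal (k : R) (j : nat) : j%:R + 3 <= k -> \int[mu]_(x in I01) nodal k j x = k^-1.
Proof.
move=> jk; have k0 : k != 0 by apply: lt0r_neq0; apply: lt_le_trans jk; rewrite ltr_wpDl.
have j0 : 0 <= (j%:R : R) by [].
pose W c x := k^-1 * ((k * x - c) * half_sqr (k * x - c) / 3).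
have dW c (x : R) : is_derive x (1 : R) (W c) (half_sqr (k * x - c)).
  apply: der_eq (derZ k^-1 (is_derive_affine _ _ k c half_sqr_prim x)) _ _ => //.
  by rewrite mulKf.
pose V x := W j%:R x + 3 * W (j%:R + 2) x + (-3 * W (j%:R + 1) x + -1 * W (j%:R + 3) x).
have dd (x : R) : is_derive x (1 : R) V (nodal k j x).
  apply: der_eq (derD (derD (dW j%:R x) (derZ 3 (dW (j%:R + 2) x)))
    (derD (derZ (-3) (dW (j%:R + 1) x)) (derZ (-1) (dW (j%:R + 3) x)))) _ _ => //.
  rewrite /nodal /bspline /step2.
  have -> : k * x - (j%:R + 2) = k * x - j%:R - 2 by ring.
  have -> : k * x - (j%:R + 1) = k * x - j%:R - 1 by ring.
  have -> : k * x - (j%:R + 3) = k * x - j%:R - 3 by ring.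
  have -> : k * x - j%:R - 1 - 1 = k * x - j%:R - 2 by ring.
  have -> : k * x - j%:R - 1 - 2 = k * x - j%:R - 3 by ring.
  ring.
rewrite /Defs.I01 (FTC2 _ _ 0 1 ler01 dd (nodal_continuous k j)) /V /W.
rewrite !mulr1 !mulr0 /half_sqr !(pospart_le (0 - _)); [|lra..].
rewrite !pospart_ge; [|lra..].
by field.
Qed.

End Spline.

Lemma ae_abs_Rint d (X : measurableType d) (R : realType) (mu : {measure set X -> \bar R})
  (D : set X) (f g : X -> R) : measurable D -> measurable_fun D f -> rint mu D g ->
  {ae mu, forall x, D x -> `|f x| <= g x} ->
  `|\int[mu]_(x in D) f x| <= \int[mu]_(x in D) g x.
Proof.
move=> mD mf hg fg; have hf := @ae_rint _ _ _ mu _ _ _ mD mf hg fg.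
apply: (le_trans (@le_normr_Rintegral _ _ _ mu _ _ mD hf)).
exact: (@ae_le_Rint _ _ _ mu _ _ _ mD (rint_norm mu hf) hg fg).
Qed.

(** * Node and cell averages at a fixed time *)

Section Slice.
Context {R : realType}.
Notation mu := (@lebesgue_measure R).
Notation I01 := (@I01 R).
Variables (a A : R -> R) (a0 L : R).
Hypothesis ca : coefficient a a0 L.
Hypothesis A0 : A 0 = 0.
Hypothesis dA : forall x : R, is_derive x (1 : R) A (a x).

Lemma H10_prim1 (f g : R -> R) : H10 f g -> prim0 g 1 = 0.
Proof.
move=> H; apply/eqP; rewrite -normr_le0.
apply: (@le_small _ _ _ 1) => e e0 _; rewrite add0r mul1r.
have [phi [cphi _ _ h3]] := H10_approx _ _ H e e0.
have [_ _ _ _ phi1] := Ccinfty_spec _ cphi.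
by have := h3 1; rewrite phi1 sub0r normrN lexx ler01; exact.
Qed.

Lemma I01P (x : R) : I01 x -> 0 <= x <= 1.
Proof. by rewrite /Defs.I01/= in_itv/= => /andP[x0 x1]; rewrite !ltW. Qed.

Lemma nodal_sqint k j : sqint mu I01 (nodal k j : R -> R).
Proof. exact/continuous_sqint/nodal_continuous. Qed.

Lemma nodal_rint k j : rint mu I01 (nodal k j : R -> R).
Proof. exact: (sqint_rint mu measurable_I01 mu_I01_fin (nodal_sqint k j)). Qed.

(** The spline has integral [1 / k], and [f] agrees almost everywhere with its continuous
    representative, so freezing [f] at [Yc] on the support of the spline costs the oscillation
    there. With [w = 1] this concerns the node averages, with [w] the control it concerns the
    source, and [Yc = 0] gives plain bounds. *)
Lemma weighted_average (f g w : R -> R) (U Yc d k : R) (j : nat) : H10 f g ->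
  j%:R + 3 <= k -> measurable_fun I01 w -> (forall x, I01 x -> `|w x| <= U) -> 0 <= d ->
  (forall x, I01 x -> nodal k j x != 0 -> `|prim0 g x - Yc| <= d) ->
  `|\int[mu]_(x in I01) (w x * f x * nodal k j x)
    - Yc * \int[mu]_(x in I01) (w x * nodal k j x)| <= U * d / k.
Proof.
move=> H jk mw wU d0 hd; have [hf hg] := H10_L2 _ _ H.
have hn := nodal_sqint k j.
have i1 : rint mu I01 (fun x => w x * f x * nodal k j x).
  by apply: sqintM_I => //; exact: (@sqintM_bdd _ _ _ mu _ _ _ U measurable_I01 mw wU hf).
have i2 : rint mu I01 (fun x => w x * nodal k j x).
  exact: (@rintM_bdd _ _ _ mu _ _ _ U measurable_I01 mw wU (nodal_rint k j)).
have i3 : rint mu I01 (fun x => Yc * (w x * nodal k j x)).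
  exact: (@rintZ _ _ _ mu _ _ _ measurable_I01).
rewrite -(@RintegralZl _ _ _ mu _ _ _ measurable_I01)//.
rewrite -(@RintegralB _ _ _ mu _ _ _ measurable_I01)//.
have -> : U * d / k = \int[mu]_(x in I01) (U * d * nodal k j x).
  rewrite (@RintegralZl _ _ _ mu _ _ _ measurable_I01) ?Rint_nodal//; exact: nodal_rint.
apply: (@ae_abs_Rint _ _ _ mu _ _ _ measurable_I01).
- exact: (rint_meas mu (rintB_I _ _ i1 i3)).
- exact: (@rintZ _ _ _ mu _ _ _ measurable_I01 (nodal_rint k j)).
- apply: ae_imp (H10_ae _ _ H) => x fF Ix; rewrite fF//.
  have -> : w x * prim0 g x * nodal k j x - Yc * (w x * nodal k j x) =
    w x * (prim0 g x - Yc) * nodal k j x by ring.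
  have [->|n0] := eqVneq (nodal k j x) 0; first by rewrite !mulr0 normr0.
  rewrite !normrM (ger0_norm (nodal_ge0 k j x)) ler_wpM2r ?nodal_ge0//.
  by apply: ler_pM => //; [exact: wU|exact: hd].
Qed.

Lemma cell_average (f g : R -> R) (S Yc d k al be : R) : H10 f g ->
  0 <= al -> al <= be -> be <= 1 -> be - al = k^-1 -> 0 <= d -> 0 < k ->
  (forall x, al <= x <= be -> `|prim0 g x| <= S) -> `|Yc| <= S ->
  (forall x, al <= x <= be -> `|prim0 g x - Yc| <= d) ->
  `|k * \int[mu]_(x in `]al, be[) A (f x) - A Yc| <= (a 0 + L * S) * d.
Proof.
move=> H al0 albe be1 bk d0 k0 hS YS hd; have [hf hg] := H10_L2 _ _ H.
have mc : measurable (`]al, be[ : set (measurableTypeR R)) by exact: measurable_itv.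
have fc := @mu_itvoo_fin R al be.
have sub := @sub_I01 R al be al0 be1.
have S0 : 0 <= S by rewrite (le_trans _ YS).
have c0 : 0 <= a 0 + L * S.
  by rewrite addr_ge0 ?mulr_ge0 ?(coef_L _ _ _ ca)// ltW// (coef0_gt0 _ _ _ ca).
have i1 : rint mu `]al, be[ (fun x => A (f x)).
  exact: (@rintS _ _ _ mu _ _ _ measurable_I01 mc sub (prim_rint _ _ _ _ ca A0 dA _ hf)).
have icst c : rint mu `]al, be[ (fun=> c : R) by exact: (rint_cst mu c mc fc).
have Ecst c : \int[mu]_(x in `]al, be[) c = c / k.
  apply: (eq_trans (@Rintegral_cst _ _ _ mu _ mc c)); congr (_ * _).
  by rewrite -bk -mu_itvoo.
have -> : k * \int[mu]_(x in `]al, be[) A (f x) - A Yc =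
   k * \int[mu]_(x in `]al, be[) (A (f x) - A Yc).
  have E1 : \int[mu]_(x in `]al, be[) (A (f x) - A Yc) =
      \int[mu]_(x in `]al, be[) A (f x) - \int[mu]_(x in `]al, be[) A Yc.
    exact: (@RintegralB _ _ _ mu _ _ _ mc i1 (icst (A Yc))).
  by rewrite E1 Ecst; field; exact: lt0r_neq0.
rewrite normrM (gtr0_norm k0) -ler_pdivlMl//.
rewrite mulrC -Ecst; apply: (@ae_abs_Rint _ _ _ mu _ _ _ mc) => //.
  exact: (rint_meas mu (@rintB _ _ _ mu _ _ _ mc i1 (icst (A Yc)))).
apply: ae_imp (H10_ae _ _ H) => x fF Cx; rewrite fF//; last exact: sub.
have xI : al <= x <= be by move: Cx; rewrite /= in_itv/= => /andP[/ltW -> /ltW ->].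
apply: (le_trans (prim_lip _ _ _ _ ca dA S _ _ (hS _ xI) YS)).
by rewrite ler_wpM2l// hd.
Qed.

Section FixedSlice.
Variables (f g w : R -> R) (Cy U : R) (n : nat).
Hypothesis H : H10 f g.
Hypothesis fC : nrm mu I01 f <= Cy.
Hypothesis mw : measurable_fun I01 w.
Hypothesis wU : forall x, I01 x -> `|w x| <= U.
Hypothesis n3 : (3 <= n)%N.

Let N := nrm mu I01 g.
Let k : R := n%:R.
Let S := Num.sqrt (2 * Cy * N).
Let d := Num.min (Num.sqrt (3 / k) * N) (2 * S).

(** The shift by one places node [i] over the middle cell of its spline, which is the cell of
    [cell_avg i]. The interior nodes are those with [0 < i] and [i.+1 < n]. At [i = 0] the
    predecessor repeats the spline of node 1; that value is only ever multiplied by a test vanishing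
    at 0. *)
Definition node_avg (i : nat) := k * \int[mu]_(x in I01) (f x * nodal k i.-1 x).
Definition cell_avg (i : nat) := k * \int[mu]_(x in `]i%:R / k, i.+1%:R / k[) A (f x).

Let k0 : 0 < k. Proof. by rewrite /k ltr0n (leq_trans _ n3). Qed.

Let N0 : 0 <= N. Proof. exact: nrm_ge0. Qed.
Let S0 : 0 <= S. Proof. exact: sqrtr_ge0. Qed.
Let d0 : 0 <= d.
Proof. by rewrite /d le_min; rewrite !mulr_ge0 ?sqrtr_ge0. Qed.

Let supS x : 0 <= x <= 1 -> `|prim0 g x| <= S.
Proof.
move=> xI; have := H10_sup _ _ _ H xI.
rewrite -sqrtr_sqr => h; rewrite ler_wsqrtr// (le_trans h)//.
by rewrite ler_wpM2r// ler_wpM2l.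
Qed.

Let osc x y : 0 <= x <= 1 -> 0 <= y <= 1 -> `|x - y| <= 3 / k ->
  `|prim0 g x - prim0 g y| <= d.
Proof.
move=> xI yI xy; have [_ hg] := H10_L2 _ _ H.
rewrite /d le_min; apply/andP; split.
  apply: (le_trans (prim0_holder _ _ _ xI yI hg)).
  by rewrite ler_wpM2r// ler_wsqrtr.
rewrite (le_trans (ler_normB _ _))// mulr_natl mulr2n lerD// supS//.
Qed.

Lemma nodal_supp (j : nat) (x : R) : nodal k j x != 0 -> j%:R / k <= x <= (j%:R + 3) / k.
Proof.
move=> h; apply/andP; split; rewrite leNgt; apply: contra h => h.
- rewrite /nodal bspline0l//.
  by move: h; rewrite ltr_pdivlMr// => h; rewrite subr_le0 mulrC ltW.
- rewrite /nodal bspline0r//.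
  by move: h; rewrite ltr_pdivrMr// => h; rewrite lerBrDl mulrC ltW.
Qed.

Lemma node_osc (i : nat) (x : R) : (0 < i)%N -> (i.+1 < n)%N ->
  i.-1%:R / k <= x <= (i.-1%:R + 3) / k -> `|prim0 g x - node_avg i| <= d.
Proof.
move=> i0 im /andP[x1 x2].
have ik : i.-1%:R + 3 <= k.
  by rewrite /k -natrD ler_nat addn3; case: i i0 im {x1 x2}.
have xI : 0 <= x <= 1.
  rewrite (le_trans _ x1) ?divr_ge0 ?ler0n ?(ltW k0)//= (le_trans x2)//.
  by rewrite ler_pdivrMr// mul1r.
have wa := weighted_average f g (fun=> 1) 1 (prim0 g x) d k i.-1 H ik _ _ d0 _.
rewrite distrC /node_avg -/k.
have -> : k * \int[mu]_(x in I01) (f x * nodal k i.-1 x) - prim0 g x =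
  k * (\int[mu]_(x in I01) (1 * f x * nodal k i.-1 x) - prim0 g x *
     \int[mu]_(x in I01) (1 * nodal k i.-1 x)).
  have -> : \int[mu]_(x in I01) (1 * f x * nodal k i.-1 x) =
      \int[mu]_(x in I01) (f x * nodal k i.-1 x).
    by apply: eq_Rint_in => z _; rewrite mul1r.
  have -> : \int[mu]_(x in I01) (1 * nodal k i.-1 x) = \int[mu]_(x in I01) nodal k i.-1 x.
    by apply: eq_Rint_in => z _; rewrite mul1r.
  rewrite Rint_nodal//; field; exact: lt0r_neq0.
rewrite normrM (gtr0_norm k0) -ler_pdivlMl// [leRHS]mulrC -[d]mul1r; apply: wa => //.
- by move=> z _; rewrite normr1.
- move=> z zI /nodal_supp /andP[z1 z2]; apply: osc => //; first exact: I01P.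
  rewrite ler_norml; move: x1 x2 z1 z2; rewrite mulrDl; lra.
Qed.

Lemma node_supS (i : nat) : (0 < i)%N -> (i.+1 < n)%N -> `|node_avg i| <= S.
Proof.
move=> i0 im.
have ik : i.-1%:R + 3 <= k.
  by rewrite /k -natrD ler_nat addn3; case: i i0 im.
have := weighted_average f g (fun=> 1) 1 0 S k i.-1 H ik _ _ S0 _.
rewrite mul0r subr0 /node_avg normrM (gtr0_norm k0) -ler_pdivlMl// mulrC => wa.
rewrite (eq_Rint_in mu _ _ (fun x => 1 * f x * nodal k i.-1 x)); last by move=> z _; rewrite mul1r.
rewrite -[S]mul1r; apply: wa => //.
- by move=> z _; rewrite normr1.
- by move=> z zI _; rewrite subr0 supS//; exact: I01P.
Qed.

Let cellI (i : nat) x : (i < n)%N -> i%:R / k <= x <= i.+1%:R / k -> 0 <= x <= 1.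
Proof.
move=> im /andP[x1 x2]; rewrite (le_trans _ x1) ?divr_ge0 ?ler0n ?(ltW k0)//=.
by rewrite (le_trans x2)// ler_pdivrMr// mul1r ler_nat.
Qed.

Let cellgen (i : nat) (Yc d' : R) : (i < n)%N -> 0 <= d' -> `|Yc| <= S ->
  (forall x, i%:R / k <= x <= i.+1%:R / k -> `|prim0 g x - Yc| <= d') ->
  `|cell_avg i - A Yc| <= (a 0 + L * S) * d'.
Proof.
move=> im d0' YS hd; apply: (cell_average f g S Yc d' k _ _ H) => //.
- by rewrite divr_ge0 ?ler0n// ltW.
- by rewrite ler_wpM2r ?invr_ge0 ?(ltW k0)// ler_nat.
- by rewrite ler_pdivrMr// mul1r ler_nat.
- by rewrite -mulrBl -natr1 addrC addKr mul1r.
- by move=> x /(cellI _ _ im); exact: supS.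
Qed.

Lemma cell_osc (i : nat) : (0 < i)%N -> (i.+1 < n)%N ->
  `|cell_avg i - A (node_avg i)| <= (a 0 + L * S) * d.
Proof.
move=> i0 im; apply: cellgen => //; [exact: ltnW|exact: node_supS|].
move=> x /andP[x1 x2]; apply: node_osc => //; apply/andP; split.
  by rewrite (le_trans _ x1)// ler_wpM2r ?invr_ge0 ?(ltW k0)// ler_nat leq_pred.
rewrite (le_trans x2)// ler_wpM2r ?invr_ge0 ?(ltW k0)// -natrD ler_nat.
by case: i i0 {im x1 x2} => //= i _; rewrite addn3.
Qed.

(** The two extreme cells carry no node, and the scheme has value 0 there. The Dirichlet condition
    makes their averages of A(y) an error of the same size as the oscillation over an interior
    cell. *)
Lemma cell_bdry0 : `|cell_avg 0| <= (a 0 + L * S) * d.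
Proof.
rewrite -[cell_avg 0]subr0 -[X in _ - X]A0; apply: cellgen => //; rewrite ?normr0//.
  by rewrite (leq_trans _ n3).
move=> x xI; rewrite subr0; have xI' := cellI 0 x (leq_trans _ n3) xI.
rewrite -[prim0 g x]subr0 -(prim0_0 g); apply: osc; rewrite ?lexx ?ler01//; first exact: xI'.
move: xI => /andP[x1 x2]; move: x1; rewrite mul0r subr0 => x1.
by rewrite ger0_norm// (le_trans x2)// ler_wpM2r ?invr_ge0 ?(ltW k0)// ler_nat.
Qed.

Lemma cell_bdry1 : `|cell_avg n.-1| <= (a 0 + L * S) * d.
Proof.
rewrite -[cell_avg n.-1]subr0 -[X in _ - X]A0; have nn : n.-1.+1 = n by case: n n3.
apply: cellgen => //; rewrite ?normr0//.
  by rewrite -ltnS nn.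
move=> x xI; have xI' := cellI n.-1 x _ xI; rewrite subr0.
rewrite -[prim0 g x]subr0 -(H10_prim1 _ _ H); apply: osc; rewrite ?lexx ?ler01//.
  by apply: xI'; rewrite -ltnS nn.
move: xI => /andP[x1 x2]; move: x2; rewrite nn divff ?lt0r_neq0// => x2.
rewrite distrC ger0_norm ?subr_ge0// lerBlDr (le_trans _ (lerD (lexx _) x1))//.
rewrite -mulrDl ler_pdivlMr// mul1r /k -natrD ler_nat.
by rewrite (leq_trans (leqSpred n))// -[n.-1.+1]add1n leq_add2r.
Qed.

Lemma cell_abs (i : nat) : (i < n)%N -> `|cell_avg i| <= (a 0 + L * S) * S.
Proof.
move=> im; rewrite -[cell_avg i]subr0 -[X in _ - X]A0; apply: cellgen => //; rewrite ?normr0//.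
by move=> x xI; rewrite subr0 supS//; exact: cellI im xI.
Qed.

Lemma source_osc (i : nat) : (0 < i)%N -> (i.+1 < n)%N ->
  `|\int[mu]_(x in I01) (w x * f x * nodal k i.-1 x)
    - node_avg i * \int[mu]_(x in I01) (w x * nodal k i.-1 x)| <= U * d / k.
Proof.
move=> i0 im; apply: (weighted_average f g) => //.
  by rewrite /k -natrD ler_nat addn3; case: i i0 im.
by move=> x xI /nodal_supp; exact: node_osc.
Qed.

Lemma source_abs (i : nat) : (0 < i)%N -> (i.+1 < n)%N ->
  `|\int[mu]_(x in I01) (w x * f x * nodal k i.-1 x)| <= U * S / k.
Proof.
move=> i0 im; have := weighted_average f g w U 0 S k i.-1 H _ mw wU S0 _.
rewrite mul0r subr0; apply.
  by rewrite /k -natrD ler_nat addn3; case: i i0 im.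
by move=> x xI _; rewrite subr0 supS//; exact: I01P.
Qed.

End FixedSlice.
End Slice.

(** * The flux as a second difference of cell averages *)

Section FluxIdentity.
Context {R : realType}.
Notation mu := (@lebesgue_measure R).
Notation I01 := (@I01 R).

Lemma Rint_split (f : R -> R) (x y z : R) : x <= y -> y <= z -> rint mu `]x, z[ f ->
  \int[mu]_(t in `]x, z[) f t = \int[mu]_(t in `]x, y[) f t + \int[mu]_(t in `]y, z[) f t.
Proof.
move=> xy yz hf.
have sub (u v : R) : x <= u -> v <= z -> rint mu `]u, v[ f.
  move=> xu vz; apply: (@rintS _ _ _ mu _ _ _ (measurable_itv _) (measurable_itv _) _ hf).
  by move=> t; rewrite /= !in_itv/= => /andP[ut tv]; rewrite (le_lt_trans xu ut) (lt_le_trans tv vz).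
have [->|xny] := eqVneq x y; first by rewrite set_itvoo0 Rintegral_set0 add0r.
have [<-|ynz] := eqVneq y z; first by rewrite set_itvoo0 Rintegral_set0 addr0.
have xy' : x < y by rewrite lt_def eq_sym xny.
have yz' : y < z by rewrite lt_def eq_sym ynz.
rewrite (@Rintegral_itv_bndo_bndc _ (BRight x) y); last exact: sub.
rewrite -(@Rintegral_itvB _ f (BRight x) (BLeft z) y)//.
by rewrite addrC subrK.
Qed.

Lemma Rint_ramp (f : R -> R) (xi : R) : 0 <= xi -> rint mu I01 f ->
  \int[mu]_(x in I01) (f x * pospart (x - xi)) = \int[mu]_(x in `]xi, 1[) (f x * (x - xi)).
Proof.
move=> xi0 hf.
have -> : (`]xi, 1[ : set R) = I01 `&` `]xi, 1[.
  rewrite setIidr//; exact: sub_I01.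
rewrite Rintegral_mkcondr; apply: eq_Rint_in => x.
rewrite /Defs.I01/= in_itv/= => /andP[x0 x1]; rewrite patchE.
case: ifPn => [|/negP].
  by rewrite inE /= in_itv/= => /andP[xx _]; rewrite pospart_ge// subr_ge0 ltW.
rewrite inE /= in_itv/= x1 andbT => /negP; rewrite -leNgt => xxi.
by rewrite pospart_le ?mulr0// subr_le0.
Qed.

Variables (a A : R -> R) (a0 L : R).
Hypothesis ca : coefficient a a0 L.
Hypothesis A0 : A 0 = 0.
Hypothesis dA : forall x : R, is_derive x (1 : R) A (a x).

Lemma pospart_scale (k s : R) : 0 <= k -> pospart (k * s) = k * pospart s.
Proof.
move=> k0; have [[s0 ->]|[s0 ->]] := pospartP s; first by rewrite pospart_ge ?mulr_ge0.
by rewrite pospart_le ?mulr0// mulr_ge0_le0.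
Qed.

(** The derivative of the spline is a third difference of ramps. [chain_rule] turns each ramp into
    the tail integral [P] of A(f), and consecutive tails differ by one cell. The flux is thus
    discretized exactly, in terms of averages of A(f). *)
Lemma flux_identity (f g : R -> R) (n j : nat) : H10 f g -> (j + 3 <= n)%N ->
  \int[mu]_(x in I01) (a (f x) * g x * dnodal n%:R j x) =
  - n%:R * (cell_avg A f n j - 2 * cell_avg A f n j.+1 + cell_avg A f n j.+2).
Proof.
move=> H jn; have [hf hg] := H10_L2 _ _ H.
pose k : R := n%:R; have k0 : 0 < k by rewrite /k ltr0n (leq_trans _ jn)// addn3.
have iag : rint mu I01 (fun x => a (f x) * g x).
  by apply: sqintM_I => //; exact: coef_sqint ca _ _.
pose xi (l : nat) : R := (j + l)%:R / k.
have xiI l : (l <= 3)%N -> 0 <= xi l <= 1.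
  move=> l3; rewrite /xi divr_ge0 ?ler0n ?(ltW k0)//= ler_pdivrMr// mul1r ler_nat.
  by rewrite (leq_trans _ jn)// leq_add2l.
pose P l := \int[mu]_(x in `]xi l, 1[) A (f x).
have iA := prim_rint _ _ _ _ ca A0 dA _ hf.
have Pcell l : (l < 3)%N -> cell_avg A f n (j + l) = k * (P l - P l.+1).
  move=> l3; rewrite /cell_avg /P -/k.
  have /andP[x0 x1] := xiI l (ltnW l3).
  have /andP[y0 y1] := xiI l.+1 l3.
  have xy : xi l <= xi l.+1 by rewrite ler_wpM2r ?invr_ge0 ?(ltW k0)// ler_nat leq_add2l.
  rewrite (Rint_split _ (xi l) (xi l.+1) 1)//; last exact: rint_I_sub.
  by rewrite addrK /xi addnS.
have ramp l : (l <= 3)%N ->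
    \int[mu]_(x in I01) (a (f x) * g x * pospart (x - xi l)) = - P l.
  move=> l3; have xl := xiI _ l3; rewrite Rint_ramp//; last by case/andP: xl.
  exact: chain_rule ca A0 dA _ _ _ H xl.
have iramp l : (l <= 3)%N -> rint mu I01 (fun x => a (f x) * g x * pospart (x - xi l)).
  move=> l3; have /andP[x0 x1] := xiI _ l3.
  apply: (@eq_rint _ _ _ mu _ (fun x => pospart (x - xi l) * (a (f x) * g x)) _ measurable_I01).
    by move=> x _; rewrite mulrC.
  apply: (@rintM_bdd _ _ _ mu _ _ (fun x => pospart (x - xi l)) 1 measurable_I01) => //.
    apply: continuous_measurable => //; first exact: measurable_I01.
    move=> x; have := continuous_affine _ 1 (xi l) pospart_continuous x.
    by under eq_fun do rewrite mul1r.
  move=> x /I01P /andP[z0 z1].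
  by rewrite ler_norml; have [[? ->]|[? ->]] := pospartP (x - xi l); lra.
have E x : a (f x) * g x * dnodal k j x = k ^+ 2 * (a (f x) * g x * pospart (x - xi 0%N)
    - 3 * (a (f x) * g x * pospart (x - xi 1%N)) + 3 * (a (f x) * g x * pospart (x - xi 2%N))
    - a (f x) * g x * pospart (x - xi 3%N)).
  have xl (l : nat) : k * x - j%:R - l%:R = k * (x - xi l).
    rewrite mulrBr /xi natrD -addrA -opprD; congr (_ - _).
    by rewrite mulrC divfK// lt0r_neq0.
  have x0 : k * x - j%:R = k * (x - xi 0%N) by rewrite -xl subr0.
  have x1 : k * x - j%:R - 1 = k * (x - xi 1%N) by rewrite -xl.
  have x2 : k * x - j%:R - 2 = k * (x - xi 2%N) by rewrite -xl.
  have x3 : k * x - j%:R - 3 = k * (x - xi 3%N) by rewrite -xl.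
  rewrite /dnodal /dbspline x1 x2 x3 x0.
  by rewrite !pospart_scale ?(ltW k0)//; ring.
rewrite (eq_Rint_in mu _ _ _ (fun x _ => E x)).
have r3 c l : (l <= 3)%N -> rint mu I01 (fun x => c * (a (f x) * g x * pospart (x - xi l))).
  by move=> l3; exact: (@rintZ _ _ _ mu _ _ _ measurable_I01 (iramp l l3)).
have s1 := rintB_I _ _ (iramp 0%N isT) (r3 3 1%N isT).
have s2 := rintD_I _ _ s1 (r3 3 2%N isT).
have s3 := rintB_I _ _ s2 (iramp 3%N isT).
rewrite (@RintegralZl _ _ _ mu _ _ _ measurable_I01 s3).
rewrite (@RintegralB _ _ _ mu _ _ _ measurable_I01 s2 (iramp 3%N isT)).
rewrite (@RintegralD _ _ _ mu _ _ _ measurable_I01 s1 (r3 3 2%N isT)).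
rewrite (@RintegralB _ _ _ mu _ _ _ measurable_I01 (iramp 0%N isT) (r3 3 1%N isT)).
rewrite (@RintegralZl _ _ _ mu _ _ _ measurable_I01 (iramp 1%N isT)).
rewrite (@RintegralZl _ _ _ mu _ _ _ measurable_I01 (iramp 2%N isT)).
rewrite !ramp//.
have := Pcell 0%N isT; have := Pcell 1%N isT; have := Pcell 2%N isT.
rewrite addn0 addn1 addn2 => -> -> ->; rewrite -/k; ring.
Qed.

Lemma CL2_bound (T : R) (y : R * R -> R) : 0 <= T -> CL2 T y ->
  exists2 C : R, 0 <= C & forall t, 0 <= t <= T -> nrm mu I01 (fun x => y (x, t)) <= C.
Proof.
move=> T0 [yL2 yc]; pose phi t := nrm mu I01 (fun x => y (x, t)).
have inT t : `[0, T]%classic t <-> 0 <= t <= T by rewrite /= in_itv.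
have cphi : {within `[0, T], continuous phi}.
  apply/subspace_continuousP => t tT; apply/cvgrPdist_lt => e e0.
  have := yc t tT e e0; rewrite !near_withinE; apply: filterS => s h sT.
  have {}h := h sT.
  have ys := yL2 s sT; have yt := yL2 t tT.
  have sys := L2_sqint _ ys; have syt := L2_sqint _ yt.
  rewrite distL2_nrm// lte_fin in h; apply: le_lt_trans h.
  set D := nrm _ _ _.
  have h1 : phi s <= phi t + D by exact: nrm_tri_I _ _ sys syt.
  have h2 : phi t <= phi s + D by rewrite /D nrm_sym_I; exact: nrm_tri_I _ _ syt sys.
  have aux (u v w : R) : u <= v + w -> v <= u + w -> `|v - u| <= w.
    by move=> ? ?; rewrite ler_norml; apply/andP; split; lra.
  exact: (aux _ _ _ h1 h2).
have [c cT hc] := EVT_max T0 cphi.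
exists (phi c); first exact: nrm_ge0.
by move=> t tT; apply: hc; rewrite in_itv.
Qed.

End FluxIdentity.

Lemma Lfun2_sqint d (X : measurableType d) (R : realType) (m : {measure set X -> \bar R})
    (D : set X) (f : X -> R) : measurable D -> f \_ D \in Lfun m 2%:E -> sqint m D f.
Proof.
move=> mD hf; have hi := Lfun2_integrable_sqr hf.
move: hf; rewrite inE => /andP[]; rewrite inE/= => mf _.
split; first exact/(measurable_restrictT f mD).
have := @rintS _ _ _ m _ _ _ measurableT mD (@subsetT _ _) hi.
by apply: eq_rint => // x Dx; rewrite patchE mem_set.
Qed.

(** * The weak formulation tested with splines *)

Section WeakForm.
Context {R : realType}.
Notation mu := (@lebesgue_measure R).
Notation mu2 := (@lebesgue_measure R \x @lebesgue_measure R)%E.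
Notation I01 := (@I01 R).
Variables (a A : R -> R) (a0 L : R).
Hypothesis ca : coefficient a a0 L.
Hypothesis A0 : A 0 = 0.
Hypothesis dA : forall x : R, is_derive x (1 : R) A (a x).
Variables (T : R) (y0 : R -> R) (u : R * R -> R) (omega : set R) (y yx : R * R -> R).
Hypothesis T0 : 0 < T.
Hypothesis mom : measurable omega.
Hypothesis uinf : Linfty T u.
Hypothesis yH : L2H10 T y yx.
Hypothesis yC : CL2 T y.
Hypothesis y0L2 : L2 y0.
Hypothesis yini : L2zero (fun x => y (x, 0) - y0 x).
Hypothesis weak : forall eta, test_function T eta -> forall t, `[0, T]%classic t ->
      \int[mu]_(x in I01) (y (x, t) * eta (x, t))
      - \int[mu]_(x in I01) (y0 x * eta (x, 0))
      - \int[mu2]_(p in QT t) (y p * Dt eta p)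
      + \int[mu2]_(p in QT t) (a (y p) * yx p * Dx eta p)
      = \int[mu2]_(p in QT t) (u p * y p * \1_omega p.1 * eta p).

Lemma test_nodal (k : R) (j : nat) : j%:R + 3 <= k ->
  test_function T (fun p : R * R => nodal k j p.1) /\
  (forall p, Dx (fun p : R * R => nodal k j p.1) p = dnodal k j p.1) /\
  (forall p, Dt (fun p : R * R => nodal k j p.1) p = 0).
Proof.
move=> jk; pose eta := fun p : R * R => nodal k j p.1.
have hx p : derivable eta p (1, 0) /\ 'D_((1, 0) : R * R) eta p = dnodal k j p.1.
  have [d1 d2] := nodal_derive k j p.1.
  by split; [exact: d1|exact: d2].
have ht p : derivable eta p (0, 1) /\ 'D_((0, 1) : R * R) eta p = 0.
  (* A step in time does not move the first coordinate, so the difference quotient is that of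
     [nodal] in direction 0. *)
  have d1 : derivable (nodal k j) p.1 0 by exact: derivable0.
  have d2 : 'D_0 (nodal k j) p.1 = 0 by exact: derive0.
  by split; [exact: d1|exact: d2].
split; last by split=> p; [have [] := hx p|have [] := ht p].
split.
- by move=> p; split; [have [] := hx p|have [] := ht p].
- have -> : Dx eta = (fun p => dnodal k j p.1) by apply/funext => p; have [] := hx p.
  by move=> p; apply: (@continuous_comp _ _ _ fst (dnodal k j)); [exact: cvg_fst|exact: dnodal_continuous].
- have -> : Dt eta = (fun=> 0) by apply/funext => p; have [] := ht p.
  by move=> p; exact: cst_continuous.
- move=> t _; rewrite /eta /nodal /= mulr0 mulr1 sub0r; split.
    by rewrite bspline0l// oppr_le0.
  by rewrite bspline0r// lerBrDl.
Qed.

Lemma measurable_QT (t : R) : measurable (QT t : set (measurableTypeR R * measurableTypeR R)).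
Proof. by apply: measurableX; exact: measurable_itv. Qed.

Lemma QT_fin (t : R) : (mu2 (QT t) < +oo)%E.
Proof.
rewrite /QT product_measure1E; [|exact: measurable_itv|exact: measurable_itv].
by apply: lte_mul_pinfty => //; [by rewrite ge0_fin_numE// mu_I01_fin|exact: mu_itvoo_fin].
Qed.

Lemma y_sqint : sqint mu2 (QT T) y.
Proof. by have [h _ _] := yH; exact: (Lfun2_sqint _ _ _ mu2 (QT T) y (measurable_QT T) h). Qed.

Lemma yx_sqint : sqint mu2 (QT T) yx.
Proof. by have [_ h _] := yH; exact: (Lfun2_sqint _ _ _ mu2 (QT T) yx (measurable_QT T) h). Qed.

Lemma ay_sqint : sqint mu2 (QT T) (fun p => a (y p)).
Proof.
have [my y2] := y_sqint.
apply: (@sqint_le _ _ _ mu2 _ _ (fun p => a 0 + L * `|y p|) (measurable_QT T)).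
- apply: (measurableT_comp _ my); apply: continuous_measurable_fun.
  exact: (coef_continuous _ _ _ ca).
- apply: (@sqintD _ _ _ mu2 _ _ _ (measurable_QT T)).
    exact: (sqint_cst mu2 _ (measurable_QT T) (QT_fin T)).
  apply: (@sqintZ _ _ _ mu2 _ _ _ (measurable_QT T)).
  split; first exact: measurableT_comp.
  by apply: (@eq_rint _ _ _ mu2 _ _ _ (measurable_QT T) _ y2) => p _; rewrite real_normK ?num_real.
- by move=> p _; exact: (coef_abs _ _ _ ca).
Qed.

Lemma Ay_rint : rint mu2 (QT T) (fun p => A (y p)).
Proof.
have ys := y_sqint; have [my y2] := ys.
have yn : sqint mu2 (QT T) (fun p => `|y p|).
  split; first exact: measurableT_comp.
  by apply: (@eq_rint _ _ _ mu2 _ _ _ (measurable_QT T) _ y2) => p _; rewrite real_normK ?num_real.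
apply: (@rint_le _ _ _ mu2 _ _ (fun p => (a 0 + L * `|y p|) * `|y p|) (measurable_QT T)).
- apply: (measurableT_comp _ my); apply: continuous_measurable_fun.
  exact: (prim_continuous _ _ dA).
- apply: (@sqintM _ _ _ mu2 _ _ _ (measurable_QT T)) => //.
  apply: (@sqintD _ _ _ mu2 _ _ _ (measurable_QT T)).
    exact: (sqint_cst mu2 _ (measurable_QT T) (QT_fin T)).
  exact: (@sqintZ _ _ _ mu2 _ _ _ (measurable_QT T)).
- by move=> p _; exact: (prim_abs _ _ _ _ ca A0 dA).
Qed.

Lemma indic_fst_meas (D : set (R * R)) :
  measurable (D : set (measurableTypeR R * measurableTypeR R)) ->
  measurable_fun (D : set (measurableTypeR R * measurableTypeR R)) (fun p => \1_omega p.1 : R).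
Proof.
move=> mD.
have h : measurable_fun setT ((\1_omega : measurableTypeR R -> R) \o (fst : measurableTypeR R * measurableTypeR R -> _)).
  by apply: measurableT_comp; [exact: measurable_indic|exact: measurable_fst].
exact: measurable_funTS h.
Qed.

(** Truncating [u] at its essential bound and multiplying by the indicator gives a control bounded
    at every point and zero at every point off [omega], so no null sets have to be followed through
    the time sections. *)
Lemma control_representative : exists (U : R) (w : R * R -> R),
  [/\ 0 <= U, measurable_fun (QT T : set (measurableTypeR R * measurableTypeR R)) w,
      forall p, `|w p| <= U, forall p, ~ omega p.1 -> w p = 0 &
      {ae mu2, forall p, QT T p -> u p * \1_omega p.1 = w p}].
Proof.
have [mu_ [U U0 hU]] := Linfty_bound T u uinf.
pose w p := Num.max (- U) (Num.min U (u p)) * \1_omega p.1.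
exists U, w; split => //.
- apply: measurable_funM.
    by apply: measurable_maxr => //; exact: measurable_minr.
  exact: indic_fst_meas (measurable_QT T).
- move=> p; rewrite /w normrM -[leRHS]mulr1 ler_pM//.
    rewrite ler_norml le_max lexx/= ge_max ge_min lexx/= andbT; lra.
  by rewrite indicE; case: (_ \in _); rewrite ?normr1 ?normr0.
- by move=> p np; rewrite /w indicE memNset// mulr0.
- apply: ae_imp hU => p h /h; rewrite ler_norml /w => /andP[h1 h2].
  by rewrite min_r// max_r.
Qed.

Section TimeIdentity.
Variables (U : R) (w : R * R -> R).
Hypothesis mw : measurable_fun (QT T : set (measurableTypeR R * measurableTypeR R)) w.
Hypothesis wU : forall p, `|w p| <= U.
Hypothesis uw : {ae mu2, forall p, QT T p -> u p * \1_omega p.1 = w p}.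

Lemma QT_sub (t : R) : t <= T -> QT t `<=` QT T.
Proof.
move=> tT p [p1 p2]; split => //; move: p2; rewrite /= !in_itv/= => /andP[-> h].
exact: lt_le_trans h tT.
Qed.

Lemma rint_QT_sub (G : R * R -> R) (t : R) : t <= T -> rint mu2 (QT T) G -> rint mu2 (QT t) G.
Proof.
move=> tT; exact: (@rintS _ _ _ mu2 _ _ _ (measurable_QT T) (measurable_QT t) (QT_sub _ tT)).
Qed.

Lemma fst_meas (g : R -> R) (D : set (R * R)) : continuous g ->
  measurable (D : set (measurableTypeR R * measurableTypeR R)) ->
  measurable_fun (D : set (measurableTypeR R * measurableTypeR R)) (fun p => g p.1).
Proof.
move=> cg mD.
have h : measurable_fun setT ((g : measurableTypeR R -> R) \o (fst : measurableTypeR R * measurableTypeR R -> _)).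
  by apply: measurableT_comp; [exact: continuous_measurable_fun|exact: measurable_fst].
exact: measurable_funTS h.
Qed.

Lemma dnodal_bound (k : R) (j : nat) (x : R) : 0 <= (j%:R : R) -> j%:R + 3 <= k -> I01 x -> `|dnodal k j x| <= 8 * k ^+ 2.
Proof.
move=> j0 jk /I01P /andP[x0 x1]; have k0 : 0 <= k by lra.
have kx0 : 0 <= k * x by rewrite mulr_ge0.
have kx1 : k * x <= k by rewrite -[leRHS]mulr1 ler_wpM2l.
rewrite /dnodal normrM (ger0_norm k0) expr2 mulrCA ler_wpM2l// /dbspline.
have b c : 0 <= c -> c <= k -> 0 <= pospart (k * x - c) /\ pospart (k * x - c) <= k.
  by move=> ? ?; have [[? ->]|[? ->]] := pospartP (k * x - c); lra.
have -> : k * x - j%:R - 1 = k * x - (j%:R + 1) by ring.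
have -> : k * x - j%:R - 2 = k * x - (j%:R + 2) by ring.
have -> : k * x - j%:R - 3 = k * x - (j%:R + 3) by ring.
have [] := b j%:R; [lra..|]; have [] := b (j%:R + 1); [lra..|].
have [] := b (j%:R + 2); [lra..|]; have [] := b (j%:R + 3); [lra..|].
by move=> *; rewrite ler_norml; apply/andP; split; lra.
Qed.

Definition source (i n : nat) (s : R) :=
  \int[mu]_(x in I01) (w (x, s) * y (x, s) * nodal n%:R i.-1 x).
Definition cellt (n i : nat) (s : R) := cell_avg A (fun x => y (x, s)) n i.
Definition nodet (n i : nat) (s : R) := node_avg (fun x => y (x, s)) n i.

Lemma mJ (t : R) : measurable (`]0, t[ : set (measurableTypeR R)).
Proof. exact: measurable_itv. Qed.

Lemma source_G_rint (n i : nat) :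
  rint mu2 (QT T) (fun p => w p * y p * nodal n%:R i.-1 p.1).
Proof.
apply: (@eq_rint _ _ _ mu2 _ (fun p => nodal n%:R i.-1 p.1 * (w p * y p)) _ (measurable_QT T)).
  by move=> p _; rewrite mulrC.
apply: (@rintM_bdd _ _ _ mu2 _ _ _ 1 (measurable_QT T)).
- by apply: fst_meas; [exact: nodal_continuous|exact: measurable_QT].
- by move=> p _; rewrite ger0_norm ?nodal_ge0// nodal_le1.
- apply: (@rintM_bdd _ _ _ mu2 _ _ _ U (measurable_QT T)) => //.
  exact: (sqint_rint mu2 (measurable_QT T) (QT_fin T) y_sqint).
Qed.

Lemma source_rint (n i : nat) : rint mu `]0, T[ (source i n).
Proof. by have [_ h _] := Rint_prod mu mu I01 `]0, T[ measurable_I01 (mJ T) _ (source_G_rint n i). Qed.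

Lemma cellt_rint (n i : nat) : (i < n)%N -> rint mu `]0, T[ (cellt n i).
Proof.
move=> ni; pose E : set R := `]i%:R / n%:R, i.+1%:R / n%:R[.
have n0 : 0 < n%:R :> R by rewrite ltr0n (leq_ltn_trans _ ni).
have ME : measurable (E : set (measurableTypeR R)) by exact: measurable_itv.
have EI : E `<=` I01.
  apply: sub_I01; first by rewrite divr_ge0 ?ler0n.
  by rewrite ler_pdivrMr// mul1r ler_nat.
have sub : rint mu2 (E `*` `]0, T[) (fun p => A (y p)).
  apply: (@rintS _ _ _ mu2 _ _ _ (measurable_QT T) _ _ Ay_rint).
    by apply: measurableX => //; exact: mJ.
  by move=> p [p1 p2]; split => //; exact: EI.
have [_ h _] := Rint_prod mu mu E `]0, T[ ME (mJ T) _ sub.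
exact: (@rintZ _ _ _ mu _ _ n%:R (mJ T) h).
Qed.

Lemma ae_H10 (t : R) : t <= T -> {ae mu, forall s, `]0, t[%classic s ->
  H10 (fun x => y (x, s)) (fun x => yx (x, s))}.
Proof.
move=> tT; have [_ _ h] := yH; apply: ae_imp h => s + sI; apply.
move: sI; rewrite /= !in_itv/= => /andP[-> h]; exact: lt_le_trans h tT.
Qed.

Lemma rint_J_sub (G : R -> R) (t : R) : t <= T -> rint mu `]0, T[ G -> rint mu `]0, t[ G.
Proof.
move=> tT; apply: (@rintS _ _ _ mu _ _ _ (mJ T) (mJ t)).
by move=> s; rewrite /= !in_itv/= => /andP[-> h]; exact: lt_le_trans h tT.
Qed.

Lemma flux_time (n j : nat) (t : R) : (j + 3 <= n)%N -> t <= T ->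
  \int[mu2]_(p in QT t) (a (y p) * yx p * dnodal n%:R j p.1) =
  - n%:R * \int[mu]_(s in `]0, t[) (cellt n j s - 2 * cellt n j.+1 s + cellt n j.+2 s).
Proof.
move=> jn tT; have jn' : j%:R + 3 <= n%:R :> R by rewrite -natrD ler_nat.
have iG : rint mu2 (QT T) (fun p => a (y p) * yx p * dnodal n%:R j p.1).
  apply: (@eq_rint _ _ _ mu2 _ (fun p => dnodal n%:R j p.1 * (a (y p) * yx p)) _ (measurable_QT T)).
    by move=> p _; rewrite mulrC.
  apply: (@rintM_bdd _ _ _ mu2 _ _ _ (8 * n%:R ^+ 2) (measurable_QT T)).
  - by apply: fst_meas; [exact: dnodal_continuous|exact: measurable_QT].
  - by move=> p [p1 _]; apply: dnodal_bound.
  - exact: (@sqintM _ _ _ mu2 _ _ _ (measurable_QT T) ay_sqint yx_sqint).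
have [_ i2 ->] := Rint_prod mu mu I01 `]0, t[ measurable_I01 (mJ t) _ (rint_QT_sub _ _ tT iG).
have c l : (l < 3)%N -> rint mu `]0, t[ (cellt n (j + l)).
  by move=> l3; apply: rint_J_sub => //; apply: cellt_rint; rewrite (leq_trans _ jn)// ltn_add2l.
have := c 0%N isT; have := c 1%N isT; have := c 2%N isT; rewrite addn0 addn1 addn2 => c2 c1 c0.
have c1' := @rintZ _ _ _ mu _ _ 2 (mJ t) c1.
have i3 := @rintD _ _ _ mu _ _ _ (mJ t) (@rintB _ _ _ mu _ _ _ (mJ t) c0 c1') c2.
rewrite -(@RintegralZl _ _ _ mu _ _ _ (mJ t) i3).
apply: (@ae_eq_Rint _ _ _ mu _ _ _ (mJ t)).
- exact: (rint_meas mu i2).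
- exact: (rint_meas mu (@rintZ _ _ _ mu _ _ (- n%:R) (mJ t) i3)).
- apply: ae_imp (ae_H10 _ tT) => s h /h Hs.
  exact: (flux_identity _ _ _ _ ca A0 dA _ _ _ _ Hs jn).
Qed.

(** The weak formulation tested with the spline of node [i], which does not depend on time. The
    identity is exact, but it is not closed: it involves the cell average of A(y) instead of A of
    the node average. This gap is the consistency error of the scheme. *)
Lemma time_identity (n i : nat) (t : R) : (0 < i)%N -> (i.+1 < n)%N -> 0 <= t <= T ->
  nodet n i t - node_avg y0 n i = \int[mu]_(s in `]0, t[)
    (n%:R ^+ 2 * (cellt n i.-1 s - 2 * cellt n i s + cellt n i.+1 s) + n%:R * source i n s).
Proof.
move=> i0 im /andP[t0 tT]; pose j := i.-1.
have ij : i = j.+1 by rewrite /j prednK.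
have jn : (j + 3 <= n)%N by rewrite addn3 -ij.
have jn' : j%:R + 3 <= n%:R :> R by rewrite -natrD ler_nat.
have [tf [DxE DtE]] := test_nodal n%:R j jn'.
have tI : `[0, T]%classic t by rewrite /= in_itv/= t0.
have := weak _ tf t tI.
rewrite (eq_Rint_in mu2 (QT t) (fun p => y p * Dt _ p) (fun=> 0)); last by move=> p _; rewrite DtE mulr0.
rewrite (@Rintegral_cst _ _ _ mu2 _ (measurable_QT t)) mul0r subr0.
rewrite (eq_Rint_in mu2 (QT t) (fun p => a (y p) * yx p * Dx _ p)
  (fun p => a (y p) * yx p * dnodal n%:R j p.1)); last by move=> p _; rewrite DxE.
rewrite flux_time//.
have mu2u : \int[mu2]_(p in QT t) (u p * y p * \1_omega p.1 * nodal n%:R j p.1) =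
    \int[mu2]_(p in QT t) (w p * y p * nodal n%:R j p.1).
  have iw := rint_QT_sub _ _ tT (source_G_rint n i).
  apply: (@ae_eq_Rint _ _ _ mu2 _ _ _ (measurable_QT t)).
  - have [mu_ _] := Linfty_bound T u uinf.
    have my := sqint_meas mu2 y_sqint.
    have mQ := measurable_QT t.
    apply: measurable_funM; last by apply: fst_meas => //; exact: nodal_continuous.
    apply: measurable_funM.
      apply: measurable_funM; first exact: measurable_funS (measurable_QT T) (QT_sub _ tT) mu_.
      exact: measurable_funS (measurable_QT T) (QT_sub _ tT) my.
    exact: indic_fst_meas.
  - exact: (rint_meas mu2 iw).
  - apply: ae_imp uw => p h Qp; rewrite -h; last exact: QT_sub Qp.
    by ring.
rewrite mu2u.
have [_ i2 ->] := Rint_prod mu mu I01 `]0, t[ measurable_I01 (mJ t) _ (rint_QT_sub _ _ tT (source_G_rint n i)).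
rewrite -/(source i n).
have c l : (l < n)%N -> rint mu `]0, t[ (cellt n l).
  by move=> ln; apply: rint_J_sub => //; exact: cellt_rint.
have c0 := c j (leq_ltn_trans (leq_pred i) (ltnW im)).
have c1 := c i (ltnW im); have c2 := c i.+1 im.
have cs := rint_J_sub _ _ tT (source_rint n i).
have c1' := @rintZ _ _ _ mu _ _ 2 (mJ t) c1.
have i3 := @rintD _ _ _ mu _ _ _ (mJ t) (@rintB _ _ _ mu _ _ _ (mJ t) c0 c1') c2.
rewrite (@RintegralD _ _ _ mu _ _ _ (mJ t) (@rintZ _ _ _ mu _ _ _ (mJ t) i3) (@rintZ _ _ _ mu _ _ _ (mJ t) cs)).
rewrite (@RintegralZl _ _ _ mu _ _ _ (mJ t) i3) (@RintegralZl _ _ _ mu _ _ _ (mJ t) cs).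
rewrite /nodet /node_avg -/j /= -ij.
set I1 := \int[mu]_(s in `]0, t[) (_ + _); set I2 := \int[mu]_(s in `]0, t[) _.
rewrite /source -/j -/I2; set X1 := Rintegral _ _ _; set X2 := Rintegral _ _ _ => E.
have -> : I2 = X1 - X2 - n%:R * I1 by lra.
ring.
Qed.

End TimeIdentity.

End WeakForm.

(** * Discrete H^-1 stability *)

Section DiscreteDual.
Context {R : realType}.
Implicit Types f g d : nat -> R.

Definition dif f (i : nat) : R := f i.+1 - f i.
(** At index 0 the predecessor is 0 itself; in sums this value meets only factors vanishing at 0. *)
Definition lap f (i : nat) : R := f i.+1 - 2 * f i + f i.-1.

Lemma sum_cst (c : R) (N : nat) : \sum_(i < N) c = N%:R * c.
Proof. by rewrite sumr_const card_ord mulr_natl. Qed.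

Lemma summation_by_parts f g (N : nat) : g 0%N = 0 -> g N = 0 ->
  \sum_(i < N) lap f i * g i = - \sum_(i < N) dif f i * dif g i.
Proof.
move=> g0; have gen M : \sum_(i < M.+1) lap f i * g i =
    - \sum_(i < M.+1) dif f i * dif g i + dif f M * g M.+1.
  elim: M => [|M IH]; first by rewrite !big_ord1 /dif g0; ring.
  by rewrite big_ord_recr /= IH [in RHS]big_ord_recr /= /lap /dif /=; ring.
case: N => [|N] gN; first by rewrite !big_ord0 oppr0.
by rewrite gen gN mulr0 addr0.
Qed.

Lemma lap_sym f g (N : nat) : f 0%N = 0 -> f N = 0 -> g 0%N = 0 -> g N = 0 ->
  \sum_(i < N) lap f i * g i = \sum_(i < N) f i * lap g i.
Proof.
move=> f0 fN g0 gN; rewrite summation_by_parts//.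
transitivity (\sum_(i < N) lap g i * f i); last by apply: eq_bigr => i _; rewrite mulrC.
by rewrite summation_by_parts//; congr (- _); apply: eq_bigr => i _; rewrite mulrC.
Qed.

Definition psum d (i : nat) : R := \sum_(j < i.+1) d j.
(** The solution of the discrete Dirichlet problem [- lap g i = d i] for [0 < i]: two summations,
    and a linear term that restores the value 0 at [N]. *)
Definition green d (N i : nat) : R :=
  - \sum_(l < i) psum d l + i%:R / N%:R * \sum_(l < N) psum d l.

Lemma green0 d N : green d N 0 = 0.
Proof. by rewrite /green big_ord0 oppr0 add0r mul0r mul0r. Qed.

Lemma greenN d N : (0 < N)%N -> green d N N = 0.
Proof. by move=> N0; rewrite /green divff ?pnatr_eq0 -?lt0n// mul1r addNr. Qed.

Lemma lap_green d N i : (0 < i)%N -> lap (green d N) i = - d i.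
Proof.
case: i => // i _; have p1 : psum d i.+1 = psum d i + d i.+1 by rewrite /psum big_ord_recr.
by rewrite /lap /green /= !big_ord_recr /= p1 -!natr1; ring.
Qed.

Lemma green_lin d d' N i : green (fun j => d j + d' j) N i = green d N i + green d' N i.
Proof.
have p l : psum (fun j => d j + d' j) l = psum d l + psum d' l by rewrite /psum big_split.
have s m : \sum_(l < m) psum (fun j => d j + d' j) l = \sum_(l < m) psum d l + \sum_(l < m) psum d' l.
  by rewrite -big_split; apply: eq_bigr => l _; exact: p.
by rewrite /green !s; ring.
Qed.

(** The squared discrete H^-1 norm of [d], without its mesh factor; division by [n ^+ 3] makes it
    independent of the mesh. *)
Definition energy d N : R := \sum_(i < N) dif (green d N) i ^+ 2.

Lemma energy_ge0 d N : 0 <= energy d N.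
Proof. by apply: sumr_ge0 => i _; exact: sqr_ge0. Qed.

Lemma dual_pairing d g N : (0 < N)%N -> d 0%N = 0 -> g 0%N = 0 -> g N = 0 ->
  \sum_(i < N) d i * g i = \sum_(i < N) dif (green d N) i * dif g i.
Proof.
move=> N0 d0 g0 gN; have := summation_by_parts (green d N) g N g0 gN.
move=> /(congr1 -%R); rewrite opprK => <-; rewrite -sumrN; apply: eq_bigr => -[[|i] iN] _ /=.
  by rewrite g0 !mulr0 oppr0.
by rewrite lap_green// mulNr opprK.
Qed.

Lemma sum_cauchy_schwarz (f g : nat -> R) N :
  (\sum_(i < N) f i * g i) ^+ 2 <= (\sum_(i < N) f i ^+ 2) * (\sum_(i < N) g i ^+ 2).
Proof.
have disc (X Y Z : R) : 0 <= X -> 0 <= Z -> (forall t, 0 <= X + 2 * t * Y + t ^+ 2 * Z) -> Y ^+ 2 <= X * Z.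
  move=> X0 Z0 h; have [Z00|Zn0] := eqVneq Z 0.
    have [->|Yn0] := eqVneq Y 0; first by rewrite Z00 expr0n mulr0.
    have := h (- (X + 1) / (2 * Y)); rewrite Z00 mulr0 addr0.
    have -> : 2 * (- (X + 1) / (2 * Y)) * Y = - (X + 1) by field.
    by rewrite opprD addrA subrr add0r oppr_ge0 leNgt ltr01.
  have Zp : 0 < Z by rewrite lt_def Zn0.
  have := h (- Y / Z); have -> : X + 2 * (- Y / Z) * Y + (- Y / Z) ^+ 2 * Z = X - Y ^+ 2 / Z by field.
  by rewrite subr_ge0 ler_pdivrMr.
apply: disc; [by apply: sumr_ge0 => i _; exact: sqr_ge0|by apply: sumr_ge0 => i _; exact: sqr_ge0|].
move=> t; have -> : \sum_(i < N) f i ^+ 2 + 2 * t * \sum_(i < N) f i * g i + t ^+ 2 * \sum_(i < N) g i ^+ 2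
   = \sum_(i < N) (f i + t * g i) ^+ 2.
  by rewrite !mulr_sumr -!big_split /=; apply: eq_bigr => i _; ring.
by apply: sumr_ge0 => i _; exact: sqr_ge0.
Qed.

Lemma dif_telescope f M : \sum_(i < M) dif f i = f M - f 0%N.
Proof.
elim: M => [|M IH]; first by rewrite big_ord0 subrr.
by rewrite big_ord_recr /= IH /dif; ring.
Qed.

Lemma poincare g N : g 0%N = 0 ->
  \sum_(i < N) g i ^+ 2 <= N%:R ^+ 2 * \sum_(i < N) dif g i ^+ 2.
Proof.
move=> g0; have b (i : 'I_N) : g i ^+ 2 <= N%:R * \sum_(j < N) dif g j ^+ 2.
  have -> : g i = \sum_(j < i) 1 * dif g j.
    by under eq_bigr do rewrite mul1r; rewrite dif_telescope g0 subr0.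
  apply: (le_trans (sum_cauchy_schwarz (fun=> 1) (dif g) i)).
  apply: ler_pM; [by apply: sumr_ge0 => j _; exact: sqr_ge0|by apply: sumr_ge0 => j _; exact: sqr_ge0| |].
    by under eq_bigr do rewrite expr1n; rewrite sumr_const card_ord ler_nat ltnW.
  rewrite (big_ord_widen N (fun j => dif g j ^+ 2))//; last exact: ltnW.
  by rewrite [leRHS](bigID (fun j : 'I_N => (j < i)%N))/= lerDl; apply: sumr_ge0 => j _; exact: sqr_ge0.
apply: (le_trans (ler_sum _ (fun i _ => b i))).
by rewrite sum_cst mulrA expr2.
Qed.

Lemma energy_le d N : (0 < N)%N -> d 0%N = 0 -> energy d N <= N%:R ^+ 2 * \sum_(i < N) d i ^+ 2.
Proof.
move=> N0 d0; have g0 := green0 d N; have gN := greenN d N N0.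
have E : energy d N = \sum_(i < N) d i * green d N i.
  by rewrite dual_pairing// /energy; apply: eq_bigr => i _; rewrite expr2.
(* Cauchy-Schwarz and Poincare bound the square of the energy by the energy times the right-hand
   side, so one factor has to be cancelled. *)
have [e0|en0] := eqVneq (energy d N) 0.
  by rewrite e0 mulr_ge0 ?sqr_ge0//; apply: sumr_ge0 => i _; exact: sqr_ge0.
have ep : 0 < energy d N by rewrite lt_def en0 energy_ge0.
have h1 := sum_cauchy_schwarz d (green d N) N.
have h2 := poincare (green d N) N g0.
rewrite -(ler_pM2l ep) -expr2 {1}E; apply: (le_trans h1).
rewrite -/(energy d N) in h2.
apply: (@le_trans _ _ ((\sum_(i < N) d i ^+ 2) * (N%:R ^+ 2 * energy d N))).
  by rewrite ler_wpM2l//; apply: sumr_ge0 => i _; exact: sqr_ge0.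
by rewrite le_eqVlt; apply/orP; left; apply/eqP; ring.
Qed.

(** Duality: an H^-1 bound controls every pairing with a test of bounded slope. *)
Lemma dual_bound d phi N (c : R) : (0 < N)%N -> d 0%N = 0 -> phi 0%N = 0 -> phi N = 0 ->
  0 <= c -> (forall i, (i < N)%N -> `|dif phi i| <= c) ->
  (\sum_(i < N) phi i * d i) ^+ 2 <= energy d N * (N%:R * c ^+ 2).
Proof.
move=> N0 d0 p0 pN c0 hc.
have -> : \sum_(i < N) phi i * d i = \sum_(i < N) dif (green d N) i * dif phi i.
  by rewrite -dual_pairing//; apply: eq_bigr => i _; rewrite mulrC.
apply: (le_trans (sum_cauchy_schwarz _ _ _)); rewrite -/(energy d N) ler_wpM2l ?energy_ge0//.
rewrite -sum_cst; apply: ler_sum => i _.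
by rewrite -(real_normK (num_real (dif phi i))) ler_sqr ?nnegrE// hc.
Qed.

(** The increment of the defect is paired with the Green function of the defect. Monotonicity turns
    the flux difference [w] into a multiple of the sum of [D i ^+ 2], which absorbs the flux error
    and the reaction term by Young's inequality; the rest of the source is a multiple of the energy,
    left to Gronwall. *)
Lemma energy_step (N : nat) (D D' w e : nat -> R) (s : nat -> R) (tau n : R) (a0 U E dl : R) :
  (0 < N)%N -> N%:R <= n -> 0 < n -> 0 < a0 -> 0 <= tau -> 0 <= U -> 0 <= E ->
  D 0%N = 0 -> D N = 0 -> D' 0%N = 0 -> D' N = 0 -> w 0%N = 0 -> w N = 0 ->
  (forall i, (0 < i)%N -> (i < N)%N ->
     D' i - D i = tau * n ^+ 2 * lap (fun j => w j + e j) i + tau * s i) ->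
  (forall i, (0 < i)%N -> (i < N)%N -> a0 * D i ^+ 2 <= w i * D i) ->
  (forall i, (i <= N)%N -> `|e i| <= E) ->
  (forall i, (0 < i)%N -> (i < N)%N -> `|s i| <= U * `|D i| + E) ->
  (forall i, (0 < i)%N -> (i < N)%N -> `|D' i - D i| <= dl) ->
  energy D' N / n ^+ 3 <= (1 + (2 * U ^+ 2 / a0 + 1) * tau) * (energy D N / n ^+ 3)
     + (8 / a0 + 1) * (tau * E ^+ 2) + dl ^+ 2.
Proof.
move=> N0 Nn n0 a0p tau0 U0 E0 D0 DN D'0 D'N w0 wN step mono eE sE dD.
pose g := green D N; pose dd i := D' i - D i; pose gam := green dd N.
have g0 : g 0%N = 0 := green0 _ _; have gN : g N = 0 := greenN _ _ N0.
have dd0 : dd 0%N = 0 by rewrite /dd D0 D'0 subr0.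
have D'E : D' =1 (fun j => D j + dd j) by move=> j; rewrite /dd addrC subrK.
have gE i : green D' N i = g i + gam i.
  rewrite -green_lin /green; congr (- _ + _ * _); apply: eq_bigr => l _; apply: eq_bigr => j _; exact: D'E.
have eE' : energy D' N = energy D N + 2 * \sum_(i < N) dd i * g i + energy dd N.
  rewrite (dual_pairing dd g)// /energy -/g -/gam mulr_sumr -!big_split /=.
  by apply: eq_bigr => i _; rewrite /dif !gE; ring.
(* Subtracting the linear interpolant of the two ghost values of e changes no second difference
   and makes the error vanish at both ends. *)
pose et i := e i - e 0%N - i%:R / N%:R * (e N - e 0%N).
have Nn0 : N%:R != 0 :> R by rewrite pnatr_eq0 -lt0n.
have et0 : et 0%N = 0 by rewrite /et mul0r mul0r subr0 subrr.
have etN : et N = 0 by rewrite /et divff// mul1r subrr.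
have etE i : (i < N)%N -> `|et i| <= 2 * E.
  move=> iN; have -> : et i = e i - ((1 - i%:R / N%:R) * e 0%N + i%:R / N%:R * e N) by rewrite /et; ring.
  have t0 : 0 <= i%:R / N%:R :> R by rewrite divr_ge0.
  have t1 : i%:R / N%:R <= 1 :> R by rewrite ler_pdivrMr ?ltr0n// mul1r ler_nat ltnW.
  have := eE i (ltnW iN); have := eE 0%N (leq0n _); have := eE N (leqnn _).
  rewrite !ler_norml => /andP[? ?] /andP[? ?] /andP[? ?].
  move: (i%:R / N%:R) t0 t1 => t t0 t1; apply/andP; split; nra.
have lapet i : (0 < i)%N -> lap (fun j => w j + e j) i = lap (fun j => w j + et j) i.
  by case: i => // i _; rewrite /lap /et /= -!natr1; field.
pose X := \sum_(i < N) D i ^+ 2; pose G2 := \sum_(i < N) g i ^+ 2.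
have X0 : 0 <= X by apply: sumr_ge0 => i _; exact: sqr_ge0.
have key : \sum_(i < N) dd i * g i =
    - (tau * n ^+ 2 * \sum_(i < N) (w i + et i) * D i) + tau * \sum_(i < N) s i * g i.
  have -> : \sum_(i < N) dd i * g i =
     tau * n ^+ 2 * (\sum_(i < N) lap (fun j => w j + et j) i * g i) + tau * \sum_(i < N) s i * g i.
    rewrite !mulr_sumr -big_split /=; apply: eq_bigr => -[[|i] iN] _ /=; first by rewrite g0 !mulr0 addr0.
    by rewrite /dd step// lapet//; ring.
  rewrite lap_sym ?w0 ?wN ?et0 ?etN ?addr0// -mulrN -sumrN; congr (_ * _ + _).
  apply: eq_bigr => -[[|i] iN] _ /=; first by rewrite w0 et0 !addr0 !mul0r oppr0.
  by rewrite lap_green// mulrN.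
(* Young's inequality spends a quarter of the coercivity [a0] on the flux error; the source will
   spend another quarter. *)
have b1 : - \sum_(i < N) (w i + et i) * D i <= - (3 / 4 * a0) * X + N%:R * (4 / a0 * E ^+ 2).
  rewrite -sumrN mulr_sumr -(sum_cst (4 / a0 * E ^+ 2) N) -big_split /=.
  apply: ler_sum => -[[|i] iN] _ /=.
    by rewrite w0 et0 D0 expr0n /= !mulr0 oppr0 add0r mulr_ge0 ?sqr_ge0// divr_ge0// ltW.
  have m1 := mono i.+1 (ltn0Sn i) iN; have m2 := etE i.+1 iN.
  have m3 : et i.+1 ^+ 2 <= 4 * E ^+ 2.
    have -> : 4 * E ^+ 2 = (2 * E) ^+ 2 by ring.
    by rewrite -(real_normK (num_real (et i.+1))) ler_sqr ?nnegrE ?mulr_ge0.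
  have m4 : - (et i.+1 * D i.+1) <= a0 / 4 * D i.+1 ^+ 2 + et i.+1 ^+ 2 / a0.
    rewrite -subr_ge0.
    have -> : a0 / 4 * D i.+1 ^+ 2 + et i.+1 ^+ 2 / a0 - - (et i.+1 * D i.+1) =
      a0 * (D i.+1 / 2 + et i.+1 / a0) ^+ 2 by field; exact: lt0r_neq0.
    by rewrite mulr_ge0 ?sqr_ge0// ltW.
  have m5 : et i.+1 ^+ 2 / a0 <= 4 / a0 * E ^+ 2.
    by rewrite [leRHS]mulrAC ler_wpM2r ?invr_ge0// ltW.
  by move: m1 m4 m5; lra.
(* The weights [n ^+ 2] match the factor of the Laplacian, and [G2 / n ^+ 2] is at most the energy
   by the Poincare inequality. *)
have b2 : \sum_(i < N) s i * g i <=
    n ^+ 2 * (a0 / 4 * X) + (U ^+ 2 / a0 + 1 / 2) / n ^+ 2 * G2 + n ^+ 2 * (N%:R * (E ^+ 2 / 2)).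
  rewrite !mulr_sumr -(sum_cst (E ^+ 2 / 2) N) mulr_sumr -!big_split /=.
  apply: ler_sum => -[[|i] iN] _ /=.
    by rewrite g0 D0 expr0n /= !mulr0 !add0r mulr_ge0 ?sqr_ge0// divr_ge0// sqr_ge0.
  have m1 := sE i.+1 (ltn0Sn i) iN.
  apply: (le_trans (ler_norm _)); rewrite normrM.
  apply: (le_trans (ler_wpM2r (normr_ge0 _) m1)).
  rewrite -(real_normK (num_real (D i.+1))) -(real_normK (num_real (g i.+1))).
  move: `|D i.+1| `|g i.+1| => x z.
  rewrite -subr_ge0.
  have -> : n ^+ 2 * (a0 / 4 * x ^+ 2) + (U ^+ 2 / a0 + 1 / 2) / n ^+ 2 * z ^+ 2 + n ^+ 2 * (E ^+ 2 / 2)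
     - (U * x + E) * z = a0 * (n * x / 2 - U * z / (a0 * n)) ^+ 2 + (n * E - z / n) ^+ 2 / 2.
    by field; rewrite !gt_eqF.
  apply: addr_ge0; last by rewrite divr_ge0// sqr_ge0.
  by apply: mulr_ge0; [exact: ltW|exact: sqr_ge0].
have b3 : G2 <= n ^+ 2 * energy D N.
  apply: (le_trans (poincare g N g0)); rewrite -/(energy D N) ler_wpM2r ?energy_ge0//.
  by rewrite ler_sqr ?nnegrE ?ler0n// ltW.
(* The price of an explicit step: the energy of the increment itself. In the application its sum
   over all steps is of the order of the time step. *)
have b4 : energy dd N <= n ^+ 3 * dl ^+ 2.
  apply: (le_trans (energy_le dd N N0 dd0)).
  have h : \sum_(i < N) dd i ^+ 2 <= n * dl ^+ 2.
    apply: (@le_trans _ _ (N%:R * dl ^+ 2)); last by rewrite ler_wpM2r ?sqr_ge0.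
    rewrite -(sum_cst (dl ^+ 2) N); apply: ler_sum => -[[|i] iN] _ /=.
      by rewrite dd0 expr0n sqr_ge0.
    have := dD i.+1 (ltn0Sn i) iN => h; rewrite -(real_normK (num_real (dd i.+1))) ler_sqr ?nnegrE//.
    by rewrite (le_trans _ h).
  apply: (@le_trans _ _ (n ^+ 2 * (n * dl ^+ 2))); last by rewrite le_eqVlt; apply/orP; left; apply/eqP; ring.
  apply: ler_pM; [exact: sqr_ge0|by apply: sumr_ge0 => i _; exact: sqr_ge0| |exact: h].
  by rewrite ler_sqr ?nnegrE ?ler0n// ltW.
have n3p : 0 < n ^+ 3 by rewrite exprn_gt0.
rewrite ler_pdivrMr// eE' key.
have -> : ((1 + (2 * U ^+ 2 / a0 + 1) * tau) * (energy D N / n ^+ 3) + (8 / a0 + 1) * (tau * E ^+ 2) + dl ^+ 2) * n ^+ 3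
  = energy D N + 2 * tau * (U ^+ 2 / a0 + 1 / 2) * energy D N + 2 * tau * (n ^+ 3 * ((4 / a0 + 1 / 2) * E ^+ 2)) + n ^+ 3 * dl ^+ 2.
  by field; rewrite !gt_eqF.
have c0 : 0 <= U ^+ 2 / a0 + 1 / 2 by rewrite addr_ge0 ?divr_ge0 ?sqr_ge0// ltW.
have b3' : (U ^+ 2 / a0 + 1 / 2) / n ^+ 2 * G2 <= (U ^+ 2 / a0 + 1 / 2) * energy D N.
  rewrite -mulrA ler_wpM2l// ler_pdivrMl ?exprn_gt0//.
have b5 : n ^+ 2 * (N%:R * (4 / a0 * E ^+ 2)) + n ^+ 2 * (N%:R * (E ^+ 2 / 2)) <= n ^+ 3 * ((4 / a0 + 1 / 2) * E ^+ 2).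
  have -> : n ^+ 2 * (N%:R * (4 / a0 * E ^+ 2)) + n ^+ 2 * (N%:R * (E ^+ 2 / 2)) = N%:R * (n ^+ 2 * ((4 / a0 + 1 / 2) * E ^+ 2)) by ring.
  have -> : n ^+ 3 * ((4 / a0 + 1 / 2) * E ^+ 2) = n * (n ^+ 2 * ((4 / a0 + 1 / 2) * E ^+ 2)) by ring.
  have q0 : 0 <= 4 / a0 + 1 / 2 by rewrite addr_ge0// divr_ge0// ltW.
  apply: ler_wpM2r => //; apply: mulr_ge0; first exact: sqr_ge0.
  by apply: mulr_ge0 => //; exact: sqr_ge0.
have a0X : 0 <= a0 * (n ^+ 2 * X).
  by apply: mulr_ge0; [exact: ltW|apply: mulr_ge0 => //; exact: sqr_ge0].
have tot : - (n ^+ 2 * \sum_(i < N) (w i + et i) * D i) + \sum_(i < N) s i * g i <=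
   (U ^+ 2 / a0 + 1 / 2) * energy D N + n ^+ 3 * ((4 / a0 + 1 / 2) * E ^+ 2).
  have := ler_wpM2l (sqr_ge0 n) b1; rewrite mulrN; move: b2 b3' b5 a0X; lra.
have := ler_wpM2l tau0 tot; move: b4; lra.
Qed.

Lemma discrete_gronwall (q p : nat -> R) (c tau : R) (K : nat) : 0 <= c -> 0 <= tau ->
  (forall k, (k < K)%N -> 0 <= p k) -> (forall k, 0 <= q k) ->
  (forall k, (k < K)%N -> q k.+1 <= (1 + c * tau) * q k + p k) ->
  q K <= expR (c * (K%:R * tau)) * (q 0%N + \sum_(k < K) p k).
Proof.
move=> c0 t0; elim: K => [|K IH] hp hq step.
  by rewrite mul0r mulr0 expR0 mul1r big_ord0 addr0.
have ih := IH (fun k kK => hp k (ltnW kK)) hq (fun k kK => step k (ltnW kK)).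
have ct : 0 <= c * tau by rewrite mulr_ge0.
apply: (le_trans (step K (ltnSn K))).
have e1 : 1 + c * tau <= expR (c * tau) by exact: expR_ge1Dx.
have eE : expR (c * (K.+1%:R * tau)) = expR (c * tau) * expR (c * (K%:R * tau)).
  by rewrite -expRD; congr expR; rewrite -natr1; ring.
have e2 : 1 <= expR (c * (K.+1%:R * tau)).
  by rewrite -expR0 ler_expR mulr_ge0// mulr_ge0.
rewrite big_ord_recr /= addrA mulrDr; apply: lerD.
  rewrite eE -mulrA; apply: ler_pM => //; first by rewrite addr_ge0.
by rewrite -[leLHS]mul1r ler_wpM2r// hp.
Qed.

End DiscreteDual.

(** * The flux through an uncontrolled zone *)

Section DiscreteSums.
Context {R : realType}.
Implicit Types f g : nat -> R.

Lemma sum_shift f (N : nat) : f 0%N = 0 -> f N = 0 ->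
  \sum_(i < N) f i = \sum_(i < N) f i.+1.
Proof.
move=> f0 fN; apply/eqP; rewrite eq_sym -subr_eq0 -sumrB.
by have := dif_telescope f N; rewrite fN f0 subrr /dif => ->.
Qed.

Lemma sum_sub f (N c m : nat) : (forall i, 0 <= f i) -> (c + m <= N)%N ->
  \sum_(l < m) f (c + l)%N <= \sum_(i < N) f i.
Proof.
move=> f0 h; rewrite -(subnKC h) big_split_ord /= big_split_ord /=.
rewrite -addrA -[leLHS]add0r lerD ?sumr_ge0// lerDl; exact: sumr_ge0.
Qed.

Lemma dif_chain (q : nat -> R) (c m i j : nat) : (c <= i)%N -> (i <= j)%N -> (j <= c + m)%N ->
  (q j - q i) ^+ 2 <= m%:R * \sum_(l < m) dif q (c + l)%N ^+ 2.
Proof.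
move=> ci ij jm.
have -> : q j - q i = \sum_(l < j - i) 1 * dif (fun l => q (i + l)%N) l.
  under eq_bigr do rewrite mul1r.
  by rewrite dif_telescope addn0 subnKC.
apply: (le_trans (sum_cauchy_schwarz (fun=> 1) _ _)).
apply: ler_pM; [by apply: sumr_ge0 => l _; exact: sqr_ge0|by apply: sumr_ge0 => l _; exact: sqr_ge0| |].
  under eq_bigr do rewrite expr1n.
  by rewrite sumr_const card_ord ler_nat leq_subLR (leq_trans jm)// leq_add2r.
have h := sum_sub (fun l => dif q (c + l)%N ^+ 2) m (i - c) (j - i) (fun l => sqr_ge0 _).
apply: le_trans (h _); last by rewrite -(leq_add2l c) addnA subnKC// subnKC.
rewrite le_eqVlt; apply/orP; left; apply/eqP; apply: eq_bigr => l _.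
by rewrite addnA subnKC// /dif addnS.
Qed.

Lemma dif_chain_abs (q : nat -> R) (c m i j : nat) : (c <= i <= c + m)%N -> (c <= j <= c + m)%N ->
  (q j - q i) ^+ 2 <= m%:R * \sum_(l < m) dif q (c + l)%N ^+ 2.
Proof.
move=> /andP[ci im] /andP[cj jm]; have [ij|/ltnW ji] := leqP i j; first exact: dif_chain.
have -> : (q j - q i) ^+ 2 = (q i - q j) ^+ 2 by ring.
exact: dif_chain.
Qed.

Definition tent (i0 rho i : nat) : R := pospart (rho%:R - `|i%:R - i0%:R|).

Lemma tent_ge0 i0 rho i : 0 <= tent i0 rho i.
Proof. by rewrite /tent; have [[h ->]|[_ ->]] := pospartP (rho%:R - `|i%:R - i0%:R| : R); first exact: h. Qed.

Lemma tent_le i0 rho i : tent i0 rho i <= rho%:R.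
Proof.
rewrite /tent; have [[_ ->]|[_ ->]] := pospartP (rho%:R - `|i%:R - i0%:R| : R); last exact: ler0n.
by rewrite gerBl.
Qed.

Lemma dist_nat (i j : nat) : (i <= j)%N -> `|i%:R - j%:R| = j%:R - i%:R :> R.
Proof. by move=> ij; rewrite distrC ger0_norm// subr_ge0 ler_nat. Qed.

Lemma tent_out i0 rho i : (i + rho <= i0)%N || (i0 + rho <= i)%N -> tent i0 rho i = 0.
Proof.
move=> h; rewrite /tent pospart_le// subr_le0; case/orP: h => h.
- rewrite dist_nat; last by rewrite (leq_trans _ h)// leq_addr.
  by rewrite lerBrDr -natrD ler_nat addnC.
- rewrite distrC dist_nat; last by rewrite (leq_trans _ h)// leq_addr.
  by rewrite lerBrDr -natrD ler_nat addnC.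
Qed.

Lemma tent_in i0 rho c i : (c <= rho)%N -> (i0 <= i + c)%N -> (i <= i0 + c)%N ->
  rho%:R - c%:R <= tent i0 rho i.
Proof.
move=> cr h1 h2; have d : `|i%:R - i0%:R| <= c%:R :> R.
  by move: h1 h2; rewrite -!(ler_nat R) !natrD ler_norml => h1 h2; apply/andP; split; lra.
rewrite /tent pospart_ge; first lra.
by rewrite subr_ge0 (le_trans d)// ler_nat.
Qed.

Lemma pospart_convex (x : R) : 2 * pospart x <= pospart (x + 1) + pospart (x - 1).
Proof.
by have [[? ->]|[? ->]] := pospartP x; have [[? ->]|[? ->]] := pospartP (x + 1);
  have [[? ->]|[? ->]] := pospartP (x - 1); lra.
Qed.

(** Away from the apex this is convexity of [pospart]; at the apex each of the two neighbours is
    lower by at most 1. *)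
Lemma lap_tent i0 rho i : (0 < i)%N -> - (2 * (i == i0)%:R) <= lap (tent i0 rho) i.
Proof.
case: i => // i _; rewrite /lap /tent /=.
have [E|ne] := eqVneq i.+1 i0.
  have h (x y : R) : `|x - y| <= 1 -> pospart x - 1 <= pospart y.
    rewrite ler_norml => /andP[? ?].
    by have [[? ->]|[? ->]] := pospartP x; have [[? ->]|[? ->]] := pospartP y; lra.
  have E1 : i.+2%:R - i0%:R = 1 :> R by rewrite -E -[i.+2%:R]natr1 addrAC subrr add0r.
  have E2 : i%:R - i0%:R = - 1 :> R by rewrite -E -natr1 opprD addrA subrr add0r.
  have E3 : i.+1%:R - i0%:R = 0 :> R by rewrite -E subrr.
  rewrite E1 E2 E3 normr0 normrN1 normr1.
  have d1 : `|(rho%:R - 0) - (rho%:R - 1)| <= 1 :> R by rewrite ler_norml; apply/andP; split; lra.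
  by have := h _ _ d1; rewrite mulr1; lra.
rewrite mulr0 oppr0.
have n1 : i.+1%:R = i%:R + 1 :> R by rewrite -natr1.
have n2 : i.+2%:R = i%:R + 1 + 1 :> R by rewrite -natr1 n1.
have [lt|lt] := ltnP i.+1 i0.
  rewrite (dist_nat i.+2 i0 lt) (dist_nat i.+1 i0 (ltnW lt)) (dist_nat i i0 (ltnW (ltnW lt))) n1 n2.
  have := pospart_convex (rho%:R - (i0%:R - (i%:R + 1))).
  have -> : rho%:R - (i0%:R - (i%:R + 1 + 1)) = rho%:R - (i0%:R - (i%:R + 1)) + 1 :> R by ring.
  have -> : rho%:R - (i0%:R - i%:R) = rho%:R - (i0%:R - (i%:R + 1)) - 1 :> R by ring.
  lra.
have lt' : (i0 <= i)%N by rewrite -ltnS ltn_neqAle eq_sym ne.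
rewrite (distrC i.+2%:R) (distrC i.+1%:R) (distrC i%:R) (dist_nat i0 i.+2 (leqW (leqW lt')))
  (dist_nat i0 i.+1 (leqW lt')) (dist_nat i0 i lt') n1 n2.
have := pospart_convex (rho%:R - (i%:R + 1 - i0%:R)).
have -> : rho%:R - (i%:R + 1 + 1 - i0%:R) = rho%:R - (i%:R + 1 - i0%:R) - 1 :> R by ring.
have -> : rho%:R - (i%:R - i0%:R) = rho%:R - (i%:R + 1 - i0%:R) + 1 :> R by ring.
lra.
Qed.

Lemma tent_lip i0 rho i : `|dif (tent i0 rho) i| <= 1.
Proof.
apply: (le_trans (pospart_lip _ _)); have -> : rho%:R - `|i.+1%:R - i0%:R| - (rho%:R - `|i%:R - i0%:R|) =
  `|i%:R - i0%:R| - `|i.+1%:R - i0%:R| :> R by ring.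
apply: (le_trans (ler_dist_dist _ _)).
by rewrite -natr1 [X in `|X|](_ : _ = -1) ?normrN1//; ring.
Qed.

(* The quartic vanishes at 0 and 1, and its second derivative 12 x (x - 1) is at least -12 times
   its value on [0, 1]. *)
Definition quartic (x : R) : R := x ^+ 4 - 2 * x ^+ 3 + x.
Definition bump (s l i : nat) : R :=
  if (s <= i <= s + l)%N then quartic ((i%:R - s%:R) / l%:R) else 0.

Lemma quartic_ge (x : R) : 0 <= x <= 1 -> x * (1 - x) <= quartic x.
Proof.
move=> /andP[x0 x1]; have -> : quartic x = x * (1 - x) * (1 + x * (1 - x)) by rewrite /quartic; ring.
have : 0 <= x * (1 - x) by rewrite mulr_ge0// subr_ge0.
move: (x * (1 - x)) => y y0; nra.
Qed.

Lemma quartic_le1 (x : R) : 0 <= x <= 1 -> quartic x <= 1.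
Proof.
move=> /andP[x0 x1]; have -> : quartic x = x * (1 - x) * (1 + x * (1 - x)) by rewrite /quartic; ring.
have : 0 <= x * (1 - x) by rewrite mulr_ge0// subr_ge0.
have : x * (1 - x) <= 1 / 4 by have := sqr_ge0 (x - 1 / 2); nra.
move: (x * (1 - x)) => y ? ?; nra.
Qed.

Lemma bump_arg s l i : (0 < l)%N -> (s <= i <= s + l)%N -> 0 <= ((i%:R - s%:R) / l%:R : R) <= 1.
Proof.
move=> l0 /andP[si il]; have l0' : 0 < l%:R :> R by rewrite ltr0n.
rewrite divr_ge0 ?subr_ge0 ?ler_nat//= ler_pdivrMr// mul1r lerBlDr -natrD ler_nat addnC//.
Qed.

Lemma bump_ge0 s l i : (0 < l)%N -> 0 <= bump s l i.
Proof.
move=> l0; rewrite /bump; case: ifP => // h; have xI := bump_arg s l i l0 h.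
apply: le_trans (quartic_ge _ xI); case/andP: xI => ? ?; by rewrite mulr_ge0// subr_ge0.
Qed.

Lemma bump_le1 s l i : (0 < l)%N -> bump s l i <= 1.
Proof.
by move=> l0; rewrite /bump; case: ifP => // h; apply: quartic_le1; exact: bump_arg.
Qed.

Lemma bump_out s l i : (0 < l)%N -> (i <= s)%N || (s + l <= i)%N -> bump s l i = 0.
Proof.
move=> l0 h; rewrite /bump; case: ifP => // /andP[h1 h2]; case/orP: h => h.
  have -> : i = s by apply/eqP; rewrite eqn_leq h h1.
  by rewrite subrr mul0r /quartic !expr0n /= mulr0 subrr addr0.
have -> : i = (s + l)%N by apply/eqP; rewrite eqn_leq h h2.
rewrite natrD addrC addrA addNr add0r divff; last by rewrite pnatr_eq0 -lt0n.
by rewrite /quartic !expr1n; ring.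
Qed.

Lemma lap_bump s l i : (0 < l)%N -> (0 < i)%N ->
  - (12 / l%:R ^+ 2 * bump s l i) <= lap (bump s l) i.
Proof.
move=> l0 i0; have [h|h] := boolP ((i <= s)%N || (s + l <= i)%N).
  have E := bump_out s l i l0 h; have := bump_ge0 s l i.+1 l0; have := bump_ge0 s l i.-1 l0.
  by rewrite /lap E; lra.
move: h; rewrite negb_or -!ltnNge => /andP[si il].
case: i i0 si il => // i _; rewrite ltnS => si il.
have h1 : (s <= i <= s + l)%N by rewrite si/= (leq_trans _ il)// leqW.
have h2 : (s <= i.+1 <= s + l)%N by rewrite (leqW si)/= ltnW.
have h3 : (s <= i.+2 <= s + l)%N by rewrite (leqW (leqW si))/= il.
have xI := bump_arg s l i.+1 l0 h2; have ge := quartic_ge _ xI.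
rewrite /lap /bump /= h1 h2 h3; move: ge.
have l0' : l%:R != 0 :> R by rewrite pnatr_eq0 -lt0n.
set x := (i.+1%:R - s%:R) / l%:R => ge.
have -> : (i.+2%:R - s%:R) / l%:R = x + l%:R^-1 :> R by rewrite /x -natr1; field.
have -> : (i%:R - s%:R) / l%:R = x - l%:R^-1 :> R by rewrite /x -natr1; field.
have -> : 12 / l%:R ^+ 2 = 12 * (l%:R^-1) ^+ 2 :> R by rewrite exprVn.
move: (l%:R^-1) => e.
(* For a quartic the second difference is the second derivative plus a fourth-order term, here with
   the favourable sign. *)
have -> : quartic (x + e) - 2 * quartic x + quartic (x - e) = e ^+ 2 * (12 * x ^+ 2 - 12 * x) + 2 * e ^+ 4.
  by rewrite /quartic; ring.
have e2 : 0 <= e ^+ 2 := sqr_ge0 e.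
have e4 : 0 <= e ^+ 4 by rewrite exprn_even_ge0.
have := ler_wpM2l e2 ge; lra.
Qed.

Lemma sum_bump s l N : (1 < l)%N -> (s + l <= N)%N -> l%:R / 8 <= \sum_(i < N) bump s l i.
Proof.
move=> l1 sN; have l0 : (0 < l)%N by exact: ltnW.
apply: le_trans (sum_sub (bump s l) N s l (fun i => bump_ge0 s l i l0) sN).
have lp : 0 < l%:R :> R by rewrite ltr0n.
(* With the lower bound x (1 - x) of [quartic] and [M = l], the sum is (l^2 - 1) / (6 l), which is
   at least l / 8 from l = 2 on. *)
have form M : \sum_(j < M) (j%:R * (l%:R - j%:R)) = M%:R * (M%:R - 1) * (3 * l%:R - 2 * M%:R + 1) / 6 :> R.
  elim: M => [|M IH]; first by rewrite big_ord0 !mul0r.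
  by rewrite big_ord_recr /= IH -natr1; field.
apply: (@le_trans _ _ (\sum_(j < l) (l%:R ^- 2 * (j%:R * (l%:R - j%:R))))).
  rewrite -mulr_sumr form.
  have -> : l%:R ^- 2 * (l%:R * (l%:R - 1) * (3 * l%:R - 2 * l%:R + 1) / 6) = (l%:R ^+ 2 - 1) / (6 * l%:R) :> R.
    by field; exact: lt0r_neq0.
  rewrite ler_pdivlMr ?mulr_gt0//.
  have : 2 <= l%:R :> R by rewrite ler_nat.
  by move: (l%:R : R) => y; nra.
apply: ler_sum => j _; have h : (s <= s + j <= s + l)%N by rewrite leq_addr/= leq_add2l ltnW.
rewrite /bump h; have xI := bump_arg s l (s + j) l0 h; apply: le_trans (quartic_ge _ xI).
have -> : (s + j)%:R - s%:R = j%:R :> R by rewrite natrD addrAC subrr add0r.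
rewrite le_eqVlt; apply/orP; left; apply/eqP.
by field; exact: lt0r_neq0.
Qed.

End DiscreteSums.

(** * The concave truncation *)

Section Truncation.
Context {R : realType}.

(** The eighth root of [1 + |w|]. With [x = root8 (A r)] the exponents 1/4, 3/8, 3/4 and 1 of 1 + A
    become the powers 2, 3, 6 and 8 of [x], so the concavity inequalities are polynomial. *)
Definition root8 (w : R) : R := Num.sqrt (Num.sqrt (Num.sqrt (1 + `|w|))).

Lemma root8_ge1 w : 1 <= root8 w.
Proof.
have h (x : R) : 1 <= x -> 1 <= Num.sqrt x by move=> x1; rewrite -[leLHS]sqrtr1 ler_wsqrtr.
by apply/h/h/h; rewrite lerDl.
Qed.

Lemma root8_exp w : 0 <= w -> root8 w ^+ 8 = 1 + w.
Proof.
move=> w0; rewrite /root8 ger0_norm// (exprM _ 2 4) sqr_sqrtr// (exprM _ 2 2) sqr_sqrtr//.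
by rewrite sqr_sqrtr// addr_ge0.
Qed.

Lemma root8_le v w : 0 <= v -> v <= w -> root8 v <= root8 w.
Proof.
move=> v0 vw; do 3!apply: ler_wsqrtr.
by rewrite lerD2l !ger0_norm// (le_trans v0).
Qed.

Lemma root8_continuous : continuous root8.
Proof.
move=> w; apply: continuous_comp; last exact: sqrt_continuous.
apply: continuous_comp; last exact: sqrt_continuous.
apply: continuous_comp; last exact: sqrt_continuous.
by apply: cvgD; [exact: cvg_cst|exact: norm_continuous].
Qed.

Lemma root8_lip v w : 0 <= v -> 0 <= w -> `|root8 v ^- 2 - root8 w ^- 2| <= `|v - w|.
Proof.
move=> v0 w0; have -> : v - w = root8 v ^+ 8 - root8 w ^+ 8 by rewrite !root8_exp//; ring.
move: (root8 v) (root8 w) (root8_ge1 v) (root8_ge1 w) => x y x1 y1.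
have x2 : 1 <= x ^+ 2 by rewrite expr_ge1// (le_trans ler01).
have y2 : 1 <= y ^+ 2 by rewrite expr_ge1// (le_trans ler01).
have -> : x ^+ 8 - y ^+ 8 = ((x ^+ 2) ^+ 4 - (y ^+ 2) ^+ 4) by ring.
move: (x ^+ 2) (y ^+ 2) x2 y2 => X Y X1 Y1.
have X0 : 0 < X by lra.
have Y0 : 0 < Y by lra.
have -> : X^-1 - Y^-1 = - ((X - Y) * (X * Y)^-1) by field; rewrite !gt_eqF.
have -> : X ^+ 4 - Y ^+ 4 = (X - Y) * ((X + Y) * (X ^+ 2 + Y ^+ 2)) by ring.
rewrite normrN !normrM; apply: ler_wpM2l => //.
apply: (@le_trans _ _ 1).
  rewrite ger0_norm; last by rewrite invr_ge0 mulr_ge0// ltW.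
  by rewrite invf_le1 ?mulr_gt0// mulr_ege1.
have h1 : 1 <= X + Y by lra.
have h2 : 1 <= X ^+ 2 + Y ^+ 2 by have := exprn_ege1 2 X1; have := sqr_ge0 Y; lra.
rewrite !ger0_norm ?(le_trans ler01)//; exact: mulr_ege1.
Qed.

(* For x = (1 + w)^(1/8) and y = (1 + z)^(1/8), this is K(w) + K'(w) (z - w) - K(z), where K is the
   primitive of (1 + w)^(-1/4). *)
Definition concave_gap (x y : R) : R :=
  4 / 3 * (x ^+ 6 - 1) + x ^- 2 * (y ^+ 8 - x ^+ 8) - 4 / 3 * (y ^+ 6 - 1).

Lemma concave_gap_ge0 x y : 1 <= x -> 1 <= y -> 0 <= concave_gap x y.
Proof.
move=> x1 y1; have x0 : 0 < x by lra.
have -> : concave_gap x y = x ^- 2 / 3 * ((x ^+ 2 - y ^+ 2) ^+ 2 *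
   (x ^+ 4 + 2 * x ^+ 2 * y ^+ 2 + 3 * y ^+ 4)).
  by rewrite /concave_gap; field; exact: lt0r_neq0.
apply: mulr_ge0; first by rewrite divr_ge0// invr_ge0 sqr_ge0.
apply: mulr_ge0; first exact: sqr_ge0.
have := sqr_ge0 (x ^+ 2 + y ^+ 2); have := sqr_ge0 (y ^+ 2); nra.
Qed.

(** The sum of the two gaps is (K'(w) - K'(z)) (z - w), the discrete form of -K'' times a squared
    gradient. In the limit -K'' = (1 + w)^(-5/4) / 4, while the squared gradient of (1 + w)^(3/8)
    has the smaller coefficient 9/64. *)
Lemma concave_gap_sym x y : 1 <= x -> 1 <= y ->
  (y ^+ 3 - x ^+ 3) ^+ 2 <= concave_gap x y + concave_gap y x.
Proof.
move=> x1 y1; have x0 : 0 < x by lra.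
have y0 : 0 < y by lra.
have -> : concave_gap x y + concave_gap y x =
  (y - x) ^+ 2 * ((x + y) ^+ 2 * (x ^+ 2 + y ^+ 2) * ((x ^+ 4 + y ^+ 4) / (x ^+ 2 * y ^+ 2))).
  by rewrite /concave_gap; field; rewrite !gt_eqF.
have -> : (y ^+ 3 - x ^+ 3) ^+ 2 = (y - x) ^+ 2 * (x ^+ 2 + x * y + y ^+ 2) ^+ 2 by ring.
apply: ler_wpM2l; first exact: sqr_ge0.
have h : 2 <= (x ^+ 4 + y ^+ 4) / (x ^+ 2 * y ^+ 2).
  rewrite ler_pdivlMr ?mulr_gt0 ?exprn_gt0//.
  by have := sqr_ge0 (x ^+ 2 - y ^+ 2); nra.
have xy : 0 < x * y by rewrite mulr_gt0.
have p : 0 <= (x + y) ^+ 2 * (x ^+ 2 + y ^+ 2).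
  by rewrite mulr_ge0 ?sqr_ge0// addr_ge0// sqr_ge0.
apply: (le_trans _ (ler_wpM2l p h)).
have e1 : 0 <= x ^+ 2 by exact: sqr_ge0.
have e2 : 0 <= y ^+ 2 by exact: sqr_ge0.
have -> : (x + y) ^+ 2 * (x ^+ 2 + y ^+ 2) * 2 = (x ^+ 2 + 2 * (x * y) + y ^+ 2) * (2 * (x ^+ 2 + y ^+ 2)) by ring.
have := sqr_ge0 (x - y).
have -> : (x - y) ^+ 2 = x ^+ 2 + y ^+ 2 - 2 * (x * y) by ring.
rewrite expr2 => d; apply: ler_pM; rewrite ?addr_ge0// ?ltW//; lra.
Qed.

Variables (a A : R -> R) (a0 L : R).
Hypothesis ca : coefficient a a0 L.
Hypothesis A0 : A 0 = 0.
Hypothesis dA : forall x : R, is_derive x (1 : R) A (a x).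

(** [F] is the primitive of [root8 (A r) ^- 2], which decreases and is at most 1; this gives the two
    bounds on [F]. The last property is a Taylor bound from the Lipschitz continuity of that
    derivative: it replaces the chain rule over one explicit step, at the cost of a term quadratic
    in the increment. *)
Lemma truncation : exists F : R -> R, [/\
  F 0 = 0,
  forall r, 0 <= r -> r * root8 (A r) ^- 2 <= F r <= r &
  forall S r s, 0 <= r <= S -> 0 <= s <= S ->
    root8 (A r) ^- 2 * (s - r) - (a 0 + L * S) * (s - r) ^+ 2 <= F s - F r].
Proof.
pose q r := root8 (A r) ^- 2.
have qc : continuous q.
  move=> r; apply: cvgV; first by rewrite expf_neq0// gt_eqF// (lt_le_trans ltr01)// root8_ge1.
  apply: (@cvg_comp _ _ _ (fun r => root8 (A r)) (fun z => z ^+ 2)); last exact: exprn_continuous.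
  apply: (@continuous_comp _ _ _ A root8); last exact: root8_continuous.
  exact: (prim_continuous _ _ dA).
have q0 r : 0 <= q r by rewrite invr_ge0 sqr_ge0.
have q1 r : q r <= 1.
  by rewrite invf_le1 ?exprn_ege1 ?root8_ge1// exprn_gt0// (lt_le_trans ltr01)// root8_ge1.
have qmono r s : 0 <= r -> r <= s -> q s <= q r.
  move=> r0 rs; have z z : 0 < root8 z ^+ 2 by rewrite exprn_gt0// (lt_le_trans ltr01)// root8_ge1.
  have xy : root8 (A r) <= root8 (A s).
    apply: root8_le; first exact: (prim_ge0 _ _ _ _ ca A0 dA).
    exact: (prim_le _ _ _ _ ca dA).
  have := z (A r); have := z (A s) => z1 z2.
  by rewrite /q lef_pV2 ?posrelE// lerXn2r ?nnegrE// (le_trans ler01 (root8_ge1 _)).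
have [F F0 dF] := continuous_antiderivative _ qc.
exists F; split=> // [r r0|S r s /andP[r0 rS] /andP[s0 sS]].
  have [c [c0 cr]] := mean_value _ _ _ _ dF r0; rewrite F0 !subr0 => ->.
  rewrite -/(q r) [r * _]mulrC; apply/andP; split; last by rewrite ler_piMl.
  by apply: ler_wpM2r => //; exact: qmono.
have lip c : 0 <= c <= S -> `|c - r| <= `|s - r| -> - (a 0 + L * S) * `|s - r| <= q c - q r /\
    q c - q r <= (a 0 + L * S) * `|s - r|.
  move=> /andP[c0 cS] cr; apply/andP; rewrite mulNr -ler_norml.
  apply: (le_trans (root8_lip _ _ (prim_ge0 _ _ _ _ ca A0 dA _ c0) (prim_ge0 _ _ _ _ ca A0 dA _ r0))).
  have nc : `|c| <= S by rewrite ger0_norm.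
  have nr : `|r| <= S by rewrite ger0_norm.
  apply: (le_trans (prim_lip _ _ _ _ ca dA S _ _ nc nr)).
  apply: ler_wpM2l => //.
  by rewrite addr_ge0 ?(ltW (coef0_gt0 _ _ _ ca))// mulr_ge0 ?(coef_L _ _ _ ca)// (le_trans c0).
have [rs|/ltW sr] := leP r s.
  have [c [rc cs E]] := mean_value _ _ _ _ dF rs; rewrite E -/(q r).
  have d0 : 0 <= s - r by rewrite subr_ge0.
  have hc : 0 <= c <= S by rewrite (le_trans r0 rc) (le_trans cs sS).
  have hd : `|c - r| <= `|s - r| by rewrite !ger0_norm ?subr_ge0// lerD2r.
  have [h _] := lip c hc hd; rewrite (ger0_norm d0) in h.
  by have := ler_wpM2r d0 h; lra.
have [c [sc cr E]] := mean_value _ _ _ _ dF sr.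
have -> : F s - F r = - (q c * (r - s)) by rewrite -E; ring.
rewrite -/(q r); have d0 : 0 <= r - s by rewrite subr_ge0.
have hc : 0 <= c <= S by rewrite (le_trans s0 sc) (le_trans cr rS).
have hd : `|c - r| <= `|s - r|.
  by rewrite distrC [leRHS]distrC !ger0_norm ?subr_ge0// lerB.
have [_ h] := lip c hc hd; rewrite distrC (ger0_norm d0) in h.
by have := ler_wpM2r d0 h; lra.
Qed.

(** Quadratic growth of A gives [x ^+ 4 <= C * (1 + r)] for [x = root8 (A r)]. As [x ^+ 2] is at
    least 1, division by it leaves [r * x ^- 2], which is at most [F r]. *)
Lemma truncation_growth (F : R -> R) r : 0 <= r -> r * root8 (A r) ^- 2 <= F r ->
  root8 (A r) ^+ 2 <= (1 + a 0 + L) * (1 + F r).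
Proof.
move=> r0 h; have x1 := root8_ge1 (A r); have E := root8_exp _ (prim_ge0 _ _ _ _ ca A0 dA _ r0).
have AP := prim_abs _ _ _ _ ca A0 dA r; have a00 := coef0_gt0 _ _ _ ca; have L0 := coef_L _ _ _ ca.
move: AP E h; rewrite !ger0_norm ?(prim_ge0 _ _ _ _ ca A0 dA)//.
move: x1; set x := root8 (A r) => x1 AP E h; have x0 : 0 < x by lra.
set C := 1 + a 0 + L; have C1 : 1 <= C by rewrite /C; lra.
have h4 : x ^+ 4 <= C * (1 + r).
  have c0 : 0 <= C * (1 + r) by apply: mulr_ge0; lra.
  rewrite -ler_sqr ?nnegrE ?exprn_ge0 ?(ltW x0)// -exprM E exprMn.
  apply: (@le_trans _ _ (C * (1 + r) ^+ 2)); last first.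
    by rewrite ler_wpM2r ?sqr_ge0// expr2 ler_peMl//; lra.
  apply: (@le_trans _ _ (1 + (a 0 + L * r) * r)); first by rewrite lerD2l.
  have : 0 <= L * r by rewrite mulr_ge0.
  have : 0 <= a 0 * r by rewrite mulr_ge0// ltW.
  have : 0 <= a 0 * r ^+ 2 by rewrite mulr_ge0 ?sqr_ge0// ltW.
  have := sqr_ge0 r; rewrite /C; nra.
have x2 : 1 <= x ^+ 2 by rewrite expr_ge1// ltW.
have h5 : x ^+ 4 <= C * (x ^+ 2 + r).
  by apply: (le_trans h4); apply: ler_wpM2l; lra.
apply: (@le_trans _ _ (C * (1 + r * x ^- 2))); last first.
  by apply: ler_wpM2l; [lra|rewrite lerD2l].
have -> : C * (1 + r * x ^- 2) = C * (x ^+ 2 + r) / x ^+ 2 by field; exact: lt0r_neq0.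
by rewrite ler_pdivlMr ?exprn_gt0// -exprD.
Qed.

End Truncation.

Section Averages.
Context {R : realType}.

Lemma pigeonhole_le (f : nat -> R) (M : nat) (c : R) : (0 < M)%N ->
  \sum_(l < M) f l <= M%:R * c -> exists2 l, (l < M)%N & f l <= c.
Proof.
move=> M0 h; apply: contrapT => hn.
have hn' l : (l < M)%N -> c < f l by move=> lM; rewrite ltNge; apply/negP => hl; apply: hn; exists l.
move: h; rewrite -sum_cst leNgt => /negP; apply.
apply: ltr_sum => [|l _]; last exact: hn'.
by apply/hasP; exists (Ordinal M0) => //; rewrite mem_index_enum.
Qed.

(** A quantity that increases up to an error [c] per step is bounded at all times by its last value,
    and so is its total gain. This is where information passes from the final time to the earlier
    ones. *)
Lemma ascent_bounds (f g : nat -> R) (c : R) (K : nat) : 0 <= c ->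
  (forall k, (k < K)%N -> 0 <= g k) ->
  (forall k, (k < K)%N -> f k + g k - c <= f k.+1) ->
  (forall k, (k <= K)%N -> f k <= f K + K%:R * c) /\
  \sum_(k < K) g k <= f K - f 0%N + K%:R * c.
Proof.
move=> c0; elim: K => [|K IH] g0 h.
  by split=> [[|k]//|]; rewrite ?big_ord0 mul0r addr0 ?subrr.
have [] := IH (fun k kK => g0 k (ltnW kK)) (fun k kK => h k (ltnW kK)) => h1 h2.
have gK := g0 K (ltnSn K); have hK := h K (ltnSn K).
split=> [k|]; last by rewrite big_ord_recr /= -natr1; lra.
rewrite leq_eqVlt => /orP[/eqP ->|]; first by rewrite lerDl mulr_ge0.
by rewrite ltnS => /h1; rewrite -natr1; lra.
Qed.

End Averages.

(** * Backward estimates on one uncontrolled zone *)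

Section Zone.
Context {R : realType}.
Variables (a A : R -> R) (a0 L : R).
Hypothesis ca : coefficient a a0 L.
Hypothesis A0 : A 0 = 0.
Hypothesis dA : forall x : R, is_derive x (1 : R) A (a x).
Variables (N K m i0 : nat) (kap Mb : R) (v : nat -> nat -> R).
Hypotheses (m0 : (0 < m)%N) (zl : (24 * m <= i0)%N) (zr : (i0 + 24 * m <= N)%N).
Hypotheses (kap0 : 0 <= kap) (Mb1 : 1 <= Mb).
Hypothesis vb : forall k i, (k <= K)%N -> 0 <= v k i <= Mb.
Hypothesis v0 : forall k, v k 0%N = 0.
Hypothesis vN : forall k, v k N = 0.
Hypothesis cfl : forall r s, 0 <= r -> r <= s -> s <= Mb -> 2 * kap * (A s - A r) <= s - r.
Hypothesis step : forall k i, (k < K)%N -> (i0 < i + 24 * m)%N -> (i < i0 + 24 * m)%N ->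
  v k.+1 i = v k i + kap * lap (fun j => A (v k j)) i.

Let Ale r s : r <= s -> A r <= A s. Proof. exact: (prim_le _ _ _ _ ca dA). Qed.
Let Age r : 0 <= r -> 0 <= A r. Proof. exact: (prim_ge0 _ _ _ _ ca A0 dA). Qed.

Definition unit_min k i : R := Num.min (v k i) 1.

Let p_bound k i : (k <= K)%N -> [/\ 0 <= unit_min k i, unit_min k i <= 1 & unit_min k i <= v k i].
Proof.
move=> kK; have /andP[h1 h2] := vb k i kK.
by rewrite /unit_min ge_min lexx orbT le_min h1 ler01 ge_min lexx.
Qed.

(** The minimum of two solutions, [v] and the constant 1. The condition [cfl] makes the explicit
    step monotone in the value at node [i], and the neighbours enter through the increasing function
    A, so the step can be compared with each of the two. *)
Lemma unit_min_super k i : (k < K)%N -> (i0 < i + 24 * m)%N -> (i < i0 + 24 * m)%N ->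
  unit_min k i + kap * lap (fun j => A (unit_min k j)) i <= unit_min k.+1 i.
Proof.
move=> kK h1 h2; have [x0 x1 xv] := p_bound k i.+1 (ltnW kK).
have [y0 y1 yv] := p_bound k i (ltnW kK); have [z0 z1 zv] := p_bound k i.-1 (ltnW kK).
rewrite [leRHS]/unit_min le_min step// /lap; apply/andP; split.
  have /andP[_ vM] := vb k i (ltnW kK).
  have := cfl _ _ y0 yv vM; have := ler_wpM2l kap0 (Ale _ _ xv); have := ler_wpM2l kap0 (Ale _ _ zv).
  lra.
have := cfl _ _ y0 y1 Mb1; have := ler_wpM2l kap0 (Ale _ _ x1); have := ler_wpM2l kap0 (Ale _ _ z1).
lra.
Qed.

Let s := (i0 - m)%N.
Let l := (2 * m)%N.
Let bm k : R := \sum_(i < N) bump s l i * unit_min k i.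
(** Relative loss of the bump-weighted mass in one step: 12 comes from the quartic, and [a 0 + L]
    bounds A(r) / r for r in ]0, 1]. *)
Let x : R := kap * (12 * (a 0 + L) / l%:R ^+ 2).

Let l0 : (0 < l)%N. Proof. by rewrite /l muln_gt0. Qed.
Let mi0 : (m <= i0)%N. Proof. by rewrite (leq_trans _ zl)// leq_pmull. Qed.
Let sE : (s + m = i0)%N. Proof. by rewrite /s subnK. Qed.
Let slE : (s + l = i0 + m)%N. Proof. by rewrite /l mul2n -addnn addnA sE. Qed.
Let slN : (s + l <= N)%N. Proof. by rewrite slE (leq_trans _ zr)// leq_add2l leq_pmull. Qed.

(** The Laplacian is moved onto the bump, whose second difference is at least a negative multiple of
    the bump itself; on [0, 1] the function A is at most linear. *)
Lemma window_step k : (k < K)%N -> (1 - x) * bm k <= bm k.+1.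
Proof.
move=> kK; have h : \sum_(i < N) bump s l i * (unit_min k i + kap * lap (fun j => A (unit_min k j)) i)
    <= bm k.+1.
  apply: ler_sum => i _; have [hout|] := boolP ((i <= s)%N || (s + l <= i)%N).
    by rewrite bump_out// !mul0r.
  rewrite negb_or -!ltnNge slE => /andP[h1 h2]; apply: ler_wpM2l; first exact: bump_ge0.
  by apply: unit_min_super => //; move: sE m0 h1 h2; clear; move: s; lia.
apply: le_trans h; rewrite (eq_bigr (fun i : 'I_N => bump s l i * unit_min k i +
   kap * (lap (fun j => A (unit_min k j)) i * bump s l i))); last by move=> i _; ring.
have pm0 : unit_min k 0 = 0 by rewrite /unit_min v0 min_l// ler01.
have pmN : unit_min k N = 0 by rewrite /unit_min vN min_l// ler01.
rewrite big_split /= -mulr_sumr lap_sym; last 4 first.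
- by rewrite pm0.
- by rewrite pmN.
- by rewrite bump_out.
- by rewrite bump_out// slN orbT.
have -> : (1 - x) * bm k = bm k + kap * (- (12 * (a 0 + L) / l%:R ^+ 2 * bm k)) by rewrite /x; ring.
rewrite lerD2l ler_wpM2l// /bm mulr_sumr -sumrN; apply: ler_sum => -[[|i] iN] _ /=.
  by rewrite pm0 A0 !mulr0 mul0r oppr0.
have [y0 y1 yv] := p_bound k i.+1 (ltnW kK).
have b0 := bump_ge0 s l i.+1 l0 : 0 <= _ :> R.
have lb := lap_bump s l i.+1 l0 (ltn0Sn i) : _ <= _ :> R.
have AC : A (unit_min k i.+1) <= (a 0 + L) * unit_min k i.+1.
  have := prim_abs _ _ _ _ ca A0 dA (unit_min k i.+1); rewrite !ger0_norm ?Age// => /le_trans; apply.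
  by rewrite ler_wpM2r// lerD2l ler_piMr// (coef_L _ _ _ ca).
have := ler_wpM2l (Age _ y0) lb.
have c0 : 0 <= 12 / l%:R ^+ 2 * bump s l i.+1 :> R by apply: mulr_ge0 => //; rewrite divr_ge0// sqr_ge0.
have := ler_wpM2l c0 AC.
have -> : 12 * (a 0 + L) / l%:R ^+ 2 = 12 / l%:R ^+ 2 * (a 0 + L) by ring.
move: (12 / l%:R ^+ 2) => q; lra.
Qed.

(** Gronwall backward in time. For [x] at most 1/2 the factor [1 / (1 - x)] lost in each backward
    step is at most [1 + 2 * x], hence at most the exponential of [2 * x]. *)
Lemma window_mass k : (k <= K)%N -> x <= 1 / 2 -> bm k <= expR (2 * x * K%:R) * bm K.
Proof.
move=> kK xh; have x0 : 0 <= x.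
  rewrite mulr_ge0// divr_ge0 ?sqr_ge0// mulr_ge0// addr_ge0 ?(coef_L _ _ _ ca)//.
  exact: ltW (coef0_gt0 _ _ _ ca).
have bm0 j : (j <= K)%N -> 0 <= bm j.
  by move=> jK; apply: sumr_ge0 => i _; rewrite mulr_ge0 ?bump_ge0//; have [] := p_bound j i jK.
have h j : (j <= K)%N -> bm (K - j)%N <= expR (2 * x * j%:R) * bm K.
  elim: j => [|j IH] jK; first by rewrite subn0 mulr0 expR0 mul1r.
  have st := window_step (K - j.+1)%N; have jE : (K - j.+1).+1 = (K - j)%N by rewrite subnSK.
  have {}st : (1 - x) * bm (K - j.+1)%N <= bm (K - j)%N by rewrite -jE; apply: st; rewrite -subSn// subSS leq_subr.
  have b0 := bm0 _ (leq_subr j.+1 K).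
  have e1 : 1 + 2 * x <= expR (2 * x) by exact: expR_ge1Dx.
  have -> : expR (2 * x * j.+1%:R) = expR (2 * x) * expR (2 * x * j%:R) by rewrite -expRD; congr expR; rewrite -natr1; ring.
  rewrite -mulrA; apply: (@le_trans _ _ ((1 + 2 * x) * bm (K - j)%N)); last first.
    apply: ler_pM => //; [by lra|by apply: bm0; exact: leq_subr|exact: IH (ltnW jK)].
  have x20 : 0 <= 1 + 2 * x by lra.
  have := ler_wpM2l x20 st; apply: le_trans.
  rewrite mulrA -[leLHS]mul1r; apply: ler_wpM2r => //.
  have : 0 <= x * (1 - 2 * x) by apply: mulr_ge0; lra.
  lra.
have := h (K - k)%N (leq_subr _ _); rewrite subKn// => /le_trans; apply.
apply: ler_wpM2r; first exact: bm0.
by rewrite ler_expR; apply: ler_wpM2l; [rewrite mulr_ge0|rewrite ler_nat leq_subr].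
Qed.

(** If [v k] exceeded 1 on the whole window, [bm k] would be at least [m / 4], so [bm K] could not
    be small. Over the window the tent of radius [24 * m] is at least [23 * m], so that the tent
    mass of [v K] bounds [23 * m * bm K]. *)
Lemma window_node k (M : R) : (k <= K)%N -> x <= 1 / 2 ->
  \sum_(i < N) tent i0 (24 * m) i * v K i <= M ->
  expR (2 * x * K%:R) * M < 23 * m%:R ^+ 2 / 4 ->
  exists2 j, (i0 <= j + m)%N && (j <= i0 + m)%N & v k j <= 1.
Proof.
move=> kK xh hM hlt; apply: contrapT => hn.
have big j : (i0 <= j + m)%N && (j <= i0 + m)%N -> 1 <= v k j.
  by move=> hj; rewrite leNgt; apply/negP => hv; apply: hn; exists j => //; exact: ltW.
have mp : 0 < m%:R :> R by rewrite ltr0n.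
have h1 : m%:R / 4 <= bm k.
  have -> : m%:R / 4 = l%:R / 8 :> R by rewrite /l natrM; field.
  have l1 : (1 < l)%N by rewrite /l; move: m0; lia.
  apply: le_trans (sum_bump s l N l1 slN) _; apply: ler_sum => i _.
  have [hout|] := boolP ((i <= s)%N || (s + l <= i)%N); first by rewrite bump_out// mul0r.
  rewrite negb_or -!ltnNge slE => /andP[h1 h2].
  have vi : 1 <= v k i by apply: big; move: sE h1 h2; clear; move: s; lia.
  by rewrite /unit_min min_r// mulr1.
have h2 : 23 * m%:R * bm K <= M.
  apply: le_trans hM; rewrite /bm mulr_sumr; apply: ler_sum => i _.
  have [p0 p1 pv] := p_bound K i (leqnn K).
  have t0 := tent_ge0 i0 (24 * m) i : 0 <= _ :> R.
  have [hout|] := boolP ((i <= s)%N || (s + l <= i)%N).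
    by rewrite bump_out// mul0r mulr0 mulr_ge0// (le_trans p0).
  rewrite negb_or -!ltnNge slE => /andP[g1 g2].
  have tin : 23 * m%:R <= tent i0 (24 * m) i :> R.
    have c1 : (i0 <= i + m)%N by move: sE g1; clear; move: s; lia.
    have := tent_in i0 (24 * m) m i (leq_pmull m (isT : (0 < 24)%N)) c1 (ltnW g2) : _ <= _ :> R.
    by rewrite natrM; lra.
  have b0 := bump_ge0 s l i l0 : 0 <= _ :> R; have b1 := bump_le1 s l i l0 : _ <= _ :> R.
  rewrite mulrA; apply: ler_pM => //; first by rewrite mulr_ge0// mulr_ge0// ltW.
  by apply: le_trans tin; rewrite ler_piMr// mulr_ge0// ltW.
have h3 := window_mass k kK xh.
have := le_trans h1 h3; rewrite leNgt => /negP; apply.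
have e0 := expR_gt0 (2 * x * K%:R).
have h4 : expR (2 * x * K%:R) * bm K * (23 * m%:R) <= expR (2 * x * K%:R) * M.
  by rewrite -mulrA ler_wpM2l ?(ltW e0)// mulrC.
have := le_lt_trans h4 hlt; have -> : 23 * m%:R ^+ 2 / 4 = m%:R / 4 * (23 * m%:R) :> R by field.
by rewrite ltr_pM2r// mulr_gt0.
Qed.

Variable F : R -> R.
Hypothesis F0 : F 0 = 0.
Hypothesis Fb : forall r, 0 <= r -> r * root8 (A r) ^- 2 <= F r <= r.
Hypothesis Fstep : forall r t, 0 <= r <= Mb -> 0 <= t <= Mb ->
    root8 (A r) ^- 2 * (t - r) - (a 0 + L * Mb) * (t - r) ^+ 2 <= F t - F r.

Definition zone_mass k : R := \sum_(i < N) tent i0 (24 * m) i * F (v k i).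
Definition zone_root k i : R := root8 (A (v k i)).
(** Summed over the core only, the nodes within [12 * m] of [i0], where the tent has at least half
    its height. *)
Definition zone_dirichlet k : R :=
  \sum_(j < 24 * m) dif (fun i => zone_root k i ^+ 3) (i0 - 12 * m + j) ^+ 2.
Definition unit_root : R := root8 (A 1) ^+ 3.

Lemma zone_dirichlet_ge0 k : 0 <= zone_dirichlet k.
Proof. by apply: sumr_ge0 => j _; exact: sqr_ge0. Qed.

Let X1 k i : 1 <= zone_root k i. Proof. exact: root8_ge1. Qed.
Let X8 k i : (k <= K)%N -> zone_root k i ^+ 8 = 1 + A (v k i).
Proof. by move=> kK; have /andP[h _] := vb k i kK; rewrite root8_exp// Age. Qed.

(** From the anchor [j], where [v <= 1], the cube of the root varies over the [24 * m] differences
    of the core by at most the square root of [24 * m] times the energy; squaring the sum of the two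
    doubles it to 48. *)
Lemma core_root k j i : (k <= K)%N -> (i0 <= j + 12 * m)%N && (j <= i0 + 12 * m)%N -> v k j <= 1 ->
  (i0 <= i + 12 * m)%N && (i <= i0 + 12 * m)%N ->
  zone_root k i ^+ 6 <= 2 * unit_root ^+ 2 + 48 * m%:R * zone_dirichlet k.
Proof.
move=> kK /andP[j1 j2] vj /andP[i1 i2].
have hc := dif_chain_abs (fun i => zone_root k i ^+ 3) (i0 - 12 * m) (24 * m) j i.
have {}hc := hc _ _; move: hc.
have -> : (i0 - 12 * m <= j <= i0 - 12 * m + 24 * m)%N by move: zl j1 j2; clear; lia.
have -> : (i0 - 12 * m <= i <= i0 - 12 * m + 24 * m)%N by move: zl i1 i2; clear; lia.
move=> /(_ isT isT); rewrite -/(zone_dirichlet k) natrM.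
have : zone_root k j ^+ 3 <= unit_root.
  have /andP[vj0 _] := vb k j kK.
  by rewrite lerXn2r ?nnegrE ?(le_trans ler01 (root8_ge1 _))//; apply: root8_le; [exact: Age|exact: Ale].
have : 1 <= zone_root k j ^+ 3 by rewrite exprn_ege1.
have -> : zone_root k i ^+ 6 = (zone_root k i ^+ 3) ^+ 2 by rewrite -exprM.
move: (zone_root k i ^+ 3) (zone_root k j ^+ 3) unit_root (m%:R * zone_dirichlet k) (zone_dirichlet k) => p q u D d q1 qu.
have : q ^+ 2 <= u ^+ 2 by rewrite ler_sqr ?nnegrE//; lra.
have := sqr_ge0 (p - 2 * q); nra.
Qed.

(** The primitive K of (1 + w)^(-1/4), written in the eighth root of 1 + w. With it [lap_gap] is an
    exact discrete chain rule whose remainder consists of concavity gaps. *)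
Let kt (x : R) : R := 4 / 3 * (x ^+ 6 - 1).

Let lap_gap k i : (k <= K)%N -> zone_root k i ^- 2 * lap (fun j => A (v k j)) i =
  lap (fun j => kt (zone_root k j)) i +
  (concave_gap (zone_root k i) (zone_root k i.+1) + concave_gap (zone_root k i) (zone_root k i.-1)).
Proof.
move=> kK; have E j : A (v k j) = zone_root k j ^+ 8 - 1 by rewrite X8//; ring.
rewrite /lap !E /concave_gap /kt; have := X1 k i.
move: (zone_root k i) (zone_root k i.+1) (zone_root k i.-1) => p q r p1.
by field; rewrite gt_eqF// (lt_le_trans ltr01).
Qed.

(* The Dirichlet energy gained over the core of the tent absorbs the loss at its apex, because the
   apex value is compared with that of a nearby node where v <= 1. *)
Lemma tent_dirichlet k : (k <= K)%N -> (exists2 j, (i0 <= j + m)%N && (j <= i0 + m)%N & v k j <= 1) ->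
  m%:R * zone_dirichlet k - 6 * unit_root ^+ 2 <=
  \sum_(i < N) tent i0 (24 * m) i * (zone_root k i ^- 2 * lap (fun j => A (v k j)) i).
Proof.
move=> kK [j /andP[j1 j2] vj].
have t0 i : 0 <= tent i0 (24 * m) i :> R := tent_ge0 i0 (24 * m) i.
have tz : tent i0 (24 * m) 0 = 0 :> R by rewrite tent_out// add0n zl.
have tN : tent i0 (24 * m) N = 0 :> R by rewrite tent_out// zr orbT.
have z0 : zone_root k 0 = 1 by rewrite /zone_root v0 A0 /root8 normr0 addr0 !sqrtr1.
have zN : zone_root k N = 1 by rewrite /zone_root vN A0 /root8 normr0 addr0 !sqrtr1.
pose g1 i := tent i0 (24 * m) i * concave_gap (zone_root k i) (zone_root k i.+1).
pose g2 i := tent i0 (24 * m) i * concave_gap (zone_root k i) (zone_root k i.-1).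
have gg p q : 1 <= p -> 1 <= q -> 0 <= concave_gap p q :> R by exact: concave_gap_ge0.
rewrite (eq_bigr (fun i : 'I_N => lap (fun j => kt (zone_root k j)) i * tent i0 (24 * m) i + (g1 i + g2 i)));
  last by move=> i _; rewrite lap_gap// /g1 /g2; ring.
rewrite big_split /= lap_sym//; last 2 first.
- by rewrite z0 /kt expr1n subrr mulr0.
- by rewrite zN /kt expr1n subrr mulr0.
have Ni : (i0 < N)%N by move: zr m0; clear; lia.
have h1 : - (2 * kt (zone_root k i0)) <= \sum_(i < N) kt (zone_root k i) * lap (tent i0 (24 * m)) i.
  rewrite (bigD1 (Ordinal Ni))//= -[leLHS]addr0; apply: lerD.
    have H : (0 < i0)%N -> - (2 * (i0 == i0)%:R) <= lap (tent i0 (24 * m)) i0 :> R := lap_tent _ _ _.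
    rewrite eqxx mulr1 in H.
    have k0 : 0 <= kt (zone_root k i0) by rewrite mulr_ge0// subr_ge0 exprn_ege1.
    have i00 : (0 < i0)%N by move: zl m0; clear; lia.
    have := ler_wpM2l k0 (H i00); lra.
  apply: sumr_ge0 => -[[|i] iN] /= ne; first by rewrite z0 /kt expr1n subrr mulr0 mul0r.
  rewrite mulr_ge0//; first by rewrite mulr_ge0// subr_ge0 exprn_ege1.
  have := lap_tent i0 (24 * m) i.+1 (ltn0Sn i) : _ <= _ :> R.
  have /negbTE -> : i.+1 != i0 by apply: contra ne => /eqP E; apply/eqP/val_inj.
  by rewrite mulr0 oppr0.
have h2 : 12 * m%:R * zone_dirichlet k <= \sum_(i < N) (g1 i + g2 i).
  have -> : \sum_(i < N) (g1 i + g2 i) = \sum_(i < N) (g1 i + g2 i.+1).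
    by rewrite !big_split /= (sum_shift g2)// /g2 ?tz ?tN mul0r.
  have cN : (i0 - 12 * m + 24 * m <= N)%N by move: zl zr; clear; lia.
  have g0 i : 0 <= g1 i + g2 i.+1 by rewrite addr_ge0// mulr_ge0 ?gg.
  apply: le_trans (sum_sub (fun i => g1 i + g2 i.+1) _ _ _ g0 cN).
  rewrite /zone_dirichlet mulr_sumr; apply: ler_sum => i _.
  set q := (i0 - 12 * m + i)%N.
  have tq j' : (i0 <= j' + 12 * m)%N -> (j' <= i0 + 12 * m)%N -> 12 * m%:R <= tent i0 (24 * m) j' :> R.
    move=> c1 c2; have c0 : (12 * m <= 24 * m)%N by rewrite leq_mul2r orbT.
    by have := tent_in i0 (24 * m) (12 * m) j' c0 c1 c2 : _ <= _ :> R; rewrite !natrM; lra.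
  have iq := ltn_ord i.
  have t1 : 12 * m%:R <= tent i0 (24 * m) q :> R.
    by apply: tq; rewrite /q; move: (nat_of_ord i) iq zl; clear; lia.
  have t2 : 12 * m%:R <= tent i0 (24 * m) q.+1 :> R.
    by apply: tq; rewrite /q; move: (nat_of_ord i) iq zl; clear; lia.
  have cg := concave_gap_sym _ _ (X1 k q) (X1 k q.+1).
  have c12 : 0 <= 12 * m%:R :> R by rewrite mulr_ge0.
  apply: (le_trans (ler_wpM2l c12 cg)); rewrite mulrDr /g1 /g2 /=.
  by apply: lerD; apply: ler_wpM2r => //; exact: gg.
have hc := dif_chain_abs (fun i => zone_root k i ^+ 3) (i0 - m) (2 * m) j i0.
have {}hc := hc _ _; move: hc.
have -> : (i0 - m <= j <= i0 - m + 2 * m)%N by move: zl j1 j2; clear; lia.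
have -> : (i0 - m <= i0 <= i0 - m + 2 * m)%N by move: zl; clear; lia.
move=> /(_ isT isT) hc.
have hD : \sum_(l < 2 * m) dif (fun i => zone_root k i ^+ 3) (i0 - m + l) ^+ 2 <= zone_dirichlet k.
  have cN : (11 * m + 2 * m <= 24 * m)%N by clear; lia.
  have := sum_sub (fun l => dif (fun i => zone_root k i ^+ 3) (i0 - 12 * m + l)%N ^+ 2) _ _ _
    (fun=> sqr_ge0 _) cN; apply: le_trans.
  rewrite le_eqVlt; apply/orP; left; apply/eqP; apply: eq_bigr => i _; congr (dif _ _ ^+ 2).
  by move: zl; clear; lia.
have vj0 : 0 <= v k j by have /andP[] := vb k j kK.
have qu : zone_root k j ^+ 3 <= unit_root.
  by rewrite lerXn2r ?nnegrE ?(le_trans ler01 (root8_ge1 _))//; apply: root8_le; [exact: Age|exact: Ale].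
have q1 : 1 <= zone_root k j ^+ 3 by rewrite exprn_ege1.
have kE : kt (zone_root k i0) = 4 / 3 * ((zone_root k i0 ^+ 3) ^+ 2 - 1) by rewrite /kt -exprM.
have mD : m%:R * \sum_(l < 2 * m) dif (fun i => zone_root k i ^+ 3) (i0 - m + l) ^+ 2 <= m%:R * zone_dirichlet k.
  exact: ler_wpM2l.
have D0 : 0 <= m%:R * zone_dirichlet k by rewrite mulr_ge0// zone_dirichlet_ge0.
rewrite natrM -mulrA in hc.
rewrite -mulrA in h2; move: h1 h2; rewrite kE; move: hc mD D0 qu q1.
move: (zone_root k i0 ^+ 3) (zone_root k j ^+ 3) (\sum_(l < 2 * m) _) unit_root => p q S u hc mD D0 qu q1.
move: (\sum_(i < N) _) (\sum_(i < N) _) => S1 S2 h1 h2.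
have u2 : q ^+ 2 <= u ^+ 2 by rewrite ler_sqr ?nnegrE//; lra.
(* The apex loses at most 8/3 p^2, hence at most 16/3 u^2 plus 32/3 times [m] times the energy,
   while the core gains 12 times [m] times the energy. The ratio 12 of core to window leaves at
   least one such multiple. *)
have p2 : p ^+ 2 <= 2 * q ^+ 2 + 2 * (p - q) ^+ 2 by have := sqr_ge0 (p - 2 * q); nra.
have u0 := sqr_ge0 u.
move: (m%:R * S) (m%:R * zone_dirichlet k) (p ^+ 2) (q ^+ 2) (u ^+ 2) ((p - q) ^+ 2) hc mD D0 u2 p2 u0 h1 h2
  => mS mD' p' q' u' d' hc mD D0 u2 p2 u0 h1 h2; lra.
Qed.

(** The quadratic term of the Taylor bound for [F], with increments at most [2 * kap * A Mb],
    weights at most [24 * m] and [N] nodes. *)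
Definition step_error : R := N%:R * (24 * m%:R * ((a 0 + L * Mb) * (2 * kap * A Mb) ^+ 2)).

Lemma zone_mass_step k : (k < K)%N -> (exists2 j, (i0 <= j + m)%N && (j <= i0 + m)%N & v k j <= 1) ->
  zone_mass k + kap * (m%:R * zone_dirichlet k) - (6 * unit_root ^+ 2 * kap + step_error) <= zone_mass k.+1.
Proof.
move=> kK hj; have kK' := ltnW kK; have LM0 : 0 <= a 0 + L * Mb.
  by rewrite addr_ge0 ?(ltW (coef0_gt0 _ _ _ ca))// mulr_ge0 ?(coef_L _ _ _ ca)// (le_trans ler01).
have td := ler_wpM2l kap0 (tent_dirichlet k kK' hj).
have e0 : 0 <= (a 0 + L * Mb) * (2 * kap * A Mb) ^+ 2 by rewrite mulr_ge0// sqr_ge0.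
have hE : zone_mass k + kap * \sum_(i < N) tent i0 (24 * m) i * (zone_root k i ^- 2 * lap (fun j => A (v k j)) i)
   - step_error <= zone_mass k.+1.
  rewrite /zone_mass /step_error -sum_cst mulr_sumr -sumrN -!big_split /=; apply: ler_sum => i _.
  have t0 : 0 <= tent i0 (24 * m) i :> R := tent_ge0 _ _ _.
  have [hout|] := boolP ((i + 24 * m <= i0)%N || (i0 + 24 * m <= i)%N).
    rewrite tent_out// !mul0r mulr0 !add0r oppr_le0 mulr_ge0// mulr_ge0//.
  rewrite negb_or -!ltnNge => /andP[i1 i2].
  have fs := Fstep _ _ (vb k i kK') (vb k.+1 i kK).
  have se := step k i kK i1 i2.
  have d2 : (v k.+1 i - v k i) ^+ 2 <= (2 * kap * A Mb) ^+ 2.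
    have AMb : 0 <= A Mb by apply: Age; rewrite (le_trans ler01).
    rewrite -(real_normK (num_real (v k.+1 i - v k i))) ler_sqr ?nnegrE// ?mulr_ge0//.
    have -> : v k.+1 i - v k i = kap * lap (fun j => A (v k j)) i by rewrite se; ring.
    rewrite normrM ger0_norm// -mulrA mulrCA ler_wpM2l//.
    have bA q : 0 <= A (v k q) <= A Mb by have /andP[? ?] := vb k q kK'; rewrite Age ?Ale.
    have /andP[? ?] := bA i.+1; have /andP[? ?] := bA i; have /andP[? ?] := bA i.-1.
    by rewrite /lap ler_norml; apply/andP; split; lra.
  have := ler_wpM2l t0 fs; rewrite -/(zone_root k i).
  have -> : v k.+1 i - v k i = kap * lap (fun j => A (v k j)) i by rewrite se; ring.
  move: d2; have -> : v k.+1 i - v k i = kap * lap (fun j => A (v k j)) i by rewrite se; ring.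
  move=> /(ler_wpM2l LM0) d2.
  have tl := tent_le i0 (24 * m) i : _ <= _ :> R; rewrite natrM in tl.
  have l1 := ler_wpM2r e0 tl; have l2 := ler_wpM2l t0 d2.
  move: l1 l2; move: (tent i0 (24 * m) i) (zone_root k i ^- 2) (lap _ _) (F (v k i)) (F (v k.+1 i)) ((a 0 + L * Mb) * (2 * kap * A Mb) ^+ 2).
  move=> t z la f f' e l1 l2.
  have -> : t * (z * (kap * la) - (a 0 + L * Mb) * (kap * la) ^+ 2) =
     t * (z * (kap * la)) - t * ((a 0 + L * Mb) * (kap * la) ^+ 2) by ring.
  move: (t * ((a 0 + L * Mb) * (kap * la) ^+ 2)) l2 => y l2; lra.
lra.
Qed.

(** One [n2] stems from the final mass and one from the accumulated step errors; the last term is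
    the apex loss over the whole time. The initial value enters only through its nonnegativity, so
    the bound is free of the initial datum. *)
Lemma zone_budget (n2 T : R) : 0 <= T ->
  (forall k, (k < K)%N -> exists2 j, (i0 <= j + m)%N && (j <= i0 + m)%N & v k j <= 1) ->
  kap * K%:R = n2 * T -> K%:R * step_error <= n2 ->
  \sum_(i < N) tent i0 (24 * m) i * v K i <= n2 ->
  (forall k, (k <= K)%N -> zone_mass k <= n2 * (2 + 6 * unit_root ^+ 2 * T)) /\
  \sum_(k < K) kap * (m%:R * zone_dirichlet k) <= n2 * (2 + 6 * unit_root ^+ 2 * T).
Proof.
move=> T0 hj kK hE hM.
have LM0 : 0 <= a 0 + L * Mb.
  by rewrite addr_ge0 ?(ltW (coef0_gt0 _ _ _ ca))// mulr_ge0 ?(coef_L _ _ _ ca)// (le_trans ler01).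
have e0 : 0 <= step_error.
  apply: mulr_ge0 => //; apply: mulr_ge0; first by rewrite mulr_ge0.
  by apply: mulr_ge0 => //; exact: sqr_ge0.
have c0 : 0 <= 6 * unit_root ^+ 2 * kap + step_error by rewrite addr_ge0// mulr_ge0// mulr_ge0// sqr_ge0.
have [h1 h2] := ascent_bounds zone_mass (fun k => kap * (m%:R * zone_dirichlet k)) _ K c0
  (fun k _ => mulr_ge0 kap0 (mulr_ge0 (ler0n _ _) (zone_dirichlet_ge0 k)))
  (fun k kK => zone_mass_step k kK (hj k kK)).
have cE : K%:R * (6 * unit_root ^+ 2 * kap + step_error) <= n2 * (1 + 6 * unit_root ^+ 2 * T).
  have -> : K%:R * (6 * unit_root ^+ 2 * kap + step_error) = 6 * unit_root ^+ 2 * (kap * K%:R) + K%:R * step_error by ring.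
  rewrite kK; move: hE; move: (K%:R * step_error) => e; lra.
have mK : zone_mass K <= n2.
  apply: le_trans hM; apply: ler_sum => i _; apply: ler_wpM2l; first exact: tent_ge0.
  by have /andP[vi _] := vb K i (leqnn K); have /andP[] := Fb _ vi.
have m00 : 0 <= zone_mass 0.
  apply: sumr_ge0 => i _; apply: mulr_ge0; first exact: tent_ge0.
  have /andP[vi _] := vb 0 i (leq0n K); have /andP[h _] := Fb _ vi; apply: le_trans h.
  by rewrite mulr_ge0// invr_ge0 sqr_ge0.
by split=> [k kK'|]; [have := h1 k kK'; lra|lra].
Qed.

(** The splitting 1 + A = X^6 X^2, where X is the eighth root: X^6 is bounded uniformly on the core
    by [core_root], and X^2 is summed by means of [truncation_growth] and the mass of [F], the tent
    being at least [12 * m] on the core. *)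
Lemma core_sum k (M : R) : (k <= K)%N ->
  (exists2 j, (i0 <= j + m)%N && (j <= i0 + m)%N & v k j <= 1) -> zone_mass k <= M ->
  \sum_(j < 24 * m + 1) A (v k (i0 - 12 * m + j)%N) <=
  (2 * unit_root ^+ 2 + 48 * (m%:R * zone_dirichlet k)) *
  ((1 + a 0 + L) * ((24 * m + 1)%:R + M / (12 * m%:R))).
Proof.
move=> kK [j /andP[j1 j2] vj] hM.
have mp : 0 < 12 * m%:R :> R by rewrite mulr_gt0// ltr0n.
have C0 : 0 <= 1 + a 0 + L by rewrite !addr_ge0 ?(ltW (coef0_gt0 _ _ _ ca)) ?(coef_L _ _ _ ca).
have cN : (i0 - 12 * m + (24 * m + 1) <= N)%N by move: zl zr m0; clear; lia.
have F0' r : 0 <= r -> 0 <= F r.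
  by move=> r0; have /andP[h _] := Fb _ r0; apply: le_trans h; rewrite mulr_ge0// invr_ge0 sqr_ge0.
have vk i : 0 <= v k i by have /andP[] := vb k i kK.
have hF : \sum_(j < 24 * m + 1) F (v k (i0 - 12 * m + j)%N) <= M / (12 * m%:R).
  rewrite ler_pdivlMr// mulrC; apply: le_trans hM; rewrite mulr_sumr.
  have g0 i : 0 <= tent i0 (24 * m) i * F (v k i) by rewrite mulr_ge0 ?tent_ge0 ?F0'.
  apply: le_trans (sum_sub (fun i => tent i0 (24 * m) i * F (v k i)) _ _ _ g0 cN).
  apply: ler_sum => i _; apply: ler_wpM2r; first exact: F0'.
  have c0 : (12 * m <= 24 * m)%N by rewrite leq_mul2r orbT.
  have iq := ltn_ord i.
  have c1 : (i0 <= i0 - 12 * m + i + 12 * m)%N by move: (nat_of_ord i) iq zl; clear; lia.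
  have c2 : (i0 - 12 * m + i <= i0 + 12 * m)%N by move: (nat_of_ord i) iq zl; clear; lia.
  by have := tent_in i0 (24 * m) (12 * m) _ c0 c1 c2 : _ <= _ :> R; rewrite !natrM; lra.
have D0 : 0 <= m%:R * zone_dirichlet k by rewrite mulr_ge0// zone_dirichlet_ge0.
set Q := 2 * unit_root ^+ 2 + 48 * (m%:R * zone_dirichlet k).
have q0 : 0 <= Q by rewrite addr_ge0// mulr_ge0// sqr_ge0.
apply: (@le_trans _ _ (Q *
   ((1 + a 0 + L) * ((24 * m + 1)%:R + \sum_(j < 24 * m + 1) F (v k (i0 - 12 * m + j)%N))))); last first.
  by apply: ler_wpM2l => //; apply: ler_wpM2l => //; rewrite lerD2l.
have -> : (24 * m + 1)%:R = \sum_(j < 24 * m + 1) 1 :> R by rewrite sum_cst mulr1.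
rewrite -big_split /= !mulr_sumr; apply: ler_sum => i _.
set q := (i0 - 12 * m + i)%N; have iq := ltn_ord i.
have c1 : (i0 <= q + 12 * m)%N by rewrite /q; move: (nat_of_ord i) iq zl; clear; lia.
have c2 : (q <= i0 + 12 * m)%N by rewrite /q; move: (nat_of_ord i) iq zl; clear; lia.
have d1 : (i0 <= j + 12 * m)%N by move: j1; clear; lia.
have d2 : (j <= i0 + 12 * m)%N by move: j2; clear; lia.
have := core_root k j q kK _ vj _; rewrite d1 d2 c1 c2 => /(_ isT isT) h6.
have /andP[hg _] := Fb _ (vk q).
have h2 := truncation_growth _ _ _ _ ca A0 dA F _ (vk q) hg.
apply: (@le_trans _ _ (zone_root k q ^+ 8)); first by rewrite X8// lerDr.
have -> : zone_root k q ^+ 8 = zone_root k q ^+ 6 * zone_root k q ^+ 2 by rewrite -exprD.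
apply: ler_pM => //.
- by rewrite exprn_ge0// (le_trans ler01).
- exact: sqr_ge0.
by move: h6; rewrite /Q mulrA.
Qed.

End Zone.

(** * Time-integrated flux at one point of a zone *)

Section ZoneFlux.
Context {R : realType}.
Variables (a A : R -> R) (a0 L : R).
Hypothesis ca : coefficient a a0 L.
Hypothesis A0 : A 0 = 0.
Hypothesis dA : forall x : R, is_derive x (1 : R) A (a x).

(** [eps] and [C] precede the mesh, the bound [Mb] and the solution; [r1] keeps the width of the
    zone from shrinking with the mesh. What depends on [Mb] is a smallness condition on the time
    step. *)
Lemma zone_flux (T r1 : R) : 0 < T -> 0 < r1 -> exists eps C : R, [/\ 0 < eps, 0 <= C &
  forall (N K m i0 : nat) (n tau Mb : R) (v : nat -> nat -> R),
  (0 < m)%N -> (24 * m <= i0)%N -> (i0 + 24 * m <= N)%N -> 0 < n -> r1 * n <= m%:R ->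
  0 < tau -> K%:R * tau = T -> 1 <= Mb ->
  (forall k i, (k <= K)%N -> 0 <= v k i <= Mb) ->
  (forall k, v k 0%N = 0) -> (forall k, v k N = 0) ->
  (forall r s, 0 <= r -> r <= s -> s <= Mb -> 2 * (tau * n ^+ 2) * (A s - A r) <= s - r) ->
  (forall k i, (k < K)%N -> (i0 < i + 24 * m)%N -> (i < i0 + 24 * m)%N ->
    v k.+1 i = v k i + tau * n ^+ 2 * lap (fun j => A (v k j)) i) ->
  tau * n ^+ 2 * (6 * (a 0 + L)) <= 1 ->
  tau * n ^+ 2 * (96 * T * N%:R ^+ 2 * ((a 0 + L * Mb) * A Mb ^+ 2)) <= 1 ->
  \sum_(i < N) tent i0 (24 * m) i * v K i <= eps * n ^+ 2 ->
  exists i, [/\ (i0 <= i + 12 * m)%N, (i <= i0 + 12 * m)%N & \sum_(k < K) tau * A (v k i) <= C]].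
Proof.
move=> T0 r0; have [F [F0 Fb Fst]] := truncation _ _ _ _ ca A0 dA.
have a00 := coef0_gt0 _ _ _ ca; have L0 := coef_L _ _ _ ca.
(* The exponent of [window_mass] is 6 (a 0 + L) kap K / m^2 with kap K = n^2 T and m >= r1 n, so it
   is bounded independently of the mesh. *)
pose E1 := expR (6 * (a 0 + L) * T / r1 ^+ 2).
have E1p : 0 < E1 := expR_gt0 _.
pose B := 2 + 6 * unit_root A ^+ 2 * T.
have B0 : 0 <= B by rewrite addr_ge0// mulr_ge0 ?(ltW T0)// mulr_ge0// sqr_ge0.
(* [core_sum] summed over time; 25 comes from [24 * m + 1 <= 25 * m]. *)
pose C := (2 * unit_root A ^+ 2 * T + 48 * B) * ((1 + a 0 + L) * (25 + B / (12 * r1 ^+ 2))).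
have G0 : 0 <= (1 + a 0 + L) * (25 + B / (12 * r1 ^+ 2)).
  apply: mulr_ge0; first by rewrite !addr_ge0// ltW.
  by rewrite addr_ge0// divr_ge0// mulr_ge0// sqr_ge0.
have C0 : 0 <= C.
  by apply: mulr_ge0 => //; rewrite addr_ge0// mulr_ge0// ?(ltW T0)// mulr_ge0// sqr_ge0.
(* The bound 1 caps the final mass by [n ^+ 2]; the other makes [window_node] applicable at every
   time. *)
exists (Num.min 1 (r1 ^+ 2 / E1)), C; split=> //.
  by rewrite lt_min ltr01 divr_gt0// exprn_gt0.
move=> N K m i0 n tau Mb v m0 zl zr n0 rm tau0 KT Mb1 vb v0 vN cfl step s1 s2 hM.
have mp : 0 < m%:R :> R by rewrite ltr0n.
set kap := tau * n ^+ 2.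
have kap0 : 0 <= kap by rewrite mulr_ge0 ?(ltW tau0)// sqr_ge0.
have n2 : 0 < n ^+ 2 by rewrite exprn_gt0.
have kK : kap * K%:R = n ^+ 2 * T by rewrite -KT /kap; ring.
have r1m : r1 ^+ 2 * n ^+ 2 <= m%:R ^+ 2.
  by rewrite -exprMn ler_sqr ?nnegrE ?(ltW mp)// mulr_ge0// ltW.
have mN : m%:R <= N%:R :> R by rewrite ler_nat; move: zr; clear; lia.
have h2m : 12 * (a 0 + L) / (2 * m)%:R ^+ 2 = 3 * (a 0 + L) / m%:R ^+ 2 :> R.
  by rewrite natrM; field; exact: lt0r_neq0.
have m1 : 1 <= m%:R ^+ 2 :> R by rewrite exprn_ege1// ler1n.
have xh : kap * (12 * (a 0 + L) / (2 * m)%:R ^+ 2) <= 1 / 2.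
  rewrite h2m mulrA ler_pdivrMr; last by rewrite exprn_gt0.
  by rewrite -/kap in s1; lra.
have aL : 0 <= a 0 + L by rewrite addr_ge0// ltW.
have expE : expR (2 * (kap * (12 * (a 0 + L) / (2 * m)%:R ^+ 2)) * K%:R) <= E1.
  rewrite ler_expR h2m.
  have -> : 2 * (kap * (3 * (a 0 + L) / m%:R ^+ 2)) * K%:R = 6 * (a 0 + L) * (kap * K%:R) / m%:R ^+ 2 :> R by ring.
  rewrite kK ler_pdivrMr ?exprn_gt0// [leRHS]mulrAC ler_pdivlMr ?exprn_gt0//.
  have -> : 6 * (a 0 + L) * (n ^+ 2 * T) * r1 ^+ 2 = 6 * (a 0 + L) * T * (r1 ^+ 2 * n ^+ 2) by ring.
  by apply: ler_wpM2l => //; rewrite mulr_ge0 ?(ltW T0)// mulr_ge0.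
have win k : (k <= K)%N -> exists2 j, (i0 <= j + m)%N && (j <= i0 + m)%N & v k j <= 1.
  move=> kK'; apply: (window_node _ _ _ _ ca A0 dA N K m i0 kap Mb v m0 zl zr kap0 Mb1 vb v0 vN cfl step k _ kK' xh hM).
  have e2 : Num.min 1 (r1 ^+ 2 / E1) * n ^+ 2 <= r1 ^+ 2 / E1 * n ^+ 2.
    by rewrite ler_wpM2r ?(ltW n2)// ge_min lexx orbT.
  apply: (@le_lt_trans _ _ (E1 * (r1 ^+ 2 / E1 * n ^+ 2))).
    apply: ler_pM; [exact: expR_ge0| |exact: expE|exact: e2].
    by rewrite mulr_ge0 ?(ltW n2)// le_min ler01 divr_ge0 ?sqr_ge0// ltW.
  have -> : E1 * (r1 ^+ 2 / E1 * n ^+ 2) = r1 ^+ 2 * n ^+ 2 by field; exact: lt0r_neq0.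
  by move: m1 r1m; lra.
have AMb : 0 <= A Mb by apply: (prim_ge0 _ _ _ _ ca A0 dA); rewrite (le_trans ler01).
have errb : K%:R * step_error a A L N m kap Mb <= n ^+ 2.
  rewrite /step_error.
  have -> : K%:R * (N%:R * (24 * m%:R * ((a 0 + L * Mb) * (2 * kap * A Mb) ^+ 2))) =
    (kap * K%:R) * (kap * (96 * (N%:R * m%:R) * ((a 0 + L * Mb) * A Mb ^+ 2))) by ring.
  rewrite kK -mulrA ler_piMr ?(ltW n2)//; apply: le_trans s2; rewrite -/kap mulrCA; apply: ler_wpM2l => //.
  have -> : T * (96 * (N%:R * m%:R) * ((a 0 + L * Mb) * A Mb ^+ 2)) = 96 * T * (N%:R * m%:R) * ((a 0 + L * Mb) * A Mb ^+ 2) by ring.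
  apply: ler_wpM2r.
    by rewrite mulr_ge0 ?sqr_ge0// addr_ge0 ?(ltW a00)// mulr_ge0// (le_trans ler01).
  apply: ler_wpM2l; first by rewrite mulr_ge0// ltW.
  by rewrite expr2 ler_wpM2l.
have hM' : \sum_(i < N) tent i0 (24 * m) i * v K i <= n ^+ 2.
  by apply: (le_trans hM); rewrite ler_piMl ?(ltW n2)// ge_min lexx.
have [b1 b2] := zone_budget _ _ _ _ ca A0 dA N K m i0 kap Mb v m0 zl zr kap0 Mb1 vb v0 vN step F Fb
  (Fst Mb) (n ^+ 2) T (ltW T0) (fun k kK => win k (ltnW kK)) kK errb hM'.
rewrite -/B in b1 b2.
have cs k : (k < K)%N -> \sum_(j < 24 * m + 1) tau * A (v k (i0 - 12 * m + j)%N) <=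
    (tau * (2 * unit_root A ^+ 2) + 48 * (tau * (m%:R * zone_dirichlet A m i0 v k))) *
    (m%:R * ((1 + a 0 + L) * (25 + B / (12 * r1 ^+ 2)))).
  move=> kK'; have := core_sum _ _ _ _ ca A0 dA N K m i0 Mb v m0 zl zr vb F Fb k _ (ltnW kK') (win k (ltnW kK')) (b1 k (ltnW kK')).
  move=> /(ler_wpM2l (ltW tau0)); rewrite mulr_sumr => /le_trans; apply.
  have E X : tau * ((2 * unit_root A ^+ 2 + 48 * (m%:R * zone_dirichlet A m i0 v k)) * X) =
    (tau * (2 * unit_root A ^+ 2) + 48 * (tau * (m%:R * zone_dirichlet A m i0 v k))) * X by ring.
  rewrite E.
  apply: ler_wpM2l.
    apply: addr_ge0.
      by apply: mulr_ge0; [exact: ltW|apply: mulr_ge0 => //; exact: sqr_ge0].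
    by do 3?[apply: mulr_ge0; rewrite ?(ltW tau0)//]; exact: zone_dirichlet_ge0.
  rewrite [leRHS]mulrCA; apply: ler_wpM2l; first by rewrite !addr_ge0// ltW.
  rewrite [leRHS]mulrDr; apply: lerD; first by rewrite natrD natrM; have : 1 <= m%:R :> R by [rewrite ler1n]; lra.
  rewrite ler_pdivrMr ?mulr_gt0//.
  have -> : m%:R * (B / (12 * r1 ^+ 2)) * (12 * m%:R) = m%:R ^+ 2 * B / r1 ^+ 2 by field; exact: lt0r_neq0.
  rewrite ler_pdivlMr ?exprn_gt0//.
  have -> : n ^+ 2 * B * r1 ^+ 2 = r1 ^+ 2 * n ^+ 2 * B by ring.
  exact: ler_wpM2r.
have tot : \sum_(j < 24 * m + 1) (\sum_(k < K) tau * A (v k (i0 - 12 * m + j)%N)) <= m%:R * C.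
  rewrite exchange_big /=; apply: (@le_trans _ _ (\sum_(k < K)
    (tau * (2 * unit_root A ^+ 2) + 48 * (tau * (m%:R * zone_dirichlet A m i0 v k))) *
    (m%:R * ((1 + a 0 + L) * (25 + B / (12 * r1 ^+ 2)))))).
    by apply: ler_sum => k _; exact: cs.
  rewrite -mulr_suml big_split /= sum_cst -mulr_sumr.
  rewrite /C [leRHS]mulrCA; apply: ler_wpM2r; first by rewrite mulr_ge0.
  rewrite mulrA KT mulrC lerD2l ler_pM2l//.
  rewrite -(ler_pM2l n2); apply: le_trans b2; rewrite mulr_sumr le_eqVlt; apply/orP; left; apply/eqP.
  by apply: eq_bigr => k _; rewrite /kap; ring.
have tot' : \sum_(j < 24 * m + 1) (\sum_(k < K) tau * A (v k (i0 - 12 * m + j)%N)) <= (24 * m + 1)%:R * C.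
  apply: (le_trans tot); apply: ler_wpM2r => //; rewrite ler_nat; clear; lia.
have M1 : (0 < 24 * m + 1)%N by rewrite addn1.
(* Only the average over the core is controlled, so the point depends on the solution; it only has
   to stay within the core. *)
have [j jM hj] := pigeonhole_le (fun j => \sum_(k < K) tau * A (v k (i0 - 12 * m + j)%N)) _ _ M1 tot'.
exists (i0 - 12 * m + j)%N; split=> //; move: jM zl; clear; lia.
Qed.

End ZoneFlux.

(** * The trapezoid test and the explicit Euler scheme *)

Section Trapezoid.
Context {R : realType}.

Definition trap (iL iR i : nat) : R := pospart (Num.min (i%:R - iL%:R) (iR%:R - i%:R)).

Lemma trap_ge0 iL iR i : 0 <= trap iL iR i.
Proof. by rewrite /trap /pospart le_max lexx. Qed.

Lemma trap_out iL iR i : (i <= iL)%N || (iR <= i)%N -> trap iL iR i = 0.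
Proof. by move=> h; rewrite /trap pospart_le// ge_min !subr_le0 !ler_nat. Qed.

Lemma trap_in iL iR i : (iL <= i)%N -> (i <= iR)%N ->
  trap iL iR i = Num.min (i%:R - iL%:R) (iR%:R - i%:R).
Proof. by move=> h1 h2; rewrite /trap pospart_ge// le_min !subr_ge0 !ler_nat h1. Qed.

Let min_cases (x y : R) : (x <= y /\ Num.min x y = x) \/ (y <= x /\ Num.min x y = y).
Proof. by have [h|/ltW h] := leP x y; [left|right]. Qed.

Lemma trap_lip iL iR i : `|dif (trap iL iR) i| <= 1.
Proof.
rewrite /dif /trap; have n1 : i.+1%:R = i%:R + 1 :> R by rewrite -natr1.
apply: (le_trans (pospart_lip _ _)); rewrite n1; move: (i%:R : R) => x; rewrite ler_norml.
by have [[? ->]|[? ->]] := min_cases (x + 1 - iL%:R) (iR%:R - (x + 1));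
 have [[? ->]|[? ->]] := min_cases (x - iL%:R) (iR%:R - x); apply/andP; split; lra.
Qed.

(** Between its feet the trapezoid is a minimum of affine functions, hence concave; only at a foot
    can the slope increase, and by at most 1. *)
Lemma lap_trap iL iR i : (0 < i)%N -> (iL < iR)%N ->
  lap (trap iL iR) i <= (i == iL)%:R + (i == iR)%:R.
Proof.
case: i => // i _ LR; rewrite /lap /=.
have n1 : i.+1%:R = i%:R + 1 :> R by rewrite -natr1.
have n2 : i.+2%:R = i%:R + 1 + 1 :> R by rewrite -natr1 n1.
have lip0 p q : `|trap iL iR q - trap iL iR p| <= 1 -> trap iL iR p = 0 -> trap iL iR q <= 1.
  by move=> h p0; move: h; rewrite p0 subr0; apply: le_trans; exact: ler_norm.
have l1 := trap_lip iL iR i; have l2 := trap_lip iL iR i.+1; rewrite /dif in l1 l2.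
have [lt|gt|E] := ltngtP i.+1 iL.
- by rewrite !trap_out ?lt ?(ltnW lt) ?(ltnW (ltnW lt))// mulr0 subrr add0r addr_ge0.
- have [lt'|gt'|E] := ltngtP i.+1 iR.
  + rewrite !trap_in//; try by move: gt lt'; clear; lia.
    rewrite n1 n2 /= !mulr0n; move: (i%:R : R) => x; rewrite addr0.
    have [[? ->]|[? ->]] := min_cases (x + 1 + 1 - iL%:R) (iR%:R - (x + 1 + 1));
    have [[? ->]|[? ->]] := min_cases (x + 1 - iL%:R) (iR%:R - (x + 1));
    have [[? ->]|[? ->]] := min_cases (x - iL%:R) (iR%:R - x); lra.
  + by rewrite !trap_out ?mulr0 ?subrr ?add0r//; apply/orP; right; move: gt'; clear; lia.
  + have z1 : trap iL iR i.+1 = 0 by rewrite trap_out// E leqnn orbT.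
    have z2 : trap iL iR i.+2 = 0 by rewrite trap_out// -E leqnSn orbT.
    rewrite distrC in l1; have := lip0 _ _ l1 z1; rewrite z1 z2 /= mulr0n mulr1n; lra.
- have -> : i.+1 == iR = false by apply/negbTE; rewrite E neq_ltn LR.
  have z1 : trap iL iR i.+1 = 0 by rewrite trap_out// E leqnn.
  have z2 : trap iL iR i = 0 by rewrite trap_out// -E leqnSn.
  have := lip0 _ _ l2 z1; rewrite z1 z2 /= mulr0n mulr1n; lra.
Qed.

(** After summation by parts the concave part of the trapezoid meets the nonnegative [c] with the
    good sign, and only the values of [c] at the two feet remain. *)
Lemma trap_flux (N K iL iR : nat) (kap : R) (v c : nat -> nat -> R) :
  (iL < iR)%N -> (iR < N)%N -> 0 <= kap -> (forall k, c k 0%N = 0) -> (forall k, c k N = 0) ->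
  (forall k i, (k < K)%N -> 0 <= c k i) ->
  (forall k i, (k < K)%N -> (iL < i)%N -> (i < iR)%N -> v k.+1 i = v k i + kap * lap (c k) i) ->
  \sum_(i < N) trap iL iR i * v K i <= \sum_(i < N) trap iL iR i * v 0%N i
    + \sum_(k < K) kap * (c k iL + c k iR).
Proof.
move=> LR RN kap0 cz cN c0; elim: K c0 => [|K IH] c0 step; first by rewrite big_ord0 addr0.
have {}IH := IH (fun k i kK => c0 k i (ltnW kK)) (fun k i kK => step k i (ltnW kK)).
rewrite big_ord_recr /= addrA; apply: le_trans (lerD IH (lexx _)).
have -> : \sum_(i < N) trap iL iR i * v K.+1 i =
   \sum_(i < N) trap iL iR i * v K i + kap * \sum_(i < N) lap (c K) i * trap iL iR i.
  rewrite mulr_sumr -big_split; apply: eq_bigr => i _ /=.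
  have [hout|] := boolP ((i <= iL)%N || (iR <= i)%N); first by rewrite trap_out// !mul0r !mulr0 addr0.
  by rewrite negb_or -!ltnNge => /andP[h1 h2]; rewrite step//; ring.
rewrite lerD2l ler_wpM2l// lap_sym//; last 2 first.
- by rewrite trap_out.
- by rewrite trap_out// (ltnW RN) orbT.
have cK := c0 K _ (ltnSn K).
apply: (@le_trans _ _ (\sum_(i < N) (c K i * (i == iL :> nat)%:R + c K i * (i == iR :> nat)%:R))).
  apply: ler_sum => -[[|i] iN] _ /=; first by rewrite cz !mul0r addr0.
  by rewrite -mulrDr ler_wpM2l// lap_trap.
have pick (j : nat) : (j < N)%N -> \sum_(i < N) c K i * (i == j :> nat)%:R = c K j.
  move=> jN; rewrite (bigD1 (Ordinal jN))//= eqxx mulr1 big1 ?addr0// => i ne.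
  have /negbTE -> : (i : nat) != j by apply: contra ne => /eqP E; apply/eqP/val_inj.
  by rewrite mulr0.
by rewrite big_split /= !pick// (ltn_trans LR).
Qed.

End Trapezoid.

(** * Maximum principle and error of the explicit scheme *)

Section Euler.
Context {R : realType}.
Variables (a A : R -> R) (a0 L : R).
Hypothesis ca : coefficient a a0 L.
Hypothesis A0 : A 0 = 0.
Hypothesis dA : forall x : R, is_derive x (1 : R) A (a x).
Variables (N : nat) (kap tau : R) (u : nat -> nat -> R) (Y0 : nat -> R).

Fixpoint euler (k i : nat) : R :=
  if (0 < i)%N && (i < N)%N then
    match k with
    | 0 => Y0 i
    | k'.+1 => euler k' i + kap * (A (euler k' i.+1) - 2 * A (euler k' i) + A (euler k' i.-1))
                + tau * (u k' i * euler k' i)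
    end
  else 0.

Lemma euler_step k i : (0 < i)%N -> (i < N)%N ->
  euler k.+1 i = euler k i + kap * lap (fun j => A (euler k j)) i + tau * (u k i * euler k i).
Proof. by move=> i0 iN /=; rewrite i0 iN. Qed.

Lemma euler_out k i : ~~ ((0 < i)%N && (i < N)%N) -> euler k i = 0.
Proof. by case: k => [|k] /negbTE /= ->. Qed.

Lemma prim_cfl (Mb c : R) r s : 0 <= c -> c * (a 0 + L * Mb) <= 1 -> 0 <= r -> r <= s -> s <= Mb ->
  c * (A s - A r) <= s - r.
Proof.
move=> c0 h r0 rs sM; have sr : 0 <= s - r by rewrite subr_ge0.
have ns : `|s| <= Mb by rewrite ger0_norm// (le_trans r0).
have nr : `|r| <= Mb by rewrite ger0_norm// (le_trans rs).
have := prim_lip _ _ _ _ ca dA Mb _ _ ns nr => /(le_trans (ler_norm _)).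
rewrite (ger0_norm sr) => /(ler_wpM2l c0) /le_trans; apply.
by rewrite mulrA ler_piMl.
Qed.

Variables (K : nat) (U M0 Mb : R).
Hypotheses (kap0 : 0 <= kap) (tau0 : 0 <= tau) (U0 : 0 <= U) (M00 : 0 <= M0).
Hypothesis Y0b : forall i, (0 < i)%N -> (i < N)%N -> 0 <= Y0 i <= M0.
Hypothesis ub : forall k i, (k < K)%N -> (0 < i)%N -> (i < N)%N -> `|u k i| <= U.
Hypothesis Mbb : expR (U * (K%:R * tau)) * M0 <= Mb.
Hypothesis small : 4 * kap * (a 0 + L * Mb) <= 1.
Hypothesis tauU : 2 * (tau * U) <= 1.

(** Discrete maximum principle. The factor 4 in [small] lets diffusion consume at most half of the
    value at a node, and [tauU] lets the source consume at most the other half, which keeps the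
    scheme nonnegative. *)
Lemma euler_bound k i : (k <= K)%N -> 0 <= euler k i <= Mb.
Proof.
have tU : 0 <= tau * U by rewrite mulr_ge0.
have gr j : (j <= K)%N -> (1 + tau * U) ^+ j * M0 <= Mb.
  move=> jK; apply: le_trans Mbb; apply: ler_wpM2r => //.
  apply: (@le_trans _ _ (expR (tau * U) ^+ j)).
    by apply: lerXn2r; rewrite ?nnegrE ?expR_ge0 ?addr_ge0// expR_ge1Dx.
  rewrite -expRM_natl ler_expR.
  have -> : U * (K%:R * tau) = K%:R * (tau * U) by ring.
  by apply: ler_wpM2r => //; rewrite ler_nat.
suff H j : (j <= K)%N -> forall i, 0 <= euler j i <= (1 + tau * U) ^+ j * M0.
  by move=> kK; have /andP[-> h] := H k kK i; exact: le_trans (gr k kK).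
elim: j => [_ l|j IH jK l].
  have [/andP[h1 h2]|h] := boolP ((0 < l)%N && (l < N)%N); last by rewrite euler_out// lexx expr0 mul1r.
  by rewrite /= h1 h2 /= expr0 mul1r Y0b.
have {}IH := IH (ltnW jK); have B0 : 0 <= (1 + tau * U) ^+ j * M0.
  by rewrite mulr_ge0// exprn_ge0// addr_ge0.
have [/andP[h1 h2]|h] := boolP ((0 < l)%N && (l < N)%N); last first.
  by rewrite euler_out// lexx/= mulr_ge0// exprn_ge0// addr_ge0.
rewrite euler_step// exprS -mulrA /lap; have gj := gr j (ltnW jK).
have := ub j l jK h1 h2; rewrite ler_norml => /andP[u1 u2].
have /andP[x0 x1] := IH l.+1; have /andP[y0 y1] := IH l; have /andP[z0 z1] := IH l.-1.
move: gj x0 x1 y0 y1 z0 z1 B0 u1 u2; move: (euler j l.+1) (euler j l) (euler j l.-1) ((1 + tau * U) ^+ j * M0) (u j l).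
move=> x y z B uu BM x0 x1 y0 y1 z0 z1 B0 u1 u2.
have k4 : 0 <= 4 * kap by rewrite mulr_ge0.
have c1 := prim_cfl Mb (4 * kap) _ _ k4 small (lexx 0) y0 (le_trans y1 BM).
have c2 := prim_cfl Mb (4 * kap) _ _ k4 small y0 y1 BM.
have Ax := ler_wpM2l kap0 (prim_ge0 _ _ _ _ ca A0 dA _ x0).
have Az := ler_wpM2l kap0 (prim_ge0 _ _ _ _ ca A0 dA _ z0).
have AxB := ler_wpM2l kap0 (prim_le _ _ _ _ ca dA _ _ x1).
have AzB := ler_wpM2l kap0 (prim_le _ _ _ _ ca dA _ _ z1).
have ly := ler_wpM2r y0 u1; have uy := ler_wpM2r y0 u2.
have tly := ler_wpM2l tau0 ly; have tuy := ler_wpM2l tau0 uy.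
have tUy := ler_wpM2r y0 tauU; have tUB := ler_wpM2l tU y1.
rewrite A0 in c1.
have s0 : 0 <= 4 * kap * (A B - A y) by rewrite mulr_ge0// subr_ge0 (prim_le _ _ _ _ ca dA).
apply/andP; split; lra.
Qed.

Lemma euler_increment k i : (k < K)%N -> `|euler k.+1 i - euler k i| <= kap * (2 * A Mb) + tau * (U * Mb).
Proof.
move=> kK; have /andP[x0 x1] := euler_bound k i.+1 (ltnW kK).
have /andP[y0 y1] := euler_bound k i (ltnW kK); have /andP[z0 z1] := euler_bound k i.-1 (ltnW kK).
have Mb0 : 0 <= Mb := le_trans y0 y1.
have AM : 0 <= A Mb := prim_ge0 _ _ _ _ ca A0 dA _ Mb0.
have [/andP[h1 h2]|h] := boolP ((0 < i)%N && (i < N)%N); last first.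
  by rewrite !euler_out// subrr normr0 addr_ge0// mulr_ge0// mulr_ge0.
rewrite euler_step//; have -> : forall p q r : R, p + q + r - p = q + r by move=> *; ring.
apply: (le_trans (ler_normD _ _)); rewrite !normrM !(ger0_norm kap0) (ger0_norm tau0).
apply: lerD; apply: ler_wpM2l => //.
  have bA q : 0 <= q -> q <= Mb -> 0 <= A q <= A Mb.
    by move=> ? ?; rewrite (prim_ge0 _ _ _ _ ca A0 dA)// (prim_le _ _ _ _ ca dA).
  have /andP[? ?] := bA _ x0 x1; have /andP[? ?] := bA _ y0 y1; have /andP[? ?] := bA _ z0 z1.
  by rewrite /lap ler_norml; apply/andP; split; lra.
by rewrite (ger0_norm y0); apply: ler_pM => //; exact: ub.
Qed.

(** [Y] stands for the node averages of the weak solution. They solve the scheme up to a flux error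
    [e], which also lives on the two ghost nodes 0 and [N], and a source error [r]; [osc] bounds
    their change over one time step. *)
Variables (Y e r : nat -> nat -> R) (E osc : nat -> R) (n : R).
Hypotheses (N0 : (0 < N)%N) (Nn : N%:R <= n) (kapE : kap = tau * n ^+ 2).
Hypothesis E0 : forall k, 0 <= E k.
Hypothesis YY0 : forall i, (0 < i)%N -> (i < N)%N -> Y 0%N i = Y0 i.
Hypothesis Ystep : forall k i, (k < K)%N -> (0 < i)%N -> (i < N)%N ->
  Y k.+1 i - Y k i = kap * lap (fun j => (if (0 < j)%N && (j < N)%N then A (Y k j) else 0) + e k j) i
     + tau * (u k i * Y k i + r k i).
Hypothesis eE : forall k i, (k < K)%N -> (i <= N)%N -> `|e k i| <= E k.
Hypothesis rE : forall k i, (k < K)%N -> (0 < i)%N -> (i < N)%N -> `|r k i| <= E k.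
Hypothesis Yosc : forall k i, (k < K)%N -> (0 < i)%N -> (i < N)%N -> `|Y k.+1 i - Y k i| <= osc k.

Definition defect k i : R := if (0 < i)%N && (i < N)%N then Y k i - euler k i else 0.
Definition drift : R := kap * (2 * A Mb) + tau * (U * Mb).

(** The scheme starts from the node averages of the initial datum, so the initial defect is zero and
    Gronwall leaves only the consistency errors and the cost of explicit steps. *)
Lemma defect_energy :
  energy (defect K) N / n ^+ 3 <= expR ((2 * U ^+ 2 / a0 + 1) * (K%:R * tau)) *
    \sum_(k < K) ((8 / a0 + 1) * (tau * E k ^+ 2) + (osc k + drift) ^+ 2).
Proof.
have n0 : 0 < n by apply: lt_le_trans Nn; rewrite ltr0n.
have a0p := coef_gt0 _ _ _ ca.
have d0 k : defect k 0 = 0 by [].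
have dN k : defect k N = 0 by rewrite /defect ltnn andbF.
have c0 : 0 <= 2 * U ^+ 2 / a0 + 1 by rewrite addr_ge0// divr_ge0 ?(ltW a0p)// mulr_ge0// sqr_ge0.
have := discrete_gronwall (fun k => energy (defect k) N / n ^+ 3)
  (fun k => (8 / a0 + 1) * (tau * E k ^+ 2) + (osc k + drift) ^+ 2) _ tau K c0 tau0.
have -> : energy (defect 0) N / n ^+ 3 = 0.
  have z : defect 0 =1 fun=> 0.
    by move=> i; rewrite /defect; case: ifP => // h; move: (h) => /andP[h1 h2]; rewrite YY0// /= h subrr.
  have g0 i : green (defect 0) N i = 0.
    have p l : psum (defect 0) l = 0 by rewrite /psum big1.
    by rewrite /green !big1 ?oppr0 ?mulr0 ?addr0.
  by rewrite /energy big1 ?mul0r// => i _; rewrite /dif !g0 subrr expr0n.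
rewrite add0r; apply=> [k kK|k|k kK].
- apply: addr_ge0; last exact: sqr_ge0.
  apply: mulr_ge0; first by rewrite addr_ge0// divr_ge0// ltW.
  by apply: mulr_ge0 => //; exact: sqr_ge0.
- by rewrite divr_ge0 ?energy_ge0// exprn_ge0// ltW.
pose w i := if (0 < i)%N && (i < N)%N then A (Y k i) - A (euler k i) else 0.
rewrite addrA; apply: (energy_step N (defect k) (defect k.+1) w (e k)
  (fun i => u k i * defect k i + r k i) tau n a0 U (E k) (osc k + drift)) => //.
- by rewrite /w ltnn andbF.
- move=> i i0 iN; rewrite /defect i0 iN.
  have -> : Y k.+1 i - euler k.+1 i - (Y k i - euler k i) = (Y k.+1 i - Y k i) - (euler k.+1 i - euler k i) by ring.
  rewrite Ystep// euler_step// -kapE.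
  have lw : lap (fun j => w j + e k j) i = lap (fun j => (if (0 < j)%N && (j < N)%N then A (Y k j) else 0) + e k j) i
     - lap (fun j => A (euler k j)) i.
    have wE j : w j = (if (0 < j)%N && (j < N)%N then A (Y k j) else 0) - A (euler k j).
      by rewrite /w; case: ifP => // h; rewrite euler_out ?h// A0 subrr.
    rewrite /lap !wE; ring.
  by rewrite lw /=; ring.
- move=> i i0 iN; rewrite /w /defect i0 iN /=; exact: (prim_monotone _ _ _ _ ca dA).
- by move=> i iN; exact: eE.
- move=> i i0 iN; apply: (le_trans (ler_normD _ _)); rewrite normrM; apply: lerD; last exact: rE.
  by apply: ler_wpM2r => //; exact: ub.
- move=> i i0 iN; rewrite /defect i0 iN /=.
  have -> : Y k.+1 i - euler k.+1 i - (Y k i - euler k i) = (Y k.+1 i - Y k i) - (euler k.+1 i - euler k i) by ring.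
  by apply: (le_trans (ler_normB _ _)); apply: lerD; [exact: Yosc|exact: euler_increment].
Qed.

Lemma defect_pairing (phi : nat -> R) (q : R) : phi 0%N = 0 -> phi N = 0 ->
  (forall i, (i < N)%N -> `|dif phi i| <= 1) -> 0 <= q -> energy (defect K) N / n ^+ 3 <= q ^+ 2 ->
  `|\sum_(i < N) phi i * defect K i| <= n ^+ 2 * q.
Proof.
move=> p0 pN pl q0 hq; have n0 : 0 < n by apply: lt_le_trans Nn; rewrite ltr0n.
have := dual_bound (defect K) phi N 1 N0 _ p0 pN ler01 pl; rewrite expr1n mulr1 => /(_ erefl) h.
have nq : 0 <= n ^+ 2 * q by rewrite mulr_ge0// sqr_ge0.
rewrite -ler_sqr ?nnegrE// (real_normK (num_real _)); apply: (le_trans h).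
move: hq; rewrite ler_pdivrMr ?exprn_gt0// => hq.
have -> : (n ^+ 2 * q) ^+ 2 = q ^+ 2 * n ^+ 3 * n by ring.
by apply: ler_pM => //; exact: energy_ge0.
Qed.

End Euler.

(** * Discretization of a weak solution *)

Section TimeGrid.
Context {R : realType}.
Notation mu := (@lebesgue_measure R).

Lemma rint_oo_sub (f : R -> R) (x y u v : R) : x <= u -> v <= y ->
  rint mu `]x, y[ f -> rint mu `]u, v[ f.
Proof.
move=> xu vy; apply: (@rintS _ _ _ mu _ _ _ (measurable_itv _) (measurable_itv _)).
by move=> t; rewrite /= !in_itv/= => /andP[ut tv]; rewrite (le_lt_trans xu ut) (lt_le_trans tv vy).
Qed.

Lemma sum_grid (f : R -> R) (tau : R) (K : nat) : 0 <= tau ->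
  rint mu `]0, K%:R * tau[ f ->
  \sum_(k < K) \int[mu]_(s in `]k%:R * tau, k.+1%:R * tau[) f s =
  \int[mu]_(s in `]0, K%:R * tau[) f s.
Proof.
move=> t0; elim: K => [|K IH] hf.
  by rewrite big_ord0 mul0r set_itvoo0 Rintegral_set0.
have h1 : 0 <= K%:R * tau by rewrite mulr_ge0.
have h2 : K%:R * tau <= K.+1%:R * tau by rewrite ler_wpM2r// ler_nat.
rewrite big_ord_recr /= IH; last exact: rint_oo_sub hf.
by rewrite [RHS](Rint_split _ _ _ _ h1 h2).
Qed.

Lemma cauchy_schwarz_itv (f : R -> R) (x y : R) : x <= y -> sqint mu `]x, y[ f ->
  (\int[mu]_(s in `]x, y[) f s) ^+ 2 <= (y - x) * \int[mu]_(s in `]x, y[) (f s ^+ 2).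
Proof.
move=> xy hf; have mxy : measurable (`]x, y[ : set (measurableTypeR R)) by exact: measurable_itv.
have ones := sqint_cst mu (1 : R) mxy (mu_itvoo_fin x y).
have := @cauchy_schwarz _ _ _ mu _ _ _ mxy ones hf.
have -> : \int[mu]_(s in `]x, y[) (1 * f s) = \int[mu]_(s in `]x, y[) f s.
  by apply: eq_Rint_in => s _; rewrite mul1r.
have -> : \int[mu]_(s in `]x, y[) (1 ^+ 2 : R) = y - x.
  rewrite expr1n; apply: (eq_trans (@Rintegral_cst _ _ _ mu _ mxy 1)).
  by rewrite mul1r -mu_itvoo.
by [].
Qed.

Lemma cvg_dominated0 (f_ : nat -> R -> R) (g : R -> R) (x y : R) :
  (forall n, measurable_fun `]x, y[ (f_ n)) -> rint mu `]x, y[ g ->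
  (forall s, `]x, y[%classic s -> (fun n => f_ n s) @ \oo --> (0 : R)) ->
  (forall n s, `]x, y[%classic s -> `|f_ n s| <= g s) ->
  (fun n => \int[mu]_(s in `]x, y[) f_ n s) @ \oo --> (0 : R).
Proof.
move=> mf hg h0 hd.
have mxy : measurable (`]x, y[ : set (measurableTypeR R)) by exact: measurable_itv.
have H1 : {ae mu, forall s, `]x, y[%classic s -> (EFin \o f_ n) s @[n --> \oo] --> (cst 0%E : R -> \bar R) s}.
  by apply: nearW => s Ds; apply/fine_cvgP; split; [exact: nearW|exact: h0].
have H2 : {ae mu, forall s n, `]x, y[%classic s -> (`|(EFin \o f_ n) s| <= (EFin \o g) s)%E}.
  by apply: nearW => s n Ds; rewrite lee_fin; exact: hd.
have H3 : forall n, measurable_fun `]x, y[ (EFin \o f_ n) by move=> n; exact/measurable_EFinP.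
have [_ _] := @dominated_convergence _ _ _ mu `]x, y[ mxy (fun n => EFin \o f_ n) (cst 0%E)
  (EFin \o g) H3 (measurable_cst _) H1 hg H2.
by rewrite integral0 => /fine_cvgP[_].
Qed.

End TimeGrid.

(** * Consistency errors on a space-time grid *)

Section Discretization.
Context {R : realType}.
Notation mu := (@lebesgue_measure R).
Notation mu2 := (@lebesgue_measure R \x @lebesgue_measure R)%E.
Notation I01 := (@I01 R).
Variables (a A : R -> R) (a0 L : R).
Hypothesis ca : coefficient a a0 L.
Hypothesis A0 : A 0 = 0.
Hypothesis dA : forall x : R, is_derive x (1 : R) A (a x).
Variables (T : R) (omega : set R) (y yx : R * R -> R).
Hypothesis T0 : 0 < T.
Hypothesis yH : L2H10 T y yx.
Variables (U : R) (w : R * R -> R).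
Hypothesis U0 : 0 <= U.
Hypothesis mw : measurable_fun (QT T : set (measurableTypeR R * measurableTypeR R)) w.
Hypothesis wU : forall p, `|w p| <= U.
Hypothesis wom : forall p, ~ omega p.1 -> w p = 0.
Variable Cy : R.
Hypothesis Cy0 : 0 <= Cy.
Hypothesis yCy : forall t, 0 <= t <= T -> nrm mu I01 (fun x => y (x, t)) <= Cy.

Let N (s : R) := nrm mu I01 (fun x => yx (x, s)).
Let S (s : R) := Num.sqrt (2 * Cy * N s).
(* S bounds the sup norm of y(., s), by |y|^2 <= 2 |y|_2 |y_x|_2, and d its oscillation over three
   cells; the second argument of the minimum makes P dominated by G, which is square integrable in time
   although N ^+ 2 is only integrable. *)
Let d (n : nat) (s : R) := Num.min (Num.sqrt (3 / n%:R) * N s) (2 * S s).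
Let P (n : nat) (s : R) := (a 0 + L * S s + U) * d n s.
Let G (s : R) := (a 0 + L * S s + U) * S s.

Let a00 : 0 <= a 0. Proof. exact/ltW/(coef0_gt0 _ _ _ ca). Qed.
Let L0 : 0 <= L. Proof. exact: coef_L _ _ _ ca. Qed.
Let N0 s : 0 <= N s. Proof. exact: nrm_ge0. Qed.
Let S0 s : 0 <= S s. Proof. exact: sqrtr_ge0. Qed.
Let d0 n s : 0 <= d n s.
Proof. by rewrite /d le_min !mulr_ge0 ?sqrtr_ge0. Qed.
Let c0 s : 0 <= a 0 + L * S s + U.
Proof. by rewrite !addr_ge0// mulr_ge0. Qed.
Let P0 n s : 0 <= P n s. Proof. by rewrite mulr_ge0. Qed.
Let G0 s : 0 <= G s. Proof. by rewrite mulr_ge0. Qed.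

Let mJT : measurable (`]0, T[ : set (measurableTypeR R)). Proof. exact: measurable_itv. Qed.

Lemma N_sqint : sqint mu `]0, T[ N.
Proof.
have [_ i2] := yx_sqint T y yx yH.
have [_ h _] := Rint_prod mu mu I01 `]0, T[ (measurable_I01) mJT _ i2.
have E s : N s ^+ 2 = \int[mu]_(x in I01) (yx (x, s) ^+ 2) by exact: nrm_sqr.
split; last by apply: (@eq_rint _ _ _ mu _ _ _ mJT _ h) => s _; rewrite E.
have -> : N = (@Num.sqrt R) \o (fun s => \int[mu]_(x in I01) (yx (x, s) ^+ 2)) by [].
apply: measurableT_comp; last exact: (rint_meas mu h).
by apply: continuous_measurable_fun; exact: sqrt_continuous.
Qed.

Lemma S_meas : measurable_fun `]0, T[ S.
Proof.
have -> : S = (@Num.sqrt R) \o (fun s => 2 * Cy * N s) by [].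
apply: measurableT_comp; first by apply: continuous_measurable_fun; exact: sqrt_continuous.
by apply: measurable_funM => //; exact: (sqint_meas mu N_sqint).
Qed.

Lemma P_meas n : measurable_fun `]0, T[ (P n).
Proof.
have mS := S_meas; have mN := sqint_meas mu N_sqint.
apply: measurable_funM.
  by apply: measurable_funD => //; apply: measurable_funD => //; exact: measurable_funM.
by apply: measurable_minr; exact: measurable_funM.
Qed.

Lemma G_sqint : sqint mu `]0, T[ G.
Proof.
have mS := S_meas; pose C := a 0 + U + 2 * Cy * (a 0 + U + L).
apply: (@sqint_le _ _ _ mu _ _ (fun s => C * (1 + N s)) mJT).
- apply: measurable_funM => //.
  by apply: measurable_funD => //; apply: measurable_funD => //; exact: measurable_funM.
- apply: (@sqintZ _ _ _ mu _ _ _ mJT); apply: (@sqintD _ _ _ mu _ _ _ mJT); last exact: N_sqint.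
  exact: (sqint_cst mu 1 mJT (mu_itvoo_fin _ _)).
- move=> s _; rewrite ger0_norm ?G0//.
  have S2 : S s ^+ 2 = 2 * Cy * N s by rewrite sqr_sqrtr// !mulr_ge0.
  have h : S s <= 1 + S s ^+ 2 by have := S0 s; nra.
  have aU : 0 <= a 0 + U by rewrite addr_ge0.
  have -> : G s = (a 0 + U) * S s + L * S s ^+ 2 by rewrite /G; ring.
  have h2 := ler_wpM2l aU h.
  have q1 : 0 <= (a 0 + U) * N s by rewrite mulr_ge0.
  have q2 : 0 <= Cy * (a 0 + U + L) by rewrite mulr_ge0 ?addr_ge0.
  rewrite S2 in h2 *; rewrite /C.
  have -> : (a 0 + U + 2 * Cy * (a 0 + U + L)) * (1 + N s) =
    (a 0 + U) * (1 + 2 * Cy * N s) + L * (2 * Cy * N s) + 2 * (Cy * (a 0 + U + L)) + (a 0 + U) * N s by ring.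
  lra.
Qed.

(** At each fixed time [d n s] is at most the square root of [3 / n] times [N s]; dominated
    convergence then removes the space error, without a rate. *)
Lemma P_cvg0 : (fun n => \int[mu]_(s in `]0, T[) (P n s ^+ 2)) @ \oo --> (0 : R).
Proof.
apply: (cvg_dominated0 (fun n s => P n s ^+ 2) (fun s => 4 * G s ^+ 2)).
- by move=> n; apply: measurable_funX; exact: P_meas.
- by apply: (@rintZ _ _ _ mu _ _ 4 mJT); case: G_sqint.
- move=> s _.
  have Pn n : `|P n s| <= (a 0 + L * S s + U) * (Num.sqrt 3 * N s) * Num.sqrt (n%:R^-1).
    rewrite ger0_norm// -[leRHS]mulrA ler_wpM2l// /d ge_min sqrtrM// mulrAC.
    by rewrite -mulrA [X in Num.sqrt 3 * X]mulrC mulrA lexx.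
  have c1 : (fun n : nat => Num.sqrt ((n%:R : R)^-1)) @ \oo --> (0 : R).
    rewrite -[X in _ --> X](@sqrtr0 R).
    apply: (@cvg_comp _ _ _ (fun n : nat => (n%:R : R)^-1) (@Num.sqrt R) _ (nbhs (0:R))).
      by rewrite -cvg_shiftS; exact: cvg_harmonic.
    exact: sqrt_continuous.
  have c2 : (fun n : nat => (a 0 + L * S s + U) * (Num.sqrt 3 * N s) * Num.sqrt (n%:R^-1)) @ \oo --> (0 : R).
    by rewrite -[X in _ --> X](mulr0 ((a 0 + L * S s + U) * (Num.sqrt 3 * N s))); apply: cvgMr.
  have c3 : (fun n : nat => P n s) @ \oo --> (0 : R).
    apply/norm_cvg0P; apply: (squeeze_cvgr _ (cvg_cst 0) c2).
    by apply: nearW => n; rewrite normr_ge0 Pn.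
  under eq_fun do rewrite expr2.
  have c4 : (fun n : nat => P n s * P n s) @ \oo --> ((0 : R) * 0 : R) by apply: cvgM.
  by rewrite mulr0 in c4.
- move=> n s _; rewrite ger0_norm ?sqr_ge0//.
  have -> : 4 * G s ^+ 2 = (2 * G s) ^+ 2 by ring.
  rewrite ler_sqr ?nnegrE ?mulr_ge0//.
  have -> : 2 * G s = (a 0 + L * S s + U) * (2 * S s) by rewrite /G; ring.
  by rewrite ler_wpM2l// /d ge_min lexx orbT.
Qed.

Definition wnode (n i : nat) (s : R) := \int[mu]_(x in I01) (w (x, s) * nodal n%:R i.-1 x).

Lemma wsec_meas s : `]0, T[%classic s -> measurable_fun I01 (fun x => w (x, s)).
Proof. by move=> sT; exact: (@section_meas _ _ _ _ _ I01 `]0, T[ measurable_I01 mJT w s sT mw). Qed.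

(** One function [P] bounds all gaps and one function [G] all sizes, for all nodes at once outside a
    single null set of times. *)
Lemma ae_bounds (n : nat) : (3 <= n)%N -> {ae mu, forall s, `]0, T[%classic s ->
  [/\ forall i, (0 < i)%N -> (i.+1 < n)%N -> `|cellt A y n i s - A (nodet y n i s)| <= P n s,
      `|cellt A y n 0 s| <= P n s, `|cellt A y n n.-1 s| <= P n s,
      forall i, (i < n)%N -> `|cellt A y n i s| <= G s &
      forall i, (0 < i)%N -> (i.+1 < n)%N ->
        n%:R * `|source y w i n s - nodet y n i s * wnode n i s| <= P n s /\
        n%:R * `|source y w i n s| <= G s]}.
Proof.
move=> n3; apply: ae_imp (ae_H10 T y yx yH T (lexx T)) => s h sJ.
have H := h sJ; have sT : 0 <= s <= T by move: sJ; rewrite /= in_itv/= => /andP[/ltW -> /ltW ->].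
have fC := yCy s sT; have mws := wsec_meas s sJ.
have wUs x : I01 x -> `|w (x, s)| <= U by move=> _; exact: wU.
have n0 : 0 < n%:R :> R by rewrite ltr0n (leq_trans _ n3).
have PE : (a 0 + L * S s) * d n s <= P n s by rewrite /P ler_wpM2r// lerDl.
have GE : (a 0 + L * S s) * S s <= G s by rewrite /G ler_wpM2r// lerDl.
have Pd : U * d n s <= P n s by rewrite /P ler_wpM2r// lerDr addr_ge0// mulr_ge0.
have GS : U * S s <= G s by rewrite /G ler_wpM2r// lerDr addr_ge0// mulr_ge0.
split.
- move=> i i0 im; apply: le_trans PE.
  exact: (cell_osc a A a0 L ca A0 dA _ _ _ _ H fC n3 i i0 im).
- by apply: le_trans PE; exact: (cell_bdry0 a A a0 L ca A0 dA _ _ _ _ H fC n3).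
- by apply: le_trans PE; exact: (cell_bdry1 a A a0 L ca A0 dA _ _ _ _ H fC n3).
- by move=> i im; apply: le_trans GE; exact: (cell_abs a A a0 L ca A0 dA _ _ _ _ H fC n3 i im).
- move=> i i0 im; split.
    apply: le_trans Pd; rewrite -ler_pdivlMl// [leRHS]mulrC.
    exact: (source_osc _ _ _ _ _ _ H fC mws wUs n3 i i0 im).
  apply: le_trans GS; rewrite -ler_pdivlMl// [leRHS]mulrC.
  exact: (source_abs _ _ _ _ _ _ H fC mws wUs n3 i i0 im).
Qed.

Section Grid.
Variables (n K : nat) (Y0 : nat -> R).
Hypothesis n3 : (3 <= n)%N.
Hypothesis K0 : (0 < K)%N.
Hypothesis Htime : forall i t, (0 < i)%N -> (i.+1 < n)%N -> 0 <= t <= T ->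
  nodet y n i t - Y0 i = \int[mu]_(s in `]0, t[)
    (n%:R ^+ 2 * (cellt A y n i.-1 s - 2 * cellt A y n i s + cellt A y n i.+1 s)
     + n%:R * source y w i n s).

Let tau : R := T / K%:R.
Let nn : R := n%:R.
Let tk (k : nat) : R := k%:R * tau.
Let Y (k i : nat) := nodet y n i (tk k).
Let Ik (k : nat) : set R := `]tk k, tk k.+1[.

Let tau0 : 0 < tau. Proof. by rewrite divr_gt0// ltr0n. Qed.
Let n0 : 0 < nn. Proof. by rewrite ltr0n (leq_trans _ n3). Qed.
Let tk_mono k l : (k <= l)%N -> tk k <= tk l.
Proof. by move=> kl; rewrite ler_wpM2r ?(ltW tau0)// ler_nat. Qed.
Let tkK : tk K = T. Proof. by rewrite /tk /tau mulrC divfK// pnatr_eq0 -lt0n. Qed.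
Let tk_ge0 k : 0 <= tk k. Proof. by rewrite mulr_ge0// ltW. Qed.
Let tk_leT k : (k <= K)%N -> tk k <= T. Proof. by move=> kK; rewrite -tkK tk_mono. Qed.
Let tkS k : tk k.+1 - tk k = tau. Proof. by rewrite /tk -natr1; ring. Qed.
Let mIk k : measurable (Ik k : set (measurableTypeR R)). Proof. exact: measurable_itv. Qed.
Let Ik_sub k : (k < K)%N -> Ik k `<=` `]0, T[.
Proof.
move=> kK s; rewrite /Ik /= !in_itv/= => /andP[s1 s2].
by rewrite (le_lt_trans (tk_ge0 k) s1) (lt_le_trans s2 (tk_leT _ kK)).
Qed.
Let rIk k f : (k < K)%N -> rint mu `]0, T[ f -> rint mu (Ik k) f.
Proof. by move=> kK; exact: (@rintS _ _ _ mu _ _ _ mJT (mIk k) (Ik_sub _ kK)). Qed.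
Let sIk k f : (k < K)%N -> sqint mu `]0, T[ f -> sqint mu (Ik k) f.
Proof. by move=> kK; exact: (@sqintS _ _ _ mu _ _ _ mJT (mIk k) (Ik_sub _ kK)). Qed.
Let Ik_cst k c : \int[mu]_(s in Ik k) c = c * tau.
Proof.
apply: (eq_trans (@Rintegral_cst _ _ _ mu _ (mIk k) c)); congr (_ * _).
by rewrite -(tkS k) -mu_itvoo// tk_mono.
Qed.
Let rIk_cst k c : rint mu (Ik k) (fun=> c : R).
Proof. exact: (rint_cst mu c (mIk k) (mu_itvoo_fin _ _)). Qed.

Let rG : rint mu `]0, T[ G.
Proof. exact: (sqint_rint mu mJT (mu_itvoo_fin _ _) G_sqint). Qed.
Let sP : sqint mu `]0, T[ (P n).
Proof.
split; first exact: P_meas.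
apply: (@rint_le _ _ _ mu _ _ (fun s => 4 * G s ^+ 2) mJT).
- by apply: measurable_funX; exact: P_meas.
- by apply: (@rintZ _ _ _ mu _ _ 4 mJT); case: G_sqint.
- move=> s _; rewrite ger0_norm ?sqr_ge0//.
  have -> : 4 * G s ^+ 2 = (2 * G s) ^+ 2 by ring.
  rewrite ler_sqr ?nnegrE ?mulr_ge0//.
  have -> : 2 * G s = (a 0 + L * S s + U) * (2 * S s) by rewrite /G; ring.
  by rewrite ler_wpM2l// /d ge_min lexx orbT.
Qed.
Let rP : rint mu `]0, T[ (P n).
Proof. exact: (sqint_rint mu mJT (mu_itvoo_fin _ _) sP). Qed.

Let integrand i s := nn ^+ 2 * (cellt A y n i.-1 s - 2 * cellt A y n i s + cellt A y n i.+1 s)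
     + nn * source y w i n s.

Let rcell i : (i < n)%N -> rint mu `]0, T[ (cellt A y n i).
Proof. by move=> im; exact: cellt_rint ca A0 dA _ _ _ yH _ _ im. Qed.

Let rsource i : rint mu `]0, T[ (source y w i n).
Proof. exact: (source_rint _ _ _ yH _ _ mw wU). Qed.

Let rlap i : (0 < i)%N -> (i.+1 < n)%N ->
  rint mu `]0, T[ (fun s => cellt A y n i.-1 s - 2 * cellt A y n i s + cellt A y n i.+1 s).
Proof.
move=> i0 im; have r1 := rcell _ (leq_ltn_trans (leq_pred i) (ltnW im)).
have r2 := @rintZ _ _ _ mu _ _ 2 mJT (rcell _ (ltnW im)).
exact: (@rintD _ _ _ mu _ _ _ mJT (@rintB _ _ _ mu _ _ _ mJT r1 r2) (rcell _ im)).
Qed.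

Let rint_integrand i : (0 < i)%N -> (i.+1 < n)%N -> rint mu `]0, T[ (integrand i).
Proof.
move=> i0 im; apply: (@rintD _ _ _ mu _ _ _ mJT).
  exact: (@rintZ _ _ _ mu _ _ _ mJT (rlap _ i0 im)).
exact: (@rintZ _ _ _ mu _ _ _ mJT (rsource i)).
Qed.

Let Yincr i s t : (0 < i)%N -> (i.+1 < n)%N -> 0 <= s -> s <= t -> t <= T ->
  nodet y n i t - nodet y n i s = \int[mu]_(s in `]s, t[) integrand i s.
Proof.
move=> i0 im s0 st tT; have t0 := le_trans s0 st; have sT := le_trans st tT.
have h1 : nodet y n i t - Y0 i = \int[mu]_(s in `]0, t[) integrand i s.
  by apply: Htime => //; rewrite t0.
have h2 : nodet y n i s - Y0 i = \int[mu]_(s in `]0, s[) integrand i s.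
  by apply: Htime => //; rewrite s0.
have r := rint_oo_sub _ _ _ _ _ (lexx 0) tT (rint_integrand _ i0 im).
by move: h1; rewrite (Rint_split _ _ _ _ s0 st r) -h2; lra.
Qed.

(** The second difference contributes 4 and the source 1, the latter multiplied up to [nn ^+ 2],
    which is at least 1. *)
Definition grid_osc (k : nat) : R := 5 * nn ^+ 2 * \int[mu]_(s in Ik k) G s.

Lemma grid_osc_ge0 k : 0 <= grid_osc k.
Proof. by rewrite /grid_osc !mulr_ge0 ?(ltW n0)//; apply: Rintegral_ge0 => s _; exact: G0. Qed.

Lemma Yosc k i s : (k < K)%N -> (0 < i)%N -> (i.+1 < n)%N -> tk k <= s <= tk k.+1 ->
  `|nodet y n i s - Y k i| <= grid_osc k.
Proof.
move=> kK i0 im /andP[s1 s2]; have sT := le_trans s2 (tk_leT _ kK).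
rewrite /Y Yincr//.
have mJ' : measurable (`]tk k, s[ : set (measurableTypeR R)) by exact: measurable_itv.
have rg := rint_oo_sub _ _ _ _ _ (tk_ge0 k) sT rG.
have rgZ := @rintZ _ _ _ mu _ _ (5 * nn ^+ 2) mJ' rg.
have ri := rint_oo_sub _ _ _ _ _ (tk_ge0 k) sT (rint_integrand _ i0 im).
apply: (@le_trans _ _ (\int[mu]_(s in `]tk k, s[) (5 * nn ^+ 2 * G s))).
  apply: (@ae_abs_Rint _ _ _ mu _ _ _ mJ' (rint_meas mu ri) rgZ).
  apply: ae_imp (ae_bounds n n3) => r h rI.
  have rT : `]0, T[%classic r.
    by move: rI; rewrite /= !in_itv/= => /andP[r1 r2]; rewrite (le_lt_trans (tk_ge0 k) r1) (lt_le_trans r2 sT).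
  have [_ _ _ hG hs] := h rT; have [_ hs2] := hs i i0 im.
  have g1 := hG i.-1 (leq_ltn_trans (leq_pred i) (ltnW im)); have g2 := hG i (ltnW im).
  have g3 := hG i.+1 im; rewrite /integrand.
  apply: (le_trans (ler_normD _ _)); rewrite [`|nn ^+ 2 * _|]normrM (ger0_norm (sqr_ge0 nn))
    [`|nn * _|]normrM (gtr0_norm n0).
  have hl : `|cellt A y n i.-1 r - 2 * cellt A y n i r + cellt A y n i.+1 r| <= 4 * G r.
    by move: g1 g2 g3; rewrite !ler_norml => /andP[? ?] /andP[? ?] /andP[? ?]; apply/andP; split; lra.
  have := ler_wpM2l (sqr_ge0 nn) hl.
  have nn1 : 1 <= nn ^+ 2 by rewrite -(expr1n _ 2) ler_sqr ?nnegrE ?(ltW n0)// /nn ler1n (leq_trans _ n3).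
  have := ler_wpM2r (G0 r) nn1; rewrite mul1r; move: hs2; lra.
rewrite (@RintegralZl _ _ _ mu _ _ _ mJ' rg) /grid_osc ler_wpM2l ?mulr_ge0 ?(ltW n0)//.
rewrite /Ik (Rint_split _ _ _ _ s1 s2); last exact: rint_oo_sub (tk_ge0 k) (tk_leT _ kK) rG.
by rewrite lerDl; apply: Rintegral_ge0 => r _; exact: G0.
Qed.

Variable By : R.
Hypothesis Byb : forall i t, (0 < i)%N -> (i.+1 < n)%N -> 0 <= t <= T -> `|nodet y n i t| <= By.

Let LA : R := a 0 + L * By.

(** The first term is the time average of the space error; the second is the cost of freezing the
    node averages at the start of the time step, [LA] being the Lipschitz constant of A on their
    range. *)
Definition grid_err (k : nat) : R :=
  tau^-1 * \int[mu]_(s in Ik k) P n s + (LA + U) * grid_osc k.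

Definition grid_cell (k i : nat) : R := tau^-1 * \int[mu]_(s in Ik k) cellt A y n i s.
Definition grid_e (k i : nat) : R :=
  grid_cell k i - (if (0 < i)%N && (i.+1 < n)%N then A (Y k i) else 0).
(** The control averaged over the spline and the time step. It keeps the bound [U], and it vanishes
    when the spline does not meet [omega], so the scheme is uncontrolled in the gap. *)
Definition grid_u (k i : nat) : R := nn / tau * \int[mu]_(s in Ik k) wnode n i s.
Definition grid_r (k i : nat) : R :=
  nn / tau * \int[mu]_(s in Ik k) source y w i n s - grid_u k i * Y k i.

Let rwnode i : rint mu `]0, T[ (wnode n i).
Proof.
have iG : rint mu2 (QT T) (fun p => w p * nodal nn i.-1 p.1).
  apply: (@eq_rint _ _ _ mu2 _ (fun p => nodal nn i.-1 p.1 * w p) _ (measurable_QT T)).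
    by move=> p _; rewrite mulrC.
  apply: (@rintM_bdd _ _ _ mu2 _ _ _ 1 (measurable_QT T)).
  - by apply: fst_meas; [exact: nodal_continuous|exact: measurable_QT].
  - by move=> p _; rewrite ger0_norm ?nodal_ge0// nodal_le1.
  - apply: (@rint_le _ _ _ mu2 _ _ (fun=> U) (measurable_QT T)) => //.
    exact: (rint_cst mu2 U (measurable_QT T) (QT_fin T)).
by have [_ h _] := Rint_prod mu mu I01 `]0, T[ measurable_I01 mJT _ iG.
Qed.

Let wnode_bound i s : (0 < i)%N -> (i.+1 < n)%N -> `]0, T[%classic s -> nn * `|wnode n i s| <= U.
Proof.
move=> i0 im sT; rewrite -ler_pdivlMl// mulrC.
have ik : i.-1%:R + 3 <= nn by rewrite /nn -natrD ler_nat addn3; case: i i0 im.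
have -> : U / nn = \int[mu]_(x in I01) (U * nodal nn i.-1 x).
  by rewrite (@RintegralZl _ _ _ mu _ _ _ measurable_I01 (nodal_rint _ _)) Rint_nodal.
apply: (@ae_abs_Rint _ _ _ mu _ _ _ measurable_I01).
- apply: measurable_funM; first exact: wsec_meas.
  by apply: continuous_measurable; [exact: measurable_I01|exact: nodal_continuous].
- exact: (@rintZ _ _ _ mu _ _ U measurable_I01 (nodal_rint _ _)).
- by apply: nearW => x _; rewrite normrM (ger0_norm (nodal_ge0 _ _ _)) ler_wpM2r ?nodal_ge0.
Qed.

Let Ik_avg k (f : R -> R) (b : R) : (k < K)%N -> rint mu `]0, T[ f ->
  {ae mu, forall s, Ik k s -> `|f s| <= P n s + b} ->
  `|tau^-1 * \int[mu]_(s in Ik k) f s| <= tau^-1 * \int[mu]_(s in Ik k) P n s + b.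
Proof.
move=> kK rf fb; have ti : 0 <= tau^-1 by rewrite invr_ge0 ltW.
have rPb := @rintD _ _ _ mu _ _ _ (mIk k) (rIk _ _ kK rP) (rIk_cst k b).
have := @ae_abs_Rint _ _ _ mu _ _ _ (mIk k) (rint_meas mu (rIk _ _ kK rf)) rPb fb.
rewrite (@RintegralD _ _ _ mu _ _ _ (mIk k) (rIk _ _ kK rP) (rIk_cst k b)) Ik_cst.
move=> /(ler_wpM2l ti); rewrite normrM (ger0_norm ti) mulrDr => /le_trans; apply.
by rewrite lerD2l mulrCA mulVf ?mulr1// gt_eqF.
Qed.

Let Ik_T k s : (k < K)%N -> Ik k s -> `]0, T[%classic s. Proof. by move=> kK; exact: Ik_sub. Qed.

Let Ik_le k s : Ik k s -> tk k <= s <= tk k.+1.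
Proof. by rewrite /Ik /= in_itv/= => /andP[/ltW -> /ltW ->]. Qed.

Let By0 : forall i, (0 < i)%N -> (i.+1 < n)%N -> 0 <= By.
Proof.
move=> i i0 im; apply: le_trans (Byb i 0 i0 im _); rewrite ?normr_ge0//.
by rewrite lexx ltW.
Qed.

Lemma grid_e_bound k i : (k < K)%N -> (i < n)%N -> 0 <= By -> `|grid_e k i| <= grid_err k.
Proof.
move=> kK im By_ge0; have LA0 : 0 <= LA by rewrite addr_ge0// mulr_ge0.
have osc0 := grid_osc_ge0 k.
have base : tau^-1 * \int[mu]_(s in Ik k) P n s <= grid_err k.
  by rewrite /grid_err lerDl mulr_ge0// addr_ge0.
have [/andP[i0 im1]|] := boolP ((0 < i)%N && (i.+1 < n)%N); last first.
  move=> hn; rewrite /grid_e (negbTE hn) subr0 /grid_cell; apply: le_trans base.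
  rewrite -[leRHS]addr0; apply: Ik_avg => //; first exact: rcell.
  apply: ae_imp (ae_bounds n n3) => s h sI; have [_ h0 h1 _ _] := h (Ik_T _ _ kK sI).
  rewrite addr0; move: hn; rewrite negb_and -leqNgt leqn0 -leqNgt => /orP[/eqP ->//|ni].
  have -> // : i = n.-1.
  by apply/eqP; rewrite eqn_leq -ltnS (prednK (leq_trans _ n3))// im/= -ltnS (prednK (leq_trans _ n3)).
rewrite /grid_e i0 im1 /= /grid_cell.
have E : tau^-1 * \int[mu]_(s in Ik k) cellt A y n i s - A (Y k i) =
   tau^-1 * \int[mu]_(s in Ik k) (cellt A y n i s - A (Y k i)).
  have E1 : \int[mu]_(s in Ik k) (cellt A y n i s - A (Y k i)) =
      \int[mu]_(s in Ik k) cellt A y n i s - \int[mu]_(s in Ik k) A (Y k i).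
    exact: (@RintegralB _ _ _ mu _ _ _ (mIk k) (rIk _ _ kK (rcell _ im)) (rIk_cst k _)).
  rewrite E1 Ik_cst; field; exact: lt0r_neq0.
rewrite E; apply: (@le_trans _ _ (tau^-1 * \int[mu]_(s in Ik k) P n s + LA * grid_osc k)).
  apply: Ik_avg => //.
    apply: (@rintB _ _ _ mu _ _ _ mJT (rcell _ im)).
    exact: (rint_cst mu _ mJT (mu_itvoo_fin _ _)).
  apply: ae_imp (ae_bounds n n3) => s h sI; have [h1 _ _ _ _] := h (Ik_T _ _ kK sI).
  have -> : cellt A y n i s - A (Y k i) = (cellt A y n i s - A (nodet y n i s)) +
    (A (nodet y n i s) - A (Y k i)) by ring.
  apply: (le_trans (ler_normD _ _)); apply: lerD; first exact: h1.
  have sT : 0 <= s <= T by have := Ik_T _ _ kK sI; rewrite /= in_itv/= => /andP[/ltW -> /ltW ->].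
  have kT : 0 <= tk k <= T by rewrite tk_ge0 tk_leT// ltnW.
  apply: (le_trans (prim_lip _ _ _ _ ca dA By _ _ (Byb _ _ i0 im1 sT) (Byb _ _ i0 im1 kT))).
  by rewrite ler_wpM2l//; apply: Yosc => //; exact: Ik_le.
by rewrite /grid_err lerD2l ler_wpM2r// lerDl.
Qed.

Lemma grid_u_bound k i : (k < K)%N -> (0 < i)%N -> (i.+1 < n)%N -> `|grid_u k i| <= U.
Proof.
move=> kK i0 im; rewrite /grid_u.
have nt : 0 <= nn / tau by rewrite divr_ge0 ?(ltW n0) ?(ltW tau0).
rewrite normrM (ger0_norm nt).
have := @ae_abs_Rint _ _ _ mu _ _ (fun=> U / nn) (mIk k) (rint_meas mu (rIk _ _ kK (rwnode i)))
  (rIk_cst k _).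
rewrite Ik_cst => h.
apply: (le_trans (ler_wpM2l nt (h _))).
  apply: nearW => s sI; rewrite ler_pdivlMr// mulrC; apply: wnode_bound => //; exact: Ik_T sI.
by rewrite le_eqVlt; apply/orP; left; apply/eqP; field; rewrite !gt_eqF.
Qed.

Lemma grid_r_bound k i : (k < K)%N -> (0 < i)%N -> (i.+1 < n)%N -> 0 <= By ->
  `|grid_r k i| <= grid_err k.
Proof.
move=> kK i0 im By_ge0; have LA0 : 0 <= LA by rewrite addr_ge0// mulr_ge0.
have osc0 := grid_osc_ge0 k.
have r1 := rIk _ _ kK (rsource i); have r2 := rIk _ _ kK (rwnode i).
have r2Y := @rintZ _ _ _ mu _ _ (Y k i) mJT (rwnode i).
have rd : rint mu `]0, T[ (fun s => nn * (source y w i n s - Y k i * wnode n i s)).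
  exact: (@rintZ _ _ _ mu _ _ nn mJT (@rintB _ _ _ mu _ _ _ mJT (rsource i) r2Y)).
have E : grid_r k i = tau^-1 * \int[mu]_(s in Ik k) (nn * (source y w i n s - Y k i * wnode n i s)).
  rewrite (@RintegralZl _ _ _ mu _ _ _ (mIk k) (@rintB _ _ _ mu _ _ _ (mIk k) r1 (rIk _ _ kK r2Y))).
  rewrite (@RintegralB _ _ _ mu _ _ _ (mIk k) r1 (rIk _ _ kK r2Y)).
  rewrite (@RintegralZl _ _ _ mu _ _ _ (mIk k) r2) /grid_r /grid_u; ring.
rewrite E; apply: (@le_trans _ _ (tau^-1 * \int[mu]_(s in Ik k) P n s + U * grid_osc k)).
  apply: Ik_avg => //.
  apply: ae_imp (ae_bounds n n3) => s h sI; have sT := Ik_T _ _ kK sI.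
  have [_ _ _ _ hs] := h sT; have [h1 _] := hs i i0 im.
  rewrite normrM (gtr0_norm n0).
  have -> : source y w i n s - Y k i * wnode n i s =
    (source y w i n s - nodet y n i s * wnode n i s) + (nodet y n i s - Y k i) * wnode n i s by ring.
  apply: (le_trans (ler_wpM2l (ltW n0) (ler_normD _ _))); rewrite mulrDr; apply: lerD; first exact: h1.
  rewrite normrM mulrCA mulrC; apply: ler_pM; rewrite ?mulr_ge0 ?(ltW n0)//.
    exact: wnode_bound.
  by apply: Yosc => //; exact: Ik_le.
by rewrite /grid_err lerD2l ler_wpM2r// lerDr.
Qed.

Lemma grid_step k i : (k < K)%N -> (0 < i)%N -> (i.+1 < n)%N ->
  Y k.+1 i - Y k i = tau * nn ^+ 2 * (grid_cell k i.-1 - 2 * grid_cell k i + grid_cell k i.+1)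
    + tau * (grid_u k i * Y k i + grid_r k i).
Proof.
move=> kK i0 im.
have -> : Y k.+1 i - Y k i = \int[mu]_(s in Ik k) integrand i s.
  by apply: Yincr => //; [exact: tk_mono|exact: tk_leT].
have r1 := rcell _ (leq_ltn_trans (leq_pred i) (ltnW im)).
have r2 := rcell _ (ltnW im); have r3 := rcell _ im.
have r2' := @rintZ _ _ _ mu _ _ 2 mJT r2.
have rB := @rintB _ _ _ mu _ _ _ mJT r1 r2'.
have rl := rlap _ i0 im; have rs := rsource i.
have rl' := @rintZ _ _ _ mu _ _ (nn ^+ 2) mJT rl.
have rs' := @rintZ _ _ _ mu _ _ nn mJT rs.
rewrite /integrand (@RintegralD _ _ _ mu _ _ _ (mIk k) (rIk _ _ kK rl') (rIk _ _ kK rs')).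
rewrite (@RintegralZl _ _ _ mu _ _ _ (mIk k) (rIk _ _ kK rl)).
rewrite (@RintegralZl _ _ _ mu _ _ _ (mIk k) (rIk _ _ kK rs)).
rewrite (@RintegralD _ _ _ mu _ _ _ (mIk k) (rIk _ _ kK rB) (rIk _ _ kK r3)).
rewrite (@RintegralB _ _ _ mu _ _ _ (mIk k) (rIk _ _ kK r1) (rIk _ _ kK r2')).
rewrite (@RintegralZl _ _ _ mu _ _ _ (mIk k) (rIk _ _ kK r2)).
rewrite /grid_r /grid_cell; set u1 := grid_u k i; set c1 := Rintegral _ _ _.
set c2 := Rintegral _ _ _; set c3 := Rintegral _ _ _; set c4 := Rintegral _ _ _.
have tn0 : tau != 0 by exact: lt0r_neq0.
move: c1 c2 c3 c4 u1 (Y k i) => c1 c2 c3 c4 u1 Yki; move: tau nn tn0 => t m tn0.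
by field.
Qed.

(** The first term depends on the space mesh alone. The second has powers of [nn] but also a factor
    [tau ^+ 2], so it disappears when the time step is chosen after the space mesh. *)
Lemma grid_err_sum : \sum_(k < K) tau * grid_err k ^+ 2 <=
  2 * \int[mu]_(s in `]0, T[) (P n s ^+ 2)
  + tau ^+ 2 * (2 * (LA + U) ^+ 2 * (5 * nn ^+ 2) ^+ 2 * \int[mu]_(s in `]0, T[) (G s ^+ 2)).
Proof.
have [_ rP2] := sP; have [_ rG2] := G_sqint.
have tKT : K%:R * tau = T by exact: tkK.
have s1 : \int[mu]_(s in `]0, T[) (P n s ^+ 2) = \sum_(k < K) \int[mu]_(s in Ik k) (P n s ^+ 2).
  by rewrite -[X in `]0, X[]tKT sum_grid ?(ltW tau0)// tKT.
have s2 : \int[mu]_(s in `]0, T[) (G s ^+ 2) = \sum_(k < K) \int[mu]_(s in Ik k) (G s ^+ 2).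
  by rewrite -[X in `]0, X[]tKT sum_grid ?(ltW tau0)// tKT.
rewrite s1 s2 !mulr_sumr -big_split /=; apply: ler_sum => k _.
have c1 := cauchy_schwarz_itv _ _ _ (tk_mono _ _ (leqnSn k)) (sIk _ _ (ltn_ord k) sP).
have c2 := cauchy_schwarz_itv _ _ _ (tk_mono _ _ (leqnSn k)) (sIk _ _ (ltn_ord k) G_sqint).
move: c1 c2; rewrite tkS -/(Ik k) /grid_err /grid_osc.
set p1 := \int[mu]_(s in Ik k) P n s; set p2 := \int[mu]_(s in Ik k) (P n s ^+ 2).
set g1 := \int[mu]_(s in Ik k) G s; set g2 := \int[mu]_(s in Ik k) (G s ^+ 2).
move=> c1 c2.
have sq (u v : R) : (u + v) ^+ 2 <= 2 * u ^+ 2 + 2 * v ^+ 2 by have := sqr_ge0 (u - v); nra.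
apply: (le_trans (ler_wpM2l (ltW tau0) (sq _ _))); rewrite mulrDr; apply: lerD.
  have -> : tau * (2 * (tau^-1 * p1) ^+ 2) = 2 * (tau^-1 * p1 ^+ 2) by field; exact: lt0r_neq0.
  by rewrite ler_pM2l// ler_pdivrMl.
have -> : tau * (2 * ((LA + U) * (5 * nn ^+ 2 * g1)) ^+ 2) =
  (tau * (2 * (LA + U) ^+ 2 * (5 * nn ^+ 2) ^+ 2)) * g1 ^+ 2 by ring.
have -> : tau ^+ 2 * (2 * (LA + U) ^+ 2 * (5 * nn ^+ 2) ^+ 2 * g2) =
  (tau * (2 * (LA + U) ^+ 2 * (5 * nn ^+ 2) ^+ 2)) * (tau * g2) by ring.
by apply: ler_wpM2l => //; rewrite mulr_ge0 ?(ltW tau0)// mulr_ge0 ?sqr_ge0// mulr_ge0// sqr_ge0.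
Qed.

Lemma grid_osc_sum : \sum_(k < K) grid_osc k ^+ 2 <=
  tau * ((5 * nn ^+ 2) ^+ 2 * \int[mu]_(s in `]0, T[) (G s ^+ 2)).
Proof.
have [_ rG2] := G_sqint.
have tKT : K%:R * tau = T by exact: tkK.
have s2 : \int[mu]_(s in `]0, T[) (G s ^+ 2) = \sum_(k < K) \int[mu]_(s in Ik k) (G s ^+ 2).
  by rewrite -[X in `]0, X[]tKT sum_grid ?(ltW tau0)// tKT.
rewrite s2 !mulr_sumr; apply: ler_sum => k _.
have c2 := cauchy_schwarz_itv _ _ _ (tk_mono _ _ (leqnSn k)) (sIk _ _ (ltn_ord k) G_sqint).
move: c2; rewrite tkS -/(Ik k) /grid_osc => c2.
by rewrite exprMn [leRHS]mulrCA; apply: ler_wpM2l => //; exact: sqr_ge0.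
Qed.

Lemma grid_total (c V : R) : 0 <= c ->
  \sum_(k < K) (c * (tau * grid_err k ^+ 2) + (grid_osc k + tau * V) ^+ 2) <=
  2 * c * \int[mu]_(s in `]0, T[) (P n s ^+ 2)
  + tau * (c * T * (2 * (LA + U) ^+ 2 * (5 * nn ^+ 2) ^+ 2 * \int[mu]_(s in `]0, T[) (G s ^+ 2))
    + 2 * ((5 * nn ^+ 2) ^+ 2 * \int[mu]_(s in `]0, T[) (G s ^+ 2)) + 2 * T * V ^+ 2).
Proof.
move=> cc0; have h1 := ler_wpM2l cc0 grid_err_sum; have h2 := grid_osc_sum.
have tT : tau <= T.
  by rewrite /tau ler_pdivrMr ?ltr0n// ler_peMr ?(ltW T0)// ler1n.
have tKT : K%:R * tau = T by exact: tkK.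
have h3 : \sum_(k < K) (grid_osc k + tau * V) ^+ 2 <= 2 * \sum_(k < K) grid_osc k ^+ 2 + tau * (2 * T * V ^+ 2).
  have -> : tau * (2 * T * V ^+ 2) = K%:R * (2 * (tau * V) ^+ 2) by rewrite -tKT; ring.
  rewrite -(sum_cst (2 * (tau * V) ^+ 2) K) mulr_sumr -big_split /=; apply: ler_sum => k _.
  by have := sqr_ge0 (grid_osc k - tau * V); nra.
rewrite big_split /= -mulr_sumr; move: h1 h2 h3.
set I1 := \int[mu]_(s in _) (P n s ^+ 2); set I2 := \int[mu]_(s in _) (G s ^+ 2).
have I20 : 0 <= I2 by apply: Rintegral_ge0 => s _; exact: sqr_ge0.
have X0 : 0 <= c * (2 * (LA + U) ^+ 2 * (5 * nn ^+ 2) ^+ 2 * I2).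
  by apply: mulr_ge0 => //; apply: mulr_ge0 => //; do 2?[apply: mulr_ge0; last exact: sqr_ge0].
have ttT : tau ^+ 2 <= tau * T by rewrite expr2 ler_wpM2l ?(ltW tau0).
have h4 := ler_wpM2l X0 ttT.
move: (2 * (LA + U) ^+ 2 * (5 * nn ^+ 2) ^+ 2 * I2) h4 => Z h4.
move: ((5 * nn ^+ 2) ^+ 2 * I2) (\sum_(k < K) tau * _) (\sum_(k < K) grid_osc k ^+ 2) (\sum_(k < K) (_ + _) ^+ 2) => z s1 s2 s3.
move: tau h4 => t h4; lra.
Qed.

End Grid.

Variable y0 : R -> R.
Hypothesis y0s : sqint mu I01 y0.
Hypothesis y0p : {ae mu, forall x, I01 x -> 0 <= y0 x}.
Hypothesis ys : forall t, 0 <= t <= T -> sqint mu I01 (fun x => y (x, t)).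
Hypothesis Htime : forall n i t, (0 < i)%N -> (i.+1 < n)%N -> 0 <= t <= T ->
  nodet y n i t - node_avg y0 n i = \int[mu]_(s in `]0, t[)
    (n%:R ^+ 2 * (cellt A y n i.-1 s - 2 * cellt A y n i s + cellt A y n i.+1 s)
     + n%:R * source y w i n s).

(** The bound degrades with [n]; it fixes [Mb] and [By] for a given [n], before the number of time
    steps is chosen. *)
Lemma node_avg_abs (f : R -> R) (n i : nat) : sqint mu I01 f -> `|node_avg f n i| <= n%:R * nrm mu I01 f.
Proof.
move=> sf; rewrite /node_avg normrM ger0_norm// ler_wpM2l//.
have sn : sqint mu I01 (nodal n%:R i.-1) := nodal_sqint n%:R i.-1.
apply: (le_trans (@cauchy_schwarz_nrm _ _ _ mu _ _ _ measurable_I01 sf sn)).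
rewrite ler_piMr ?nrm_ge0//.
have s1 : sqint mu I01 (fun=> 1) := sqint_cst mu 1 measurable_I01 mu_I01_fin.
apply: (@le_trans _ _ (nrm mu I01 (fun=> 1))).
  apply: (@nrm_le _ _ _ mu _ _ _ measurable_I01 sn s1) => x _.
  by rewrite normr1 ger0_norm ?nodal_ge0// nodal_le1.
by rewrite /nrm expr1n Rint_cst_I sqrtr1.
Qed.

Lemma node_avg_ge0 (n i : nat) : 0 <= node_avg y0 n i.
Proof.
rewrite /node_avg mulr_ge0//.
have r0 := rint_cst mu 0 measurable_I01 mu_I01_fin.
have rf := @sqintM _ _ _ mu _ _ _ measurable_I01 y0s (nodal_sqint n%:R i.-1).
have := @ae_le_Rint _ _ _ mu _ _ _ measurable_I01 r0 rf.
rewrite Rint_cst_I; apply; apply: ae_imp y0p => x h xI.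
by rewrite mulr_ge0 ?nodal_ge0// h.
Qed.

Lemma grid_u_off (n K k i : nat) : (3 <= n)%N ->
  (forall x, i.-1%:R / n%:R <= x <= (i.-1%:R + 3) / n%:R -> ~ omega x) -> grid_u n K k i = 0.
Proof.
move=> n3 off; rewrite /grid_u; have -> : wnode n i = fun=> 0.
  apply/funext => s; rewrite /wnode (eq_Rint_in mu I01 _ (fun=> 0)) ?Rint_cst_I// => x _.
  have [->|nz] := eqVneq (nodal n%:R i.-1 x) 0; first by rewrite mulr0.
  by rewrite wom ?mul0r//; apply: off; exact: nodal_supp nz.
rewrite (@Rintegral_cst _ _ _ mu); last exact: measurable_itv.
by rewrite mul0r mulr0.
Qed.

(** The order of the choices matters: [n0] comes from the space error, then [Mb] is fixed and may
    grow with [n], and finally [K] makes the time step satisfy the stability conditions, the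
    smallness of the time error and a condition with a free [X], which may depend on [n] and
    [Mb]. *)
Lemma euler_approximation (delta : R) : 0 < delta -> exists n0, forall n, (n0 <= n)%N -> (3 <= n)%N ->
  exists2 Mb, 1 <= Mb & forall X : R, exists K (v : nat -> nat -> R),
  [/\ (0 < K)%N, T / K%:R * n%:R ^+ 2 * X <= 1,
    forall k i, (k <= K)%N -> 0 <= v k i <= Mb,
    forall k i, ~~ ((0 < i)%N && (i < n.-1)%N) -> v k i = 0 &
  [/\ forall i, (0 < i)%N -> (i < n.-1)%N -> v 0%N i = node_avg y0 n i,
    forall k i, (k < K)%N -> (0 < i)%N -> (i < n.-1)%N ->
      (forall x, i.-1%:R / n%:R <= x <= (i.-1%:R + 3) / n%:R -> ~ omega x) ->
      v k.+1 i = v k i + T / K%:R * n%:R ^+ 2 * lap (fun j => A (v k j)) i &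
    forall phi : nat -> R, phi 0%N = 0 -> phi n.-1 = 0 ->
      (forall i, (i < n.-1)%N -> `|dif phi i| <= 1) ->
      `|\sum_(i < n.-1) phi i * (nodet y n i T - v K i)| <= n%:R ^+ 2 * delta]].
Proof.
move=> dl0; have a0p := coef_gt0 _ _ _ ca.
pose ec := expR ((2 * U ^+ 2 / a0 + 1) * T); have ec0 : 0 < ec := expR_gt0 _.
pose c := 8 / a0 + 1; have cp : 0 < c by rewrite addr_gt0// divr_gt0.
(* With this threshold the space error takes exactly half of [delta ^+ 2] after multiplication by
   [ec] and [2 * c]. *)
have [n0 _ hn0] : \forall n \near \oo, \int[mu]_(s in `]0, T[) (P n s ^+ 2) < delta ^+ 2 / (4 * c * ec).
  have e0 : 0 < delta ^+ 2 / (4 * c * ec).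
    by rewrite divr_gt0 ?exprn_gt0// mulr_gt0// mulr_gt0.
  have := P_cvg0; move/cvgrPdist_lt => /(_ _ e0); apply: filterS => n.
  by rewrite sub0r normrN; apply: le_lt_trans; exact: ler_norm.
exists n0 => n n0n n3; have Pn := hn0 n n0n; have nn0 : 0 < n%:R :> R by rewrite ltr0n (leq_trans _ n3).
pose M0 := n%:R * nrm mu I01 y0; have M00 : 0 <= M0 by rewrite mulr_ge0// nrm_ge0.
pose Mb := Num.max 1 (expR (U * T) * M0).
have Mb1 : 1 <= Mb by rewrite le_max lexx.
have Mb0 : 0 <= Mb := le_trans ler01 Mb1.
exists Mb => // X.
pose By := n%:R * Cy; have By0 : 0 <= By by rewrite mulr_ge0.
have Byb i t : (0 < i)%N -> (i.+1 < n)%N -> 0 <= t <= T -> `|nodet y n i t| <= By.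
  by move=> _ _ tT; apply: (le_trans (node_avg_abs _ _ _ (ys t tT))); rewrite ler_wpM2l// yCy.
pose V := n%:R ^+ 2 * (2 * A Mb) + U * Mb.
pose I2 := \int[mu]_(s in `]0, T[) (G s ^+ 2).
pose Z := c * T * (2 * (a 0 + L * By + U) ^+ 2 * (5 * n%:R ^+ 2) ^+ 2 * I2)
    + 2 * ((5 * n%:R ^+ 2) ^+ 2 * I2) + 2 * T * V ^+ 2.
have I20 : 0 <= I2 by apply: Rintegral_ge0 => s _; exact: sqr_ge0.
have Z0 : 0 <= Z.
  have q1 : 0 <= (5 * n%:R ^+ 2) ^+ 2 * I2 by apply: mulr_ge0 => //; exact: sqr_ge0.
  apply: addr_ge0; first apply: addr_ge0.
  - apply: mulr_ge0; first by rewrite mulr_ge0// ltW.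
    by apply: mulr_ge0 => //; apply: mulr_ge0; [apply: mulr_ge0 => //; exact: sqr_ge0|exact: sqr_ge0].
  - exact: mulr_ge0.
  - by apply: mulr_ge0; [rewrite mulr_ge0// ltW|exact: sqr_ge0].
have aLM : 0 <= a 0 + L * Mb by rewrite addr_ge0// mulr_ge0.
(* The requirements on the time step are added up, so that [tau * W <= 1] gives each of them: the
   free condition, the two stability conditions, and the other half of [delta ^+ 2]. *)
pose W := n%:R ^+ 2 * `|X| + 4 * n%:R ^+ 2 * (a 0 + L * Mb) + 2 * U + 2 * ec * Z / delta ^+ 2.
have w1 : 0 <= n%:R ^+ 2 * `|X| by rewrite mulr_ge0// sqr_ge0.
have w2 : 0 <= 4 * n%:R ^+ 2 * (a 0 + L * Mb) by rewrite mulr_ge0// mulr_ge0// sqr_ge0.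
have w3 : 0 <= 2 * ec * Z / delta ^+ 2 by rewrite divr_ge0 ?sqr_ge0// mulr_ge0// mulr_ge0// ltW.
have W0 : 0 <= W by rewrite !addr_ge0// mulr_ge0.
have [K K0 KW] : exists2 K, (0 < K)%N & T * W <= K%:R.
  exists (Num.truncn (T * W)).+1 => //; rewrite ltW// truncnS_gt//.
have Kp : 0 < K%:R :> R by rewrite ltr0n.
pose tau := T / K%:R; have tau0 : 0 < tau by rewrite divr_gt0.
have tW : tau * W <= 1 by rewrite /tau mulrAC ler_pdivrMr// mul1r.
have sm x : x <= W -> tau * x <= 1 by move=> xW; apply: le_trans tW; rewrite ler_wpM2l// ltW.
have KT : K%:R * tau = T by rewrite /tau mulrC divfK// gt_eqF.
(* Of the [n] cells the first and the last are ghosts, so the scheme lives on the indices 0 to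
   [n.-1] with zero values at both ends. *)
pose Q := n.-1; have nE : n = Q.+1 by rewrite /Q prednK// (leq_trans _ n3).
have Q0 : (0 < Q)%N by rewrite /Q -ltnS prednK ?(leq_trans _ n3)// ltnW.
have Qn : Q%:R <= n%:R :> R by rewrite ler_nat leq_pred.
have iN i : (i < Q)%N -> (i.+1 < n)%N by rewrite nE.
pose kap := tau * n%:R ^+ 2; have kap0 : 0 <= kap by rewrite mulr_ge0 ?sqr_ge0// ltW.
pose u := grid_u n K.
have ub k i : (k < K)%N -> (0 < i)%N -> (i < Q)%N -> `|u k i| <= U.
  by move=> kK i0 im; apply: (grid_u_bound n K n3 K0 k i kK i0 (iN _ im)).
have Y0b i : (0 < i)%N -> (i < Q)%N -> 0 <= node_avg y0 n i <= M0.
  move=> _ _; rewrite node_avg_ge0/=; apply: (le_trans (ler_norm _)); exact: node_avg_abs.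
have Mbb : expR (U * (K%:R * tau)) * M0 <= Mb by rewrite KT le_max lexx orbT.
have small : 4 * kap * (a 0 + L * Mb) <= 1.
  have -> : 4 * kap * (a 0 + L * Mb) = tau * (4 * n%:R ^+ 2 * (a 0 + L * Mb)) by rewrite /kap; ring.
  by apply: sm; rewrite /W; move: w1 w3 U0; lra.
have tauU : 2 * (tau * U) <= 1.
  have -> : 2 * (tau * U) = tau * (2 * U) by ring.
  by apply: sm; rewrite /W; move: w1 w2 w3; lra.
pose v := euler A Q kap tau u (node_avg y0 n).
exists K, v; split; [exact: K0| | | |split].
- have -> : T / K%:R * n%:R ^+ 2 * X = tau * (n%:R ^+ 2 * X) by rewrite /tau; ring.
  apply: sm; have h : n%:R ^+ 2 * X <= n%:R ^+ 2 * `|X| by rewrite ler_wpM2l ?sqr_ge0// ler_norm.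
  by rewrite /W; move: w2 w3 U0 h; lra.
- move=> k i kK; exact: (euler_bound _ _ _ _ ca A0 dA Q kap tau u _ K U M0 Mb kap0 (ltW tau0) U0 M00 Y0b ub Mbb small tauU k i kK).
- by move=> k i h; exact: euler_out.
- by move=> i i0 im; rewrite /v /= i0 im.
- move=> k i kK i0 im off; rewrite /v euler_step// /u grid_u_off// mul0r mulr0 addr0 //.
move=> phi p0 pN pl.
pose Y k i := nodet y n i (k%:R * tau).
have YT i : nodet y n i T = Y K i by rewrite /Y KT.
have dE : \sum_(i < n.-1) phi i * (nodet y n i T - v K i) =
    \sum_(i < Q) phi i * defect A Q kap tau u (node_avg y0 n) Y K i.
  apply: eq_bigr => -[[|i] im] _ /=; first by rewrite p0 !mul0r.
  by rewrite /defect /= im YT.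
rewrite dE; apply: (defect_pairing A Q kap tau u (node_avg y0 n) K Y n%:R Q0 Qn phi delta p0 pN pl (ltW dl0)).
have E0 k : 0 <= grid_err n K By k.
  apply: addr_ge0.
    rewrite mulr_ge0 ?invr_ge0 ?(ltW tau0)//; apply: Rintegral_ge0 => s _; exact: P0.
  by rewrite mulr_ge0 ?grid_osc_ge0 ?addr_ge0// mulr_ge0.
have YY0 i : (0 < i)%N -> (i < Q)%N -> Y 0%N i = node_avg y0 n i.
  move=> i0 im; have T00 : (0 : R) <= 0 <= T by rewrite lexx ltW.
  have := Htime n i 0 i0 (iN _ im) T00; rewrite set_itvoo0 Rintegral_set0 /Y mul0r => /eqP.
  by rewrite subr_eq0 => /eqP.
have := defect_energy _ _ _ _ ca A0 dA Q kap tau u (node_avg y0 n) K U M0 Mb kap0 (ltW tau0) U0 M00 Y0b ub Mbb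
  small tauU Y (grid_e n K) (grid_r n K) (grid_err n K By) (grid_osc n K) n%:R Q0 Qn erefl E0 YY0.
move=> H; apply: (le_trans (H _ _ _ _)) => {H}.
- move=> k i kK i0 im.
  rewrite /Y (grid_step n K (node_avg y0 n) K0 (Htime n) k i kK i0 (iN _ im)).
  have ce j : (if (0 < j)%N && (j < Q)%N then A (Y k j) else 0) + grid_e n K k j = grid_cell n K k j.
    by rewrite /grid_e -[(j < Q)%N]ltnS -nE addrC subrK.
  have -> : lap (fun j => (if (0 < j)%N && (j < Q)%N then A (Y k j) else 0) + grid_e n K k j) i =
      grid_cell n K k i.-1 - 2 * grid_cell n K k i + grid_cell n K k i.+1.
    rewrite /lap !ce; move: (grid_cell n K k i.+1) (grid_cell n K k i) (grid_cell n K k i.-1) => p q r.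
    by rewrite addrAC [p + r]addrC addrAC.
  by [].
- by move=> k i kK im; apply: grid_e_bound => //; [exact: Htime|rewrite nE ltnS].
- by move=> k i kK i0 im; apply: grid_r_bound => //; [exact: Htime|exact: iN].
- move=> k i kK i0 im; apply: Yosc => //; [exact: Htime|exact: iN|].
  by rewrite lexx andbT ler_wpM2r ?(ltW tau0)// ler_nat.
rewrite KT -/ec.
have -> : drift A kap tau U Mb = tau * V by rewrite /drift /V /kap; ring.
have gt := grid_total n K K0 By c V (ltW cp).
apply: (le_trans (ler_wpM2l (ltW ec0) gt)).
rewrite -/tau -/I2 -/Z mulrDr.
have h1 : ec * (2 * c * \int[mu]_(s in `]0, T[) (P n s ^+ 2)) <= delta ^+ 2 / 2.
  have cec : 0 < 2 * c * ec by rewrite mulr_gt0// mulr_gt0.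
  have := ler_wpM2l (ltW cec) (ltW Pn).
  have -> : 2 * c * ec * (delta ^+ 2 / (4 * c * ec)) = delta ^+ 2 / 2 by field; rewrite !gt_eqF.
  by apply: le_trans; rewrite mulrA [ec * _]mulrC.
have h2 : ec * (tau * Z) <= delta ^+ 2 / 2.
  have d2 : 0 < delta ^+ 2 by rewrite exprn_gt0.
  have h : tau * (2 * ec * Z / delta ^+ 2) <= 1 by apply: sm; rewrite /W; move: w1 w2 U0; lra.
  have -> : ec * (tau * Z) = tau * (2 * ec * Z / delta ^+ 2) * (delta ^+ 2 / 2) by field; exact: lt0r_neq0.
  by rewrite ler_piMl// divr_ge0// ltW.
by move: h1 h2; lra.
Qed.

End Discretization.

(** * Obstruction to density *)

Section SplinePairing.
Context {R : realType}.
Notation mu := (@lebesgue_measure R).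
Notation I01 := (@I01 R).

Definition spline (phi : nat -> R) (n N : nat) (x : R) : R :=
  \sum_(i < N) phi i * nodal n%:R i.-1 x.

Lemma spline_continuous (phi : nat -> R) (n N : nat) : continuous (spline phi n N).
Proof.
elim: N => [|N IH].
  have -> : spline phi n 0 = fun=> 0 by apply/funext => x; rewrite /spline big_ord0.
  exact: contC.
have -> : spline phi n N.+1 = fun x => spline phi n N x + phi N * nodal n%:R N.-1 x.
  by apply/funext => x; rewrite /spline big_ord_recr.
by apply: contD => //; apply: contM; [exact: contC|exact: nodal_continuous].
Qed.

Lemma spline_sqint (phi : nat -> R) (n N : nat) : sqint mu I01 (spline phi n N).
Proof. by apply: continuous_sqint; exact: spline_continuous. Qed.

Lemma spline_pairing (f : R -> R) (phi : nat -> R) (n N : nat) : sqint mu I01 f ->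
  \sum_(i < N) phi i * node_avg f n i = n%:R * \int[mu]_(x in I01) (f x * spline phi n N x).
Proof.
move=> sf; elim: N => [|N IH].
  rewrite big_ord0 (eq_Rint_in mu I01 _ (fun=> 0)) ?Rint_cst_I ?mulr0// => x _.
  by rewrite /spline big_ord0 mulr0.
rewrite big_ord_recr /= IH /node_avg.
have r1 : rint mu I01 (fun x => f x * spline phi n N x).
  exact: (@sqintM _ _ _ mu _ _ _ measurable_I01 sf (spline_sqint _ _ _)).
have sn : sqint mu I01 (nodal n%:R N.-1) := nodal_sqint n%:R N.-1.
have r2 : rint mu I01 (fun x => f x * nodal n%:R N.-1 x).
  exact: (@sqintM _ _ _ mu _ _ _ measurable_I01 sf sn).
have r3 := @rintZ _ _ _ mu _ _ (phi N) measurable_I01 r2.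
have -> : \int[mu]_(x in I01) (f x * spline phi n N.+1 x) =
  \int[mu]_(x in I01) (f x * spline phi n N x + phi N * (f x * nodal n%:R N.-1 x)).
  by apply: eq_Rint_in => x _; rewrite /spline big_ord_recr /=; ring.
rewrite (@RintegralD _ _ _ mu _ _ _ measurable_I01 r1 r3) (@RintegralZl _ _ _ mu _ _ _ measurable_I01 r2).
ring.
Qed.

Lemma spline_bound (phi : nat -> R) (n N : nat) (c x : R) : phi 0%N = 0 -> (forall i, 0 <= phi i <= c) ->
  0 <= spline phi n N x <= c.
Proof.
move=> p0 pc; have c0 : 0 <= c by have /andP[h1 h2] := pc 0%N; exact: le_trans h1 h2.
rewrite /spline; apply/andP; split.
  by apply: sumr_ge0 => i _; rewrite mulr_ge0 ?nodal_ge0//; have /andP[] := pc i.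
case: N => [|N]; first by rewrite big_ord0.
rewrite big_ord_recl p0 mul0r add0r /=.
apply: (@le_trans _ _ (c * \sum_(j < N) nodal n%:R j x)); last by rewrite ler_piMr// sum_nodal_le1.
rewrite mulr_sumr; apply: ler_sum => i _; apply: ler_wpM2r; first exact: nodal_ge0.
by have /andP[] := pc (lift ord0 i).
Qed.

Lemma spline_pairing_abs (f : R -> R) (phi : nat -> R) (n N : nat) (c : R) : sqint mu I01 f -> phi 0%N = 0 ->
  (forall i, 0 <= phi i <= c) ->
  `|\sum_(i < N) phi i * node_avg f n i| <= n%:R * (c * nrm mu I01 f).
Proof.
move=> sf p0 pc; have c0 : 0 <= c by have /andP[h1 h2] := pc 0%N; exact: le_trans h1 h2.
rewrite spline_pairing// normrM ger0_norm// ler_wpM2l//.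
have h := @cauchy_schwarz_nrm _ _ _ mu _ _ _ measurable_I01 sf (spline_sqint phi n N).
apply: (le_trans h); rewrite mulrC ler_wpM2r ?nrm_ge0//.
have sc : sqint mu I01 (fun=> c) := sqint_cst mu c measurable_I01 mu_I01_fin.
apply: (@le_trans _ _ (nrm mu I01 (fun=> c))).
  apply: (@nrm_le _ _ _ mu _ _ _ measurable_I01 (spline_sqint phi n N) sc) => x _.
  by have /andP[? ?] := spline_bound phi n N c x p0 pc; rewrite !ger0_norm.
by rewrite /nrm Rint_cst_I sqrtr_sqr ger0_norm.
Qed.

Lemma spline_ge (phi : nat -> R) (n N : nat) (c x : R) : phi 0%N = 0 -> 0 <= c -> (forall i, 0 <= phi i) ->
  (forall i, (0 < i)%N -> nodal n%:R i.-1 x != 0 -> c <= phi i) ->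
  2 <= n%:R * x -> n%:R * x <= N.-1%:R -> c <= spline phi n N x.
Proof.
move=> p0 c0 pp0 pc x2 xN; rewrite -[leLHS]mulr1 -(sum_nodal_eq1 _ _ _ x2 xN) mulr_sumr.
case: N xN => [|N] xN /=; first by rewrite big_ord0 /spline big_ord0.
rewrite /spline big_ord_recl p0 mul0r add0r /=; apply: ler_sum => i _.
have [->|nz] := eqVneq (nodal n%:R i x) 0; first by rewrite !mulr0.
by apply: ler_wpM2r; [exact: nodal_ge0|exact: pc].
Qed.

Lemma spline_pairing_ge (g : R -> R) (phi : nat -> R) (n N : nat) (c : R) : continuous g -> (forall x, 0 <= g x) ->
  (forall x, g x != 0 -> c <= spline phi n N x) ->
  n%:R * (c * \int[mu]_(x in I01) g x) <= \sum_(i < N) phi i * node_avg g n i.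
Proof.
move=> cg g0 gc; have sg := continuous_sqint g cg.
rewrite spline_pairing// ler_wpM2l//.
have rg := sqint_rint mu measurable_I01 mu_I01_fin sg.
rewrite -(@RintegralZl _ _ _ mu _ _ _ measurable_I01 rg).
apply: (@ae_le_Rint _ _ _ mu _ _ _ measurable_I01).
- exact: (@rintZ _ _ _ mu _ _ c measurable_I01 rg).
- exact: (@sqintM _ _ _ mu _ _ _ measurable_I01 sg (spline_sqint phi n N)).
- apply: nearW => x _; have [->|nz] := eqVneq (g x) 0; first by rewrite mulr0 mul0r.
  by rewrite mulrC ler_wpM2l// gc.
Qed.

Lemma node_avgB (f g : R -> R) (n i : nat) : sqint mu I01 f -> sqint mu I01 g ->
  node_avg (fun x => f x - g x) n i = node_avg f n i - node_avg g n i.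
Proof.
move=> sf sg; rewrite /node_avg -mulrBr.
have sn : sqint mu I01 (nodal n%:R i.-1) := nodal_sqint n%:R i.-1.
have r1 := @sqintM _ _ _ mu _ _ _ measurable_I01 sf sn.
have r2 := @sqintM _ _ _ mu _ _ _ measurable_I01 sg sn.
rewrite -(@RintegralB _ _ _ mu _ _ _ measurable_I01 r1 r2); congr (_ * _).
by apply: eq_Rint_in => x _; rewrite mulrBl.
Qed.

Lemma node_avg_eq0 (g : R -> R) (n i : nat) : (3 <= n)%N ->
  (forall x, i.-1%:R / n%:R <= x <= (i.-1%:R + 3) / n%:R -> g x = 0) -> node_avg g n i = 0.
Proof.
move=> n3 off; rewrite /node_avg (eq_Rint_in mu I01 _ (fun=> 0)) ?Rint_cst_I ?mulr0// => x _.
have [->|nz] := eqVneq (nodal n%:R i.-1 x) 0; first by rewrite mulr0.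
by rewrite off ?mul0r//; exact: nodal_supp nz.
Qed.

Lemma continuous_L2 (g : R -> R) : continuous g -> L2 g.
Proof.
move=> cg; have sg := continuous_sqint g cg; have [mg _] := sg.
rewrite /L2 inE; apply/andP; split.
  by rewrite inE /=; apply/measurable_fun_restrict => //; exact: measurable_I01.
rewrite inE /= /finite_norm.
by rewrite (sqint_Lnorm _ _ mu I01 g measurable_I01 sg) ltry.
Qed.

(** A point of (0,1) missed by the interval [omega] has all of [omega] on one side, so everything on
    its other side is missed as well. *)
Lemma interval_gap (omega : set R) : is_interval omega -> omega !=set0 -> omega `<=` I01 ->
  omega <> I01 -> exists p q : R, [/\ 0 <= p, p < q, q <= 1 & forall x, p < x -> x < q -> ~ omega x].
Proof.
move=> oi [z oz] os on.
have [x [xI xo]] : exists x, I01 x /\ ~ omega x.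
  apply: contrapT => h; apply: on; apply/seteqP; split=> // x xI.
  by apply: contrapT => xo; apply: h; exists x.
move: xI; rewrite /Defs.I01 /= in_itv/= => /andP[x0 x1].
have [zx|xz] := leP z x.
  exists x, 1; split=> //; first exact: ltW.
  move=> t xt _ ot; apply: xo; apply: (oi z t) => //; first by rewrite zx ltW.
exists 0, x; split=> //; first exact: ltW.
move=> t _ tx ot; apply: xo; apply: (oi t z) => //; by rewrite (ltW tx) ltW.
Qed.

End SplinePairing.

(** * Mass in the middle of the gap *)

Section MiddleMass.
Notation mu := (@lebesgue_measure _).
Notation I01 := (@I01 _).

(** The conclusion of [euler_approximation], isolated so that the estimate on the middle mass refers
    to the scheme alone. [X] comes after [n] and [Mb] because the conditions of [zone_flux] on the
    time step involve both. *)
Definition euler_approximable {R : realType} (A : R -> R) (T : R) (omega : set R) (y0 f : R -> R) : Prop :=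
  forall delta : R, 0 < delta -> exists n0, forall n, (n0 <= n)%N -> (3 <= n)%N ->
  exists2 Mb, 1 <= Mb & forall X : R, exists K (v : nat -> nat -> R),
  [/\ (0 < K)%N, T / K%:R * n%:R ^+ 2 * X <= 1,
    forall k i, (k <= K)%N -> 0 <= v k i <= Mb,
    forall k i, ~~ ((0 < i)%N && (i < n.-1)%N) -> v k i = 0 &
  [/\ forall i, (0 < i)%N -> (i < n.-1)%N -> v 0%N i = node_avg y0 n i,
    forall k i, (k < K)%N -> (0 < i)%N -> (i < n.-1)%N ->
      (forall x, i.-1%:R / n%:R <= x <= (i.-1%:R + 3) / n%:R -> ~ omega x) ->
      v k.+1 i = v k i + T / K%:R * n%:R ^+ 2 * lap (fun j => A (v k j)) i &
    forall phi : nat -> R, phi 0%N = 0 -> phi n.-1 = 0 ->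
      (forall i, (i < n.-1)%N -> `|dif phi i| <= 1) ->
      `|\sum_(i < n.-1) phi i * (node_avg f n i - v K i)| <= n%:R ^+ 2 * delta]].

Lemma node_range {R : realType} (n i : nat) (x : R) : (0 < n)%N -> (0 < i)%N ->
  i.-1%:R / n%:R <= x <= (i.-1%:R + 3) / n%:R -> i%:R - 1 <= n%:R * x /\ n%:R * x <= i%:R + 2.
Proof.
move=> n0; case: i => // i _ /=; have np : 0 < n%:R :> R by rewrite ltr0n.
rewrite ler_pdivrMr// ler_pdivlMr// -natr1 mulrC => /andP[h1 h2]; split; lra.
Qed.

(** The gap is measured in fifths: the target lives in the middle fifth, and the two zones are
    centred at one fifth and four fifths. [eps] and [B] are fixed before [y0], [f] and [g], hence
    before any control; this uniformity is the obstruction. *)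
Lemma middle_mass {R : realType} (a A : R -> R) (a0 L T : R) (omega : set R) (p q : R) :
  coefficient a a0 L -> A 0 = 0 -> (forall x : R, is_derive x (1 : R) A (a x)) -> 0 < T -> 0 <= p -> p < q -> q <= 1 ->
  (forall x, p < x -> x < q -> ~ omega x) ->
  exists eps B : R, [/\ 0 < eps, 0 <= B & forall y0 f g : R -> R,
    sqint mu I01 y0 -> sqint mu I01 f -> continuous g -> (forall x, 0 <= g x) ->
    (forall x, g x != 0 -> p + 2 / 5 * (q - p) <= x <= p + 3 / 5 * (q - p)) ->
    euler_approximable A T omega y0 f -> nrm mu I01 (fun x => f x - g x) <= eps ->
    (q - p) / 10 * \int[mu]_(x in I01) g x <= nrm mu I01 y0 + B].
Proof.
move=> ca A0 dA T0 p0 pq q1 off; pose l := q - p; have l0 : 0 < l by rewrite subr_gt0.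
have r0 : 0 < l / 480 by apply: divr_gt0; [exact: l0|rewrite ltr0n].
have a00 := coef0_gt0 _ _ _ ca; have L0 := coef_L _ _ _ ca.
have [eps1 [C [e10 C0 zone]]] := zone_flux _ _ _ _ ca A0 dA T (l / 480) T0 r0.
(* In the zones the mass of the scheme has two sources, the distance of [f] to the target and the
   error of the scheme; each may use half of [eps1]. *)
pose eps := Num.min (eps1 / 2) 1.
have e0 : 0 < eps by rewrite lt_min ltr01 divr_gt0.
have e1 : eps <= eps1 / 2 by rewrite ge_min lexx.
have e2 : eps <= 1 by rewrite ge_min lexx orbT.
(* [2 * C] is the flux through the two feet of the trapezoid; the remaining 2 covers the distance of
   [f] to [g] and the error of the scheme, each at most 1. *)
exists eps, (2 * C + 2); split=> //; first by rewrite addr_ge0// mulr_ge0.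
move=> y0 f g sy0 sf cg g0 gmid appr fg.
have sg := continuous_sqint g cg.
have sfg := @sqintB _ _ _ mu _ _ _ measurable_I01 sf sg.
have [n0 Hn] := appr eps e0.
(* Above 480 the truncation defining [m] loses at most half of [n * l / 240], hence the ratio
   [l / 480]; the same bound absorbs the few cells lost to rounding. *)
have [n [n0n n3 nl]] : exists n, [/\ (n0 <= n)%N, (3 <= n)%N & 500 <= n%:R * l].
  exists (maxn n0 (Num.truncn (500 / l)).+3); split; first exact: leq_maxl.
    by rewrite leq_max orbC.
  rewrite -ler_pdivrMr//; apply: (@le_trans _ _ (Num.truncn (500 / l)).+3%:R); last by rewrite ler_nat leq_maxr.
  have h := truncnS_gt (500 / l); apply: (le_trans (ltW h)); rewrite ler_nat; exact: leqW (leqW (leqnn _)).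
have nn0 : (0 < n)%N by exact: leq_trans n3.
have np : 0 < n%:R :> R by rewrite ltr0n.
have nnE : n%:R * q = n%:R * p + n%:R * l by rewrite /l; ring.
have nq : n%:R * p + n%:R * l <= n%:R by rewrite -nnE ler_piMr// ltW.
have npp : 0 <= n%:R * p by rewrite mulr_ge0// ltW.
have {}Hn := Hn n n0n n3.
have [Mb Mb1 HX] := Hn; have Mb0 : 0 <= Mb := le_trans ler01 Mb1.
pose N := n.-1; have nE : n = N.+1 by rewrite /N prednK.
have NR : N%:R = n%:R - 1 :> R by rewrite nE -natr1 addrK.
have aLM : 0 <= a 0 + L * Mb by rewrite addr_ge0 ?(ltW a00)// mulr_ge0.
(* Conditions on the time step: for the decay of the window mass, for the quadratic error of the
   concave truncation, and for the monotonicity of the scheme. *)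
pose X1 := 6 * (a 0 + L); pose X2 := 96 * T * N%:R ^+ 2 * ((a 0 + L * Mb) * A Mb ^+ 2).
pose X3 := 4 * (a 0 + L * Mb).
have X10 : 0 <= X1 by rewrite mulr_ge0// addr_ge0// ltW.
have X20 : 0 <= X2.
  apply: mulr_ge0; last by apply: mulr_ge0 => //; exact: sqr_ge0.
  by apply: mulr_ge0; [rewrite mulr_ge0// ltW|exact: sqr_ge0].
have X30 : 0 <= X3 by rewrite mulr_ge0.
have [K [v [K0 HK vb vout [vini vstep vphi]]]] := HX (X1 + X2 + X3).
pose tau := T / K%:R; have Kp : 0 < K%:R :> R by rewrite ltr0n.
have tau0 : 0 < tau by rewrite divr_gt0.
have KT : K%:R * tau = T by rewrite /tau mulrC divfK// gt_eqF.
pose kap := tau * n%:R ^+ 2; have kap0 : 0 <= kap by rewrite mulr_ge0 ?sqr_ge0// ltW.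
have sm x : x <= X1 + X2 + X3 -> kap * x <= 1 by move=> h; apply: le_trans HK; rewrite ler_wpM2l.
have v0 k : v k 0%N = 0 by rewrite vout.
have vN k : v k N = 0 by rewrite vout// ltnn andbF.
have cfl r s : 0 <= r -> r <= s -> s <= Mb -> 2 * kap * (A s - A r) <= s - r.
  move=> h1 h2 h3; apply: (prim_cfl _ _ _ _ ca dA Mb) => //; first by rewrite mulr_ge0.
  have -> : 2 * kap * (a 0 + L * Mb) = kap * (2 * (a 0 + L * Mb)) by ring.
  by apply: sm; move: X10 X20 aLM; rewrite /X3; clear; lra.
have offi i : (0 < i)%N -> n%:R * p + 1 < i%:R -> i%:R + 2 < n%:R * p + n%:R * l ->
    forall x, i.-1%:R / n%:R <= x <= (i.-1%:R + 3) / n%:R -> ~ omega x.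
  move=> i0 h1 h2 x /(node_range n i x nn0 i0)[x1 x2]; apply: off.
    by rewrite -(ltr_pM2l np); move: x1 h1; clear; lra.
  by rewrite -(ltr_pM2l np) nnE; move: x2 h2; clear; lra.
have goff i : (0 < i)%N -> (i%:R + 2 < n%:R * p + 2 / 5 * (n%:R * l)) || (n%:R * p + 3 / 5 * (n%:R * l) + 1 < i%:R) ->
    node_avg g n i = 0.
  move=> i0 h; apply: node_avg_eq0 => // x /(node_range n i x nn0 i0)[x1 x2].
  apply/eqP; apply: contraT => /gmid; rewrite -/l -(ler_pM2l np) -[X in _ && X](ler_pM2l np) => /andP[y1 y2].
  by case/orP: h => h; exfalso; move: h x1 x2 y1 y2; clear; lra.
(* The radius [24 * m] of a tent is then at most a tenth of the gap. *)
pose m := Num.truncn (n%:R * l / 240).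
have /andP[m1 m2] : m%:R <= n%:R * l / 240 < m%:R + 1.
  by rewrite natr1; apply: truncn_itv; rewrite divr_ge0 ?ler0n// mulr_ge0// ltW.
have m0 : (0 < m)%N by rewrite -(ltr_nat R); move: nl m2; clear; lra.
have rm : l / 480 * n%:R <= m%:R by move: nl m2; clear; lra.
have mb : 24 * m%:R <= n%:R * l / 10 by move: m1; clear; lra.
have M24 : 24 * m%:R = (24 * m)%:R :> R by rewrite natrM.
have M12 : 12 * m%:R = (12 * m)%:R :> R by rewrite natrM.
have {}nl : 100 <= n%:R * l by move: nl; clear; lra.
have mass i0 : (24 * m <= i0)%N -> (i0 + 24 * m <= N)%N ->
    (forall i, (i0 < i + 24 * m)%N -> (i < i0 + 24 * m)%N -> node_avg g n i = 0) ->
    \sum_(i < N) tent i0 (24 * m) i * v K i <= eps1 * n%:R ^+ 2.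
  move=> h1 h2 h3; have tz : tent i0 (24 * m) 0 = 0 :> R by rewrite tent_out// add0n h1.
  have tN : tent i0 (24 * m) N = 0 :> R by rewrite tent_out// h2 orbT.
  have := vphi (tent i0 (24 * m)) tz tN (fun i _ => tent_lip i0 (24 * m) i).
  rewrite -/N (eq_bigr (fun i : 'I_N => tent i0 (24 * m) i * node_avg (fun x => f x - g x) n i
      - tent i0 (24 * m) i * v K i)); last first.
    move=> i _; rewrite node_avgB//.
    have [hout|] := boolP ((i + 24 * m <= i0)%N || (i0 + 24 * m <= i)%N); first by rewrite tent_out// !mul0r subrr.
    by rewrite negb_or -!ltnNge => /andP[c1 c2]; rewrite h3//; ring.
  rewrite sumrB ler_norml => /andP[b1 _].
  have tb i : 0 <= (tent i0 (24 * m) i : R) <= n%:R.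
    have tl : tent i0 (24 * m) i <= (24 * m)%:R :> R := tent_le _ _ _.
    rewrite tent_ge0/=; apply: (le_trans tl); rewrite natrM; move: mb npp nq nl; clear; lra.
  have := spline_pairing_abs _ _ n N n%:R sfg tz tb; rewrite ler_norml => /andP[_ b2].
  have b3 : n%:R * (n%:R * nrm mu I01 (fun x => f x - g x)) <= n%:R ^+ 2 * eps.
    by rewrite mulrA -expr2 ler_wpM2l ?sqr_ge0.
  have b4 := ler_wpM2l (sqr_ge0 n%:R) e1 : _ <= _ :> R.
  move: b1 b2 b3 b4; move: (n%:R ^+ 2) (\sum_(i < N) _) (\sum_(i < N) _) => n2 s1 s2; clear; lra.
have step i0 : (24 * m <= i0)%N -> (i0 + 24 * m <= N)%N ->
    n%:R * p + 24 * m%:R + 1 < i0%:R -> i0%:R + 24 * m%:R + 2 < n%:R * p + n%:R * l ->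
    forall k i, (k < K)%N -> (i0 < i + 24 * m)%N -> (i < i0 + 24 * m)%N ->
    v k.+1 i = v k i + tau * n%:R ^+ 2 * lap (fun j => A (v k j)) i.
  move=> h1 h2 h3 h4 k i kK i1 i2; have i00 : (0 < i)%N by move: h1 i1; clear; lia.
  have iN : (i < n.-1)%N := leq_trans i2 h2.
  have j1 : i0%:R < i%:R + 24 * m%:R :> R by rewrite M24 -natrD ltr_nat.
  have j2 : i%:R < i0%:R + 24 * m%:R :> R by rewrite M24 -natrD ltr_nat.
  by apply: vstep => //; apply: offi => //; move: j1 j2 h3 h4; clear; lra.
have flux i0 : n%:R * p + 24 * m%:R + 1 < i0%:R -> i0%:R + 24 * m%:R + 2 < n%:R * p + n%:R * l ->
    (i0%:R + 24 * m%:R + 2 < n%:R * p + 2 / 5 * (n%:R * l)) || (n%:R * p + 3 / 5 * (n%:R * l) + 1 < i0%:R - 24 * m%:R) ->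
    exists i, [/\ i0%:R <= i%:R + 12 * m%:R :> R, i%:R <= i0%:R + 12 * m%:R :> R & \sum_(k < K) tau * A (v k i) <= C].
  move=> h1 h2 h3.
  have zl : (24 * m <= i0)%N by rewrite -(ler_nat R) natrM; move: h1 npp; clear; lra.
  have zr : (i0 + 24 * m <= N)%N by rewrite -(ler_nat R) natrD natrM NR; move: h2 nq; clear; lra.
  have hm : \sum_(i < N) tent i0 (24 * m) i * v K i <= eps1 * n%:R ^+ 2.
    apply: mass => // i i1 i2; have i00 : (0 < i)%N by move: zl i1; clear; lia.
    have j1 : i0%:R < i%:R + 24 * m%:R :> R by rewrite M24 -natrD ltr_nat.
    have j2 : i%:R < i0%:R + 24 * m%:R :> R by rewrite M24 -natrD ltr_nat.
    apply: goff => //.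
    by case/orP: h3 => h3; apply/orP; [left|right]; move: h3 j1 j2; clear; lra.
  have hX1 : kap * X1 <= 1 by apply: sm; move: X20 X30; clear; lra.
  have hX2 : kap * X2 <= 1 by apply: sm; move: X10 X30; clear; lra.
  have [i [i1 i2 i3]] := zone N K m i0 n%:R tau Mb v m0 zl zr np rm tau0 KT Mb1 vb v0 vN cfl
    (step i0 zl zr h1 h2) hX1 hX2 hm.
  by exists i; rewrite M12 -!natrD !ler_nat.
(* The tent centred at one fifth covers at most the part from one tenth to three tenths, inside the
   gap and to the left of the target. *)
have [iL [iL1 iL2 CL]] : exists i, [/\ n%:R * p + n%:R * l / 5 - 1 <= i%:R + 12 * m%:R,
    i%:R <= n%:R * p + n%:R * l / 5 + 12 * m%:R & \sum_(k < K) tau * A (v k i) <= C].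
  have x0 : 0 <= n%:R * p + n%:R * l / 5 by move: npp nl; clear; lra.
  have := truncn_itv x0; rewrite -[(Num.truncn _).+1%:R]natr1; set i0 := Num.truncn _ => /andP[t1 t2].
  have [||| i [i1 i2 i3]] := flux i0.
  - by move: t1 t2 mb nl; clear; lra.
  - by move: t1 t2 mb nl; clear; lra.
  - by apply/orP; left; move: t1 t2 mb nl; clear; lra.
  by exists i; split; [move: i1 t2; clear; lra|move: i2 t1; clear; lra|exact: i3].
(* The mirror image, centred at four fifths of the gap. *)
have [iR [iR1 iR2 CR]] : exists i, [/\ n%:R * p + 4 / 5 * (n%:R * l) - 1 <= i%:R + 12 * m%:R,
    i%:R <= n%:R * p + 4 / 5 * (n%:R * l) + 12 * m%:R & \sum_(k < K) tau * A (v k i) <= C].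
  have x0 : 0 <= n%:R * p + 4 / 5 * (n%:R * l) by move: npp nl; clear; lra.
  have := truncn_itv x0; rewrite -[(Num.truncn _).+1%:R]natr1; set i0 := Num.truncn _ => /andP[t1 t2].
  have [||| i [i1 i2 i3]] := flux i0.
  - by move: t1 t2 mb nl; clear; lra.
  - by move: t1 t2 mb nl; clear; lra.
  - by apply/orP; right; move: t1 t2 mb nl; clear; lra.
  by exists i; split; [move: i1 t2; clear; lra|move: i2 t1; clear; lra|exact: i3].
have LR : (iL < iR)%N by rewrite -(ltr_nat R); move: iL2 iR1 mb nl; clear; lra.
have RN : (iR < N)%N by rewrite -(ltr_nat R) NR; move: iR2 mb nl nq; clear; lra.
have tz : trap iL iR 0 = 0 :> R by rewrite trap_out.
have tN : trap iL iR N = 0 :> R by rewrite trap_out// (ltnW RN) orbT.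
have tb i : 0 <= (trap iL iR i : R) <= n%:R.
  rewrite trap_ge0 /trap /pospart ge_max ler0n/= ge_min; apply/orP; right.
  have : iR%:R <= N%:R :> R by rewrite ler_nat ltnW.
  by rewrite NR; have := ler0n R i; clear; lra.
have tf := trap_flux N K iL iR kap v (fun k i => A (v k i)) LR RN kap0.
have {}tf : \sum_(i < N) trap iL iR i * v K i <= \sum_(i < N) trap iL iR i * v 0%N i + n%:R ^+ 2 * (2 * C).
  apply: le_trans (tf _ _ _ _) _.
  - by move=> k; rewrite v0.
  - by move=> k; rewrite vN.
  - by move=> k i kK; apply: (prim_ge0 _ _ _ _ ca A0 dA); have /andP[] := vb k i (ltnW kK).
  - move=> k i kK i1 i2; have i00 : (0 < i)%N by exact: leq_ltn_trans i1.
    have iN : (i < n.-1)%N := ltn_trans i2 RN.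
    apply: vstep => //; move: i1 i2; rewrite -!(ltr_nat R) => j1 j2.
    by apply: offi => //; move: j1 j2 iL1 iR2 mb nl; clear; lra.
  rewrite lerD2l; have -> : \sum_(k < K) kap * (A (v k iL) + A (v k iR)) =
     n%:R ^+ 2 * (\sum_(k < K) tau * A (v k iL) + \sum_(k < K) tau * A (v k iR)).
    by rewrite -big_split /= mulr_sumr; apply: eq_bigr => k _; rewrite /kap; ring.
  by rewrite ler_wpM2l ?sqr_ge0//; move: CL CR; clear; lra.
have ini : \sum_(i < N) trap iL iR i * v 0%N i <= n%:R ^+ 2 * nrm mu I01 y0.
  have -> : \sum_(i < N) trap iL iR i * v 0%N i = \sum_(i < N) trap iL iR i * node_avg y0 n i.
    by apply: eq_bigr => -[[|i] iN] _ /=; [rewrite tz !mul0r|rewrite vini].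
  have := spline_pairing_abs y0 (trap iL iR) n N n%:R sy0 tz tb.
  by rewrite mulrA -expr2; apply: le_trans; exact: ler_norm.
have fin := vphi (trap iL iR) tz tN (fun i _ => trap_lip iL iR i).
(* The feet are within a twentieth of the gap from one fifth and four fifths, so over the middle
   fifth the trapezoid has height about [3 / 20 * (n * l)], and at least a tenth of [n * l] after
   rounding. *)
have low : n%:R * (n%:R * l / 10 * \int[mu]_(x in I01) g x) <= \sum_(i < N) trap iL iR i * node_avg g n i.
  apply: spline_pairing_ge => // x /gmid; rewrite -/l -(ler_pM2l np) -[X in _ && X](ler_pM2l np) => /andP[y1 y2].
  apply: spline_ge => //.
  - by move: nl; clear; lra.
  - by move=> i; have /andP[] := tb i.
  - move=> i i00 /(nodal_supp n n3)/(node_range n i x nn0 i00)[x1 x2].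
    rewrite trap_in.
    - by rewrite le_min; apply/andP; split; move: x1 x2 y1 y2 iL2 iR1 mb nl; clear; lra.
    - by rewrite -(ler_nat R); move: x1 x2 y1 y2 iL2 iR1 mb nl; clear; lra.
    - by rewrite -(ler_nat R); move: x1 x2 y1 y2 iL2 iR1 mb nl; clear; lra.
  - by move: y1 npp nl; clear; lra.
  - rewrite -subn1 natrB ?NR; last by move: RN; clear; lia.
    by move: y2 nq nl; clear; lra.
have dE : \sum_(i < N) trap iL iR i * node_avg f n i =
   \sum_(i < N) trap iL iR i * node_avg (fun x => f x - g x) n i + \sum_(i < N) trap iL iR i * node_avg g n i.
  by rewrite -big_split /=; apply: eq_bigr => i _; rewrite node_avgB//; ring.
have := spline_pairing_abs _ _ n N n%:R sfg tz tb; rewrite ler_norml => /andP[b2 _].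
have b3 : n%:R * (n%:R * nrm mu I01 (fun x => f x - g x)) <= n%:R ^+ 2 * eps.
  by rewrite mulrA -expr2 ler_wpM2l ?sqr_ge0.
move: fin; rewrite -/N (eq_bigr (fun i : 'I_N => trap iL iR i * node_avg f n i - trap iL iR i * v K i)); last first.
  by move=> i _; rewrite mulrBr.
rewrite sumrB dE ler_norml => /andP[_ b1].
have n2 : 0 < n%:R ^+ 2 :> R by rewrite exprn_gt0.
rewrite -(ler_pM2l n2) -/l.
have b5 := ler_wpM2l (ltW n2) e2.
have lowE : n%:R * (n%:R * l / 10 * \int[mu]_(x in I01) g x) = n%:R ^+ 2 * (l / 10 * \int[mu]_(x in I01) g x) by ring.
rewrite lowE in low; move: b1 b2 b3 b5 low ini tf.
move: (n%:R ^+ 2 * (l / 10 * _)) (\sum_(i < N) _) (\sum_(i < N) _) (\sum_(i < N) _) (\sum_(i < N) _).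
move=> u1 u2 u3 u4 u5; clear; lra.
Qed.

End MiddleMass.

Theorem theorem1p1 (R : realType) (a : R -> R)
  (a_C2 : Ck 2 a)
  (a_inf : (0 < ereal_inf (range (fun r => (a r)%:E)))%E)
  (a_sup : (ereal_sup
     (range (fun r => (Num.max `|a^`()%classic r| `|a^`(2)%classic r|)%:E)) < +oo)%E)
  (y0 : R -> R) (y0_L2plus : L2plus y0) (y0_neq0 : ~ L2zero y0)
  (omega : set R) (omega_open : open omega) (omega_itv : is_interval omega)
  (omega_neq0 : omega !=set0)
  (omega_sub : omega `<=` I01) (omega_proper : omega <> I01)
  (T : R) (T_gt0 : 0 < T) :
  ~ dense_in_L2plus (reachable a y0 omega T).
Proof.
move=> dens; have [a0 [L ca]] := coefficientP a a_C2 a_inf a_sup.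
have [A A0 dA] := continuous_antiderivative a (coef_continuous _ _ _ ca).
have [p [q [p0 pq q1 off]]] := interval_gap omega omega_itv omega_neq0 omega_sub omega_proper.
have [eps [B [eps0 B0 mid]]] := middle_mass a A a0 L T omega p q ca A0 dA T_gt0 p0 pq q1 off.
pose l := q - p; have l0 : 0 < l by rewrite subr_gt0.
have [y0L y0p] := y0_L2plus; have y0s := L2_sqint y0 y0L.
(* The target is one spline. Its support has three cells and starts at most one cell after the
   beginning of the middle fifth, so four cells must fit into a fifth of the gap; this is the
   constant 20. *)
have [k [k3 kl]] : exists k, (3 <= k)%N /\ 20 < k%:R * l.
  exists (Num.truncn (20 / l)).+3; split=> //; rewrite -ltr_pdivrMr//.
  by apply: (lt_le_trans (truncnS_gt _)); rewrite ler_nat; exact: leqW (leqW (leqnn _)).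
have kp : 0 < k%:R :> R by rewrite ltr0n (leq_trans _ k3).
have [j /andP[j1 j2]] : exists j : nat, k%:R * p + 2 / 5 * (k%:R * l) < j%:R <= k%:R * p + 2 / 5 * (k%:R * l) + 1.
  have x0 : 0 <= k%:R * p + 2 / 5 * (k%:R * l).
    by rewrite addr_ge0 ?mulr_ge0 ?(ltW kp) ?(ltW l0).
  exists (Num.truncn (k%:R * p + 2 / 5 * (k%:R * l))).+1.
  have /andP[h1 h2] := truncn_itv x0; rewrite h2 -[(Num.truncn _).+1%:R]natr1 lerD2r//.
have kq : k%:R * p + k%:R * l <= k%:R.
  by have -> : k%:R * p + k%:R * l = k%:R * q; [rewrite /l; ring|rewrite ler_piMr// ltW].
have jk : j%:R + 3 <= k%:R :> R by move: j2 kl kq; clear; lra.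
(* The height is chosen so that [l / 10] times the integral of [g] exceeds the bound of
   [middle_mass] by exactly 1. *)
pose H := 10 * k%:R / l * (nrm (@lebesgue_measure R) I01 y0 + B + 1).
have H0 : 0 <= H.
  apply: mulr_ge0; first by rewrite divr_ge0 ?(ltW l0)// mulr_ge0// ltW.
  by rewrite !addr_ge0// nrm_ge0.
pose g x := H * nodal k%:R j x.
have cg : continuous g by apply: contM; [exact: contC|exact: nodal_continuous].
have g0 x : 0 <= g x by rewrite mulr_ge0// nodal_ge0.
have gmid x : g x != 0 -> p + 2 / 5 * (q - p) <= x <= p + 3 / 5 * (q - p).
  rewrite mulf_eq0 negb_or => /andP[_ /(nodal_supp k k3)].
  rewrite ler_pdivrMr// ler_pdivlMr// [x * _]mulrC => /andP[x1 x2].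
  rewrite -/l -(ler_pM2l kp) -[X in _ && X](ler_pM2l kp); move: j1 j2 x1 x2 kl; clear => j1 j2 x1 x2 kl.
  by apply/andP; split; lra.
have gL : L2 g := continuous_L2 g cg.
have gplus : L2plus g by split=> //; apply: nearW => x _; exact: g0.
have [f [u [y [uinf [yx [yH yC yini weak]] fE]]] fg] := dens g gplus eps eps0.
have TT : `[0, T]%classic T by rewrite /= in_itv/= lexx ltW.
have fL : L2 f by rewrite fE; apply: (yC.1).
have mom : measurable (omega : set (measurableTypeR R)) by exact: open_measurable.
have [U [w [U0 mw wU wom uw]]] := control_representative T u omega mom uinf.
have [Cy Cy0 yCy] := CL2_bound T y (ltW T_gt0) yC.
have ys t : 0 <= t <= T -> sqint (@lebesgue_measure R) I01 (fun x => y (x, t)).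
  by move=> tT; apply: L2_sqint; apply: (yC.1); rewrite /= in_itv.
have Hti := time_identity _ _ _ _ ca A0 dA T y0 u omega y yx mom uinf yH weak U w mw wU uw.
have appr : euler_approximable A T omega y0 f.
  move=> dl dl0; rewrite fE.
  exact: (euler_approximation _ _ _ _ ca A0 dA T omega y yx T_gt0 yH U w U0 mw wU wom Cy Cy0 yCy y0 y0s y0p ys Hti dl dl0).
have nfg : nrm (@lebesgue_measure R) I01 (fun x => f x - g x) <= eps.
  by have := fg; rewrite distL2_nrm// lte_fin => /ltW.
have := mid y0 f g y0s (L2_sqint f fL) cg g0 gmid appr nfg.
have rn := nodal_rint k%:R j : rint (@lebesgue_measure R) I01 _.
rewrite (@RintegralZl _ _ _ (@lebesgue_measure R) _ _ _ measurable_I01 rn) Rint_nodal//.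
rewrite -/l; have -> : l / 10 * (H / k%:R) = nrm (@lebesgue_measure R) I01 y0 + B + 1.
  by rewrite /H; field; rewrite !gt_eqF.
by rewrite gerDl ler10.
Qed.
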